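(* Let $R$ be an associative unital algebra over $\mathbb C$ and let $L(z)$ be an $n\times n$ Lax matrix of $gl_n$-Gaudin type over $R$. For each $p\ge 1$ write $$\mathrm{Tr}\,S^p(\partial_z-L(z))=\sum_{k=0}^{p}c_{k,p}(z)\,\partial_z^k ,\qquad S_p(z):=(-1)^p c_{0,p}(z),$$ and let $QH_i(z)$ be defined by $\det^{column}(\partial_z-L(z))=\sum_{i=0}^nQH_i(z)\partial_z^i$. Then for all $k,p$ and all $z,u\in\mathbb C$ $$[S_k(z),S_p(u)]=0,\qquad [S_k(z),QH_p(u)]=0 .$$
   Context: An $n\times n$ matrix $L(z)$ with entries in $R((z))$ (or in $R((z^{-1}))$, or rational in $z$) is called a Lax matrix of $gl_n$-Gaudin type if $$[L_{ij}(u),L_{kl}(v)]=\frac{1}{u-v}\bigl(L_{il}(v)\delta_{jk}-L_{il}(u)\delta_{jk}-L_{kj}(v)\delta_{li}+L_{kj}(u)\delta_{li}\bigr)$$ for all $i,j,k,l$. Here $\partial_z-L(z)$ means $\partial_z\,\mathrm{Id}-L(z)$, with $\partial_z$ commuting with $R$ and $[\partial_z,f(z)]=f'(z)$. $\det^{column}N=\sum_{\sigma\in S_n}(-1)^\sigma N_{\sigma(1),1}\cdots N_{\sigma(n),n}$. For an $n\times n$ matrix $M$ with noncommuting entries, $$\mathrm{Tr}\,S^pM:=\frac1{p!}\sum_{1\le l_1,\dots,l_p\le n}\ \mathrm{perm}^{row}\bigl(M_{l_a,l_b}\bigr)_{a,b=1}^{p},\qquad \mathrm{perm}^{row}N=\sum_{\sigma\in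 S_p}N_{1,\sigma(1)}N_{2,\sigma(2)}\cdots N_{p,\sigma(p)}$$ (repeated indices $l_a$ are allowed). When $L(z)$ is a formal series, commutation of values at $z$ and $u$ is understood with independent formal variables, i.e. all coefficients commute. *)

(* Defs.v *)
From HB Require Import structures.
From mathcomp Require Import all_boot all_order all_fingroup all_algebra.
From mathcomp Require Import generic_quotient.
From mathcomp Require Import boolp classical_sets fsbigop reals.
From mathcomp Require Import complex.

Set Implicit Arguments.
Unset Strict Implicit.
Unset Printing Implicit Defensive.

Import Order.TTheory GRing.Theory Num.Theory.

Local Open Scope ring_scope.

Section NoncommutativeMatrices.

Definition bracket (A : pzRingType) (x y : A) : A := x * y - y * x.

(* Products over ordinals are taken in increasing order of the index. *)
Definition det_column (A : pzRingType) (n : nat) (N : 'M[A]_n) : A :=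
  \sum_(s : 'S_n) (-1) ^+ s * \prod_(i < n) N (s i) i.

Definition perm_row (A : pzRingType) (p : nat) (N : 'M[A]_p) : A :=
  \sum_(s : 'S_p) \prod_(i < p) N i (s i).

Definition tr_sym (F : fieldType) (A : lalgType F) (n p : nat) (M : 'M[A]_n) : A :=
  (p`!%:R : F)^-1 *:
    \sum_(l : {ffun 'I_p -> 'I_n}) perm_row (\matrix_(a, b) M (l a) (l b)).

End NoncommutativeMatrices.

Record derivation (F : fieldType) (A : algType F) := Derivation {
  der :> {linear A -> A};
  derM : forall x y, der (x * y) = der x * y + x * der y }.

(* The algebra of differential operators sum_k a_k D^k with coefficients a_k    *)
(* in A written on the left; it has the underlying module {poly A}, and the     *)
(* product determined by D * a = a * D + d a.                                   *)
Definition diffop (F : fieldType) (A : algType F) (d : derivation A) : Type :=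
  {poly A}.

Section DiffOp.
Variables (F : fieldType) (A : algType F) (d : derivation A).
Implicit Types (p q r : {poly A}) (a b : A).

(* Left multiplication by D *)
Definition lmulD p : {poly A} := p * 'X + map_poly d p.

Definition diffop_mul p q : {poly A} :=
  \sum_(i < size p) p`_i *: iter i lmulD q.

Lemma lmulD_is_additive : zmod_morphism lmulD.
Proof. by move=> p q; rewrite /lmulD mulrBl raddfB opprD addrACA. Qed.
HB.instance Definition _ :=
  GRing.isZmodMorphism.Build {poly A} {poly A} lmulD lmulD_is_additive.

Lemma lmulDZ a p : lmulD (a *: p) = a *: lmulD p + d a *: p.
Proof.
rewrite /lmulD -scalerAl scalerDr -addrA; congr (_ + _).
apply/polyP => i; rewrite coef_map /= !coefD !coefZ !coef_map /= derM addrC //.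
Qed.

Lemma iter_lmulDB i p q :
  iter i lmulD (p - q) = iter i lmulD p - iter i lmulD q.
Proof. by elim: i => //= i ->; rewrite raddfB. Qed.

Lemma iter_lmulD0 i : iter i lmulD 0 = 0.
Proof. by elim: i => //= i ->; rewrite raddf0. Qed.

Lemma iter_lmulDD i p q :
  iter i lmulD (p + q) = iter i lmulD p + iter i lmulD q.
Proof. by elim: i => //= i ->; rewrite raddfD. Qed.

Lemma diffop_mul_wide n p q : (size p <= n)%N ->
  diffop_mul p q = \sum_(i < n) p`_i *: iter i lmulD q.
Proof.
move=> le_pn; rewrite /diffop_mul (big_ord_widen n (fun i => p`_i *: iter i lmulD q)) //.
rewrite big_mkcond; apply: eq_bigr => i _; case: ltnP => // le_pi.
by rewrite nth_default // scale0r.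
Qed.

Lemma diffop_mulDl : left_distributive diffop_mul +%R.
Proof.
move=> p q r; set n := maxn (size p) (size q).
rewrite !(@diffop_mul_wide n) ?leq_maxl ?leq_maxr ?size_polyD // -big_split /=.
by apply: eq_bigr => i _; rewrite coefD scalerDl.
Qed.

Lemma diffop_mulDr : right_distributive diffop_mul +%R.
Proof.
move=> p q r; rewrite /diffop_mul -big_split /=.
by apply: eq_bigr => i _; rewrite iter_lmulDD scalerDr.
Qed.

Lemma diffop_mul0l q : diffop_mul 0 q = 0.
Proof. by rewrite /diffop_mul size_poly0 big_ord0. Qed.

Lemma diffop_mul0r q : diffop_mul q 0 = 0.
Proof. by rewrite /diffop_mul big1 // => i _; rewrite iter_lmulD0 scaler0. Qed.

Lemma diffop_mulZl a p q : diffop_mul (a *: p) q = a *: diffop_mul p q.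
Proof.
rewrite !(@diffop_mul_wide (size p)) ?size_scale_leq // scaler_sumr.
by apply: eq_bigr => i _; rewrite coefZ scalerA.
Qed.

Lemma diffop_mul_suml (I : Type) (r : seq I) (P : pred I) (f : I -> {poly A}) q :
  diffop_mul (\sum_(i <- r | P i) f i) q = \sum_(i <- r | P i) diffop_mul (f i) q.
Proof.
by elim/big_rec2: _ => [|i x y _ <-]; rewrite ?diffop_mul0l ?diffop_mulDl.
Qed.

Lemma diffop_mulXn n q : diffop_mul 'X^n q = iter n lmulD q.
Proof.
rewrite (@diffop_mul_wide n.+1) ?size_polyXn // big_ord_recr /= coefXn eqxx.
rewrite scale1r big1 ?add0r // => i _.
by rewrite coefXn (ltn_eqF (ltn_ord i)) scale0r.
Qed.

Lemma der1 : d 1 = 0.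
Proof.
have := derM d 1 1; rewrite !mulr1 mul1r => /eqP.
by rewrite -subr_eq0 opprD addrA subrr sub0r oppr_eq0 => /eqP.
Qed.

Lemma lmulDXn i : lmulD 'X^i = 'X^(i.+1).
Proof.
rewrite /lmulD -exprSr (_ : map_poly d _ = 0) ?addr0 //.
apply/polyP => j; rewrite coef_map /= coefXn coef0.
by case: eqP => _; [exact: der1 | exact: raddf0].
Qed.

Lemma lmulD_sum (I : Type) (r : seq I) (P : pred I) (f : I -> {poly A}) :
  lmulD (\sum_(i <- r | P i) f i) = \sum_(i <- r | P i) lmulD (f i).
Proof. exact: raddf_sum. Qed.

Lemma diffop_mul_lmulD p q : diffop_mul (lmulD p) q = lmulD (diffop_mul p q).
Proof.
rewrite -[p]coefK poly_def lmulD_sum !diffop_mul_suml lmulD_sum.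
apply: eq_bigr => i _; rewrite lmulDZ diffop_mulDl !diffop_mulZl lmulDZ.
by rewrite lmulDXn !diffop_mulXn.
Qed.

Lemma diffop_mulA : associative diffop_mul.
Proof.
move=> p q r; rewrite {2}/diffop_mul diffop_mul_suml {1}/diffop_mul.
apply: eq_bigr => i _; rewrite diffop_mulZl; congr (_ *: _).
by elim: (nat_of_ord i) => //= j ->; rewrite diffop_mul_lmulD.
Qed.

Lemma diffop_mul1l : left_id 1 diffop_mul.
Proof. by move=> q; rewrite -[1]/('X^0 : {poly A}) diffop_mulXn. Qed.

Lemma diffop_mul1r : right_id 1 diffop_mul.
Proof.
move=> q; rewrite -[RHS]coefK poly_def; apply: eq_bigr => i _.
congr (_ *: _); elim: (nat_of_ord i) => [|j /= ->]; first by rewrite expr0.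
exact: lmulDXn.
Qed.

HB.instance Definition _ := GRing.Zmodule.on (diffop d).
HB.instance Definition _ := GRing.Zmodule_isNzRing.Build (diffop d)
  diffop_mulA diffop_mul1l diffop_mul1r diffop_mulDl diffop_mulDr
  (oner_neq0 {poly A}).

Definition diffop_scale (c : F) (p : diffop d) : diffop d :=
  (c%:A : A) *: (p : {poly A}).

Lemma diffop_scaleA c e p :
  diffop_scale c (diffop_scale e p) = diffop_scale (c * e) p.
Proof. by rewrite /diffop_scale scalerA -scalerAl mul1r scalerA. Qed.
Lemma diffop_scale1 : left_id 1 diffop_scale.
Proof. by move=> p; rewrite /diffop_scale !scale1r. Qed.
Lemma diffop_scaleDr : right_distributive diffop_scale +%R.
Proof. by move=> c p q; rewrite /diffop_scale scalerDr. Qed.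
Lemma diffop_scaleDl p : {morph diffop_scale^~ p : c e / c + e}.
Proof. by move=> c e; rewrite /diffop_scale !scalerDl. Qed.

HB.instance Definition _ := GRing.Zmodule_isLmodule.Build F (diffop d)
  diffop_scaleA diffop_scale1 diffop_scaleDr diffop_scaleDl.

Lemma diffop_scaleAl (c : F) (p q : diffop d) : c *: (p * q) = (c *: p) * q.
Proof. by rewrite /GRing.scale /= /diffop_scale -diffop_mulZl. Qed.
HB.instance Definition _ :=
  GRing.Lmodule_isLalgebra.Build F (diffop d) diffop_scaleAl.

Definition dop_const (a : A) : diffop d := a%:P.
Definition dop_D : diffop d := ('X : {poly A}).
Definition dop_coef (k : nat) (p : diffop d) : A := (p : {poly A})`_k.

Lemma dop_constM (a : A) (p : diffop d) : dop_const a * p = a *: (p : {poly A}).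
Proof.
have -> : dop_const a = a *: (1 : {poly A}) :> {poly A} by rewrite alg_polyC.
by rewrite /GRing.mul /= diffop_mulZl diffop_mul1l.
Qed.

Lemma dop_DM (a : A) :
  dop_D * dop_const a = dop_const a * dop_D + dop_const (d a).
Proof.
rewrite dop_constM {1}/GRing.mul /= -[dop_D]/('X^1 : {poly A}) diffop_mulXn /=.
by rewrite /lmulD /dop_const map_polyC mul_polyC.
Qed.

Lemma dop_scaleAr (c : F) (p q : diffop d) : c *: (p * q) = p * (c *: q).
Proof.
suff cL i (r : {poly A}) :
    iter i lmulD ((c%:A : A) *: r) = (c%:A : A) *: iter i lmulD r.
  rewrite /GRing.scale /= /diffop_scale /GRing.mul /= /diffop_mul scaler_sumr.
  apply: eq_bigr => i _; rewrite cL !scalerA.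
  by rewrite -[c%:A * _]scalerAl -[_ * c%:A]scalerAr mul1r mulr1.
elim: i => //= i ->; rewrite lmulDZ linearZ_LR /=.
by rewrite der1 scaler0 scale0r addr0.
Qed.
HB.instance Definition _ :=
  GRing.Lalgebra_isAlgebra.Build F (diffop d) dop_scaleAr.

Lemma diffopE (p : diffop d) :
  p = \sum_(k < size (p : {poly A})) dop_const (dop_coef k p) * dop_D ^+ k.
Proof.
have DXn k : dop_D ^+ k = 'X^k :> {poly A}.
  elim: k => [|k IH]; first by rewrite !expr0.
  by rewrite exprS IH -[dop_D]/('X^1 : {poly A}) {1}/GRing.mul /= diffop_mulXn /= lmulDXn.
rewrite -{1}[p : {poly A}]coefK poly_def; apply: eq_bigr => k _.
by rewrite dop_constM DXn.
Qed.

End DiffOp.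

(* Formal Laurent series sum_m f_m w^m over R, with finitely many negative     *)
(* exponents; w is z for R((z)) and z^-1 for R((z^-1)).                         *)
Definition lbounded (R : nzRingType) (f : int -> R) (N : int) : Prop :=
  forall m, m < N -> f m = 0.

Record laurent (R : nzRingType) := Laurent {
  lcoef :> int -> R;
  lcoefP : exists N, lbounded lcoef N }.

HB.instance Definition _ (R : nzRingType) := gen_eqMixin (laurent R).
HB.instance Definition _ (R : nzRingType) := gen_choiceMixin (laurent R).

Section LaurentRing.
Variable R : nzRingType.
Implicit Types (f g h : laurent R) (m N : int).

Lemma laurentP f g : (forall m, f m = g m) -> f = g.
Proof.
case: f g => [f Pf] [g Pg] /= fg; have {}fg : f = g by apply/funext.
by subst g; congr Laurent; exact: Prop_irrelevance.
Qed.

Lemma lboundedW (F : int -> R) N N' : N' <= N -> lbounded F N -> lbounded F N'.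
Proof. by move=> le_N bF m ltm; apply: bF; exact: lt_le_trans le_N. Qed.

Lemma le_addnat N m : N <= m -> exists k : nat, m = N + k%:Z.
Proof.
by move=> leNm; exists `|m - N|%N; rewrite gez0_abs ?subr_ge0 // addrCA subrr addr0.
Qed.

Lemma lcommon f g : exists N, lbounded f N /\ lbounded g N.
Proof.
have [[N bN] [M bM]] := (lcoefP f, lcoefP g); exists (Num.min N M).
by split; [apply: lboundedW bN | apply: lboundedW bM]; rewrite ge_min lexx ?orbT.
Qed.

Fact lzero_subproof : exists N, lbounded (fun=> 0 : R) N.
Proof. by exists 0. Qed.
Definition lzero := Laurent lzero_subproof.

Fact lopp_subproof f : exists N, lbounded (fun m => - f m) N.
Proof. by have [N bN] := lcoefP f; exists N => m /bN ->; rewrite oppr0. Qed.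
Definition lopp f := Laurent (lopp_subproof f).

Fact ladd_subproof f g : exists N, lbounded (fun m => f m + g m) N.
Proof.
by have [N [bf bg]] := lcommon f g; exists N => m ltm; rewrite bf ?bg ?addr0.
Qed.
Definition ladd f g := Laurent (ladd_subproof f g).

Fact laddA : associative ladd.
Proof. by move=> f g h; apply: laurentP => m /=; rewrite addrA. Qed.
Fact laddC : commutative ladd.
Proof. by move=> f g; apply: laurentP => m /=; rewrite addrC. Qed.
Fact ladd0 : left_id lzero ladd.
Proof. by move=> f; apply: laurentP => m /=; rewrite add0r. Qed.
Fact laddN : left_inverse lzero lopp ladd.
Proof. by move=> f; apply: laurentP => m /=; rewrite addNr. Qed.

HB.instance Definition _ :=
  GRing.isZmodule.Build (laurent R) laddA laddC ladd0 laddN.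

(* The sum has finite support. *)
Definition lmul_fun (F G : int -> R) (m : int) : R :=
  \sum_(i \in [set: int]) F i * G (m - i).

Lemma lmul_funE (F G : int -> R) N M (K : nat) m :
  lbounded F N -> lbounded G M -> m < N + M + K%:Z ->
  lmul_fun F G m = \sum_(k < K) F (N + k%:Z) * G (m - (N + k%:Z)).
Proof.
move=> bF bG ltm.
rewrite -(big_mkord xpredT (fun k : nat => F (N + k%:Z) * G (m - (N + k%:Z)))).
rewrite /index_iota subn0.
rewrite -(big_map (fun k : nat => N + k%:Z) xpredT (fun i => F i * G (m - i))).
rewrite /lmul_fun (@fsbigE _ _ _ _ _ [seq N + k%:Z | k <- iota 0 K]) //=.
- by apply: eq_bigl => i; rewrite in_setT.
- by rewrite map_inj_uniq ?iota_uniq // => i j /addrI [].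
- move=> i _ /negP notr; case: (ltP i N) => [/bF -> | leNi]; first by rewrite mul0r.
rewrite bG ?mulr0 //.
have [k Ek] := le_addnat leNi.
rewrite ltNge; apply/negP => leM; apply: notr.
rewrite Ek; apply: map_f; rewrite mem_iota add0n leq0n /= -ltz_nat.
rewrite -(ltrD2l (N + M)); apply: le_lt_trans ltm.
by rewrite addrAC -lerBrDl -Ek.
Qed.

Lemma lmul_bounded (F G : int -> R) N M :
  lbounded F N -> lbounded G M -> lbounded (lmul_fun F G) (N + M).
Proof.
by move=> bF bG m ltm; rewrite (@lmul_funE _ _ N M 0) ?big_ord0 ?addr0.
Qed.

Fact lmul_subproof f g : exists N, lbounded (lmul_fun f g) N.
Proof.
by have [[N bN] [M bM]] := (lcoefP f, lcoefP g); exists (N + M); exact: lmul_bounded.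
Qed.
Definition lmul f g := Laurent (lmul_subproof f g).

Fact lone_subproof : exists N, lbounded (fun m => (m == 0)%:R : R) N.
Proof. by exists 0 => m ltm; rewrite lt_eqF. Qed.
Definition lone := Laurent lone_subproof.

Lemma lt_absS N m : m < N + (`|m - N|%N.+1)%:Z.
Proof.
by rewrite -ltrBlDl; apply: le_lt_trans (ler_norm _) _; rewrite -abszE ltz_nat.
Qed.

Fact lmulDl : left_distributive lmul +%R.
Proof.
move=> f g h; apply: laurentP => m /=.
have [[N [bf bg]] [M bh]] := (lcommon f g, lcoefP h).
have bfg : lbounded (fun m => f m + g m) N by move=> i lti; rewrite bf ?bg ?addr0.
pose K := (absz (m - (N + M))%R).+1.
have ltm : m < (N + M) + K%:Z := lt_absS _ _.
rewrite !(@lmul_funE _ _ N M K) // -big_split /=.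
by apply: eq_bigr => k _; rewrite mulrDl.
Qed.

Fact lmulDr : right_distributive lmul +%R.
Proof.
move=> h f g; apply: laurentP => m /=.
have [[N [bf bg]] [M bh]] := (lcommon f g, lcoefP h).
have bfg : lbounded (fun m => f m + g m) N by move=> i lti; rewrite bf ?bg ?addr0.
pose K := (absz (m - (M + N))%R).+1.
have ltm : m < (M + N) + K%:Z := lt_absS _ _.
rewrite !(@lmul_funE _ _ M N K) // -big_split /=.
by apply: eq_bigr => k _; rewrite mulrDr.
Qed.

Lemma lmul_poly (F G : int -> R) N M (K k : nat) :
  lbounded F N -> lbounded G M -> (k < K)%N ->
  lmul_fun F G (N + M + k%:Z) =
  (\poly_(i < K) F (N + i%:Z) * \poly_(i < K) G (M + i%:Z))`_k.
Proof.
move=> bF bG ltkK; rewrite (@lmul_funE _ _ N M k.+1) ?ltrD2l ?ltz_nat //.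
rewrite coefM; apply: eq_bigr => j _; have lejk : (j <= k)%N by rewrite -ltnS.
rewrite !coef_poly (leq_ltn_trans lejk ltkK) (leq_ltn_trans (leq_subr _ _) ltkK).
by congr (_ * G _); rewrite -subzn // opprD addrACA [N + M]addrC addrK.
Qed.

Fact lmulA : associative lmul.
Proof.
move=> f g h; apply: laurentP => m /=.
have [[N bf] [[M bg] [P bh]]] := (lcoefP f, (lcoefP g, lcoefP h)).
have bfg := lmul_bounded bf bg; have bgh := lmul_bounded bg bh.
case: (ltP m (N + M + P)) => [ltm | lem].
  by rewrite (lmul_bounded bf bgh) ?(lmul_bounded bfg bh) ?addrA.
have [k ->] := le_addnat lem.
rewrite (lmul_poly bfg bh (ltnSn k)) -(addrA N M P) (lmul_poly bf bgh (ltnSn k)).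
set pf := \poly_(i < _) f _; set pg := \poly_(i < k.+1) g (M + i%:Z).
set ph := \poly_(i < _) h _.
transitivity ((pf * (pg * ph))`_k); last rewrite mulrA.
  rewrite !coefM; apply: eq_bigr => j _; congr (_ * _); rewrite coef_poly.
  by rewrite ltnS leq_subr (@lmul_poly _ _ M P k.+1 _ bg bh) // ltnS leq_subr.
rewrite !coefM; apply: eq_bigr => j _; congr (_ * _); rewrite coef_poly.
by rewrite ltn_ord (lmul_poly bf bg (ltn_ord j)).
Qed.

Fact lmul1 : left_id lone lmul.
Proof.
move=> f; apply: laurentP => m /=; have [N bf] := lcoefP f.
have b1 : lbounded (fun m => (m == 0)%:R : R) 0 by move=> i /lt_eqF ->.
pose K := (absz (m - N)%R).+1.
have ltm : m < 0 + N + K%:Z by rewrite add0r; exact: lt_absS.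
rewrite (lmul_funE b1 bf ltm) big_ord_recl big1 => [|i _].
  by rewrite /= !add0r subr0 mul1r addr0.
by rewrite add0r mul0r.
Qed.

Fact lmulr1 : right_id lone lmul.
Proof.
move=> f; apply: laurentP => m /=; have [N bf] := lcoefP f.
have b1 : lbounded (fun m => (m == 0)%:R : R) 0 by move=> i /lt_eqF ->.
have [ltm | lem] := ltP m N.
  by rewrite (lmul_bounded bf b1) ?addr0 // bf.
have [k Ek] := le_addnat lem.
rewrite (@lmul_funE _ _ N 0 k.+1) ?addr0 // ?Ek ?ltrD2l ?ltz_nat //.
rewrite big_ord_recr /= subrr eqxx mulr1 big1 ?add0r // => i _.
rewrite subr_eq0 (inj_eq (addrI _)) eqz_nat gtn_eqF ?mulr0 //.
Qed.

Fact lone_neq0 : lone != lzero.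
Proof.
by apply/eqP => /(congr1 (fun f : laurent R => f 0)) /= /eqP; rewrite oner_eq0.
Qed.

HB.instance Definition _ := GRing.Zmodule_isNzRing.Build (laurent R)
  lmulA lmul1 lmulr1 lmulDl lmulDr lone_neq0.

End LaurentRing.

Section LaurentAlgebra.
Variables (F : fieldType) (R : algType F).
Implicit Types (f g : laurent R) (c : F) (m : int).

Fact lscale_subproof c f : exists N, lbounded (fun m => c *: f m) N.
Proof. by have [N bN] := lcoefP f; exists N => m /bN ->; rewrite scaler0. Qed.
Definition lscale c f : laurent R := Laurent (lscale_subproof c f).

Fact lscaleA c e f : lscale c (lscale e f) = lscale (c * e) f.
Proof. by apply: laurentP => m /=; rewrite scalerA. Qed.
Fact lscale1 : left_id 1 lscale.
Proof. by move=> f; apply: laurentP => m /=; rewrite scale1r. Qed.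
Fact lscaleDr : right_distributive lscale +%R.
Proof. by move=> c f g; apply: laurentP => m /=; rewrite scalerDr. Qed.
Fact lscaleDl f : {morph lscale^~ f : c e / c + e}.
Proof. by move=> c e; apply: laurentP => m /=; rewrite scalerDl. Qed.
HB.instance Definition _ := GRing.Zmodule_isLmodule.Build F (laurent R)
  lscaleA lscale1 lscaleDr lscaleDl.

Fact lscaleAl c f g : c *: (f * g) = (c *: f) * g.
Proof.
apply: laurentP => m /=; have [[N bf] [M bg]] := (lcoefP f, lcoefP g).
have bcf : lbounded (fun m => c *: f m) N by move=> i /bf ->; rewrite scaler0.
pose K := (absz (m - (N + M))%R).+1.
have ltm : m < (N + M) + K%:Z := lt_absS _ _.
rewrite (lmul_funE bf bg ltm) (lmul_funE bcf bg ltm) scaler_sumr.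
by apply: eq_bigr => i _; rewrite scalerAl.
Qed.
HB.instance Definition _ :=
  GRing.Lmodule_isLalgebra.Build F (laurent R) lscaleAl.

Fact lscaleAr c f g : c *: (f * g) = f * (c *: g).
Proof.
apply: laurentP => m /=; have [[N bf] [M bg]] := (lcoefP f, lcoefP g).
have bcg : lbounded (fun m => c *: g m) M by move=> i /bg ->; rewrite scaler0.
pose K := (absz (m - (N + M))%R).+1.
have ltm : m < (N + M) + K%:Z := lt_absS _ _.
rewrite (lmul_funE bf bg ltm) (lmul_funE bf bcg ltm) scaler_sumr.
by apply: eq_bigr => i _; rewrite scalerAr.
Qed.
HB.instance Definition _ :=
  GRing.Lalgebra_isAlgebra.Build F (laurent R) lscaleAr.

(* The coefficient of z^m, where w = z^-1 if inv holds and w = z otherwise. *)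
Definition zcoef (inv : bool) f m : R := f (if inv then - m else m).

(* d/dz is d/dw when w = z, and - w^2 d/dw when w = z^-1. *)
Definition lderiv_fun (inv : bool) f m : R :=
  let s : int := (-1) ^+ inv in f (m + s) *~ (s * (m + s)).

Fact lderiv_subproof inv f : exists N, lbounded (lderiv_fun inv f) N.
Proof.
have [N bf] := lcoefP f; exists (N - (-1) ^+ inv) => m ltm.
by rewrite /lderiv_fun bf ?mul0rz // -ltrBrDr.
Qed.
Definition lderiv inv f : laurent R := Laurent (lderiv_subproof inv f).

Lemma zcoef_lderiv inv f m :
  zcoef inv (lderiv inv f) m = zcoef inv f (m + 1) *~ (m + 1).
Proof.
rewrite /zcoef /= /lderiv_fun; case: inv; rewrite ?mul1r //=.
by rewrite expr1 -opprD mulN1r opprK.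
Qed.

Fact lderiv_linear inv : linear (lderiv inv).
Proof.
move=> c f g; apply: laurentP => m /=; rewrite /lderiv_fun /=.
by rewrite mulrzDl scalerMzr.
Qed.
HB.instance Definition _ inv :=
  GRing.isLinear.Build F (laurent R) (laurent R) _ (lderiv inv)
    (lderiv_linear inv).

Fact lderivM inv f g :
  lderiv inv (f * g) = lderiv inv f * g + f * lderiv inv g.
Proof.
apply: laurentP => m /=; have [[N bf] [M bg]] := (lcoefP f, lcoefP g).
set s : int := (-1) ^+ inv.
have bdf : lbounded (lderiv inv f) (N - s).
  by move=> i lti; rewrite /= /lderiv_fun bf ?mul0rz // -ltrBrDr.
have bdg : lbounded (lderiv inv g) (M - s).
  by move=> i lti; rewrite /= /lderiv_fun bg ?mul0rz // -ltrBrDr.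
pose K := (absz (m + s - (N + M))%R).+1.
have ltm : m + s < (N + M) + K%:Z := lt_absS _ _.
have ltm1 : m < N - s + M + K%:Z by rewrite (addrAC N) (addrAC (N + M)) ltrBrDr.
have ltm2 : m < N + (M - s) + K%:Z by rewrite addrA (addrAC (N + M)) ltrBrDr.
rewrite {1}/lderiv_fun -/s /= (lmul_funE bf bg ltm) (lmul_funE bdf bg ltm1).
rewrite (lmul_funE bf bdg ltm2) -big_split /= mulrz_suml; apply: eq_bigr => k _.
rewrite /lderiv_fun -/s mulrzAl mulrzAr.
have -> : N - s + k%:Z + s = N + k%:Z by rewrite addrAC subrK.
have -> : m - (N - s + k%:Z) = m + s - (N + k%:Z).
  by rewrite (addrAC N) opprB addrA.
have -> : m - (N + k%:Z) + s = m + s - (N + k%:Z) by rewrite addrAC.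
rewrite -mulrzDr -mulrDr; congr (_ *~ (_ * _)).
by rewrite [RHS]addrCA subrr addr0.
Qed.

Definition laurent_dz (inv : bool) : derivation (laurent R) :=
  Derivation (lderivM inv).

End LaurentAlgebra.

(* R-valued rational functions over F, that is the localization of R[z] at the *)
(* nonzero elements of F[z], which are central in R[z].                         *)
Section RationalFunctions.
Variables (F : fieldType) (R : algType F).
Local Open Scope quotient_scope.

Definition polyA (q : {poly F}) : {poly R} := map_poly (in_alg R) q.

Lemma polyA_inj : injective polyA.
Proof. exact: map_poly_inj. Qed.

Lemma polyAM q q' : polyA (q * q') = polyA q * polyA q'.
Proof. exact: rmorphM. Qed.

Lemma polyA1 : polyA 1 = 1.
Proof. exact: rmorph1. Qed.

Lemma polyAC (q : {poly F}) (P : {poly R}) : polyA q * P = P * polyA q.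
Proof.
apply/polyP => k; rewrite coefM coefMr; apply: eq_bigr => i _.
by rewrite coef_map /= -scalerAl -scalerAr mul1r mulr1.
Qed.

Lemma polyA_reg (q : {poly F}) (P P' : {poly R}) :
  q != 0 -> P * polyA q = P' * polyA q -> P = P'.
Proof.
move=> q0; apply: rreg_lead; rewrite lead_coef_map /= => x y.
rewrite -!scalerAr !mulr1; apply: scalerI.
by rewrite lead_coef_eq0.
Qed.

Lemma polyAAC (q s : {poly F}) (P : {poly R}) :
  P * polyA q * polyA s = P * polyA s * polyA q.
Proof. by rewrite -!mulrA polyAC. Qed.

Record ratio_rep := RatioRep {
  rep :> {poly R} * {poly F};
  rep_den : rep.2 != 0 }.
HB.instance Definition _ := [isSub for rep].
HB.instance Definition _ := [Choice of ratio_rep by <:].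

Definition ratio_rep0 : ratio_rep :=
  @RatioRep (0, 1) (oner_neq0 _).
Definition mk_rep (P : {poly R}) (q : {poly F}) : ratio_rep :=
  insubd ratio_rep0 (P, q).

Lemma mk_repE P q : q != 0 -> rep (mk_rep P q) = (P, q).
Proof. by move=> q0; rewrite /mk_rep val_insubd /= q0. Qed.

Definition eqv_rep (x y : ratio_rep) : bool :=
  x.1 * polyA y.2 == y.1 * polyA x.2.

Fact eqv_rep_refl : reflexive eqv_rep.
Proof. by move=> x; rewrite /eqv_rep. Qed.
Fact eqv_rep_sym : symmetric eqv_rep.
Proof. by move=> x y; rewrite /eqv_rep eq_sym. Qed.
Fact eqv_rep_trans : transitive eqv_rep.
Proof.
move=> y x z /eqP exy /eqP eyz; apply/eqP; apply: (polyA_reg (rep_den y)).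
by rewrite polyAAC exy polyAAC eyz polyAAC.
Qed.

Canonical eqv_rep_equiv :=
  EquivRel eqv_rep eqv_rep_refl eqv_rep_sym eqv_rep_trans.

Definition ratfun := {eq_quot eqv_rep}.
HB.instance Definition _ : EqQuotient _ eqv_rep ratfun := EqQuotient.on ratfun.
HB.instance Definition _ := Choice.on ratfun.

(* The fraction P / q; meaningful for q != 0 only. *)
Definition rfrac (P : {poly R}) (q : {poly F}) : ratfun :=
  \pi_ratfun (mk_rep P q).

Lemma rfrac_eq P q P' q' : q != 0 -> q' != 0 ->
  (rfrac P q = rfrac P' q') <-> (P * polyA q' = P' * polyA q).
Proof.
move=> q0 q0'; split=> [/eqP | E]; last apply/eqP;
  by rewrite eqmodE /= /eqv_rep !mk_repE //= ?E // => /eqP.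
Qed.

Definition rnum (f : ratfun) : {poly R} := (repr f : ratio_rep).1.
Definition rden (f : ratfun) : {poly F} := (repr f : ratio_rep).2.

Lemma rden_neq0 f : rden f != 0.
Proof. exact: rep_den. Qed.

Lemma rfracK f : rfrac (rnum f) (rden f) = f.
Proof.
rewrite /rfrac -[RHS]reprK; congr (\pi_ratfun _); apply: val_inj.
by rewrite /= mk_repE ?rden_neq0 // -surjective_pairing.
Qed.

Lemma rfrac_ext P q s : q != 0 -> s != 0 -> rfrac P q = rfrac (P * polyA s) (q * s).
Proof.
move=> q0 s0; apply/rfrac_eq; rewrite ?mulf_neq0 //.
by rewrite polyAM mulrA polyAAC.
Qed.

Lemma rfracP f : exists P q, q != 0 /\ f = rfrac P q.
Proof. by exists (rnum f), (rden f); rewrite rden_neq0 rfracK. Qed.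

Lemma rfracP2 f g : exists P S q, [/\ q != 0, f = rfrac P q & g = rfrac S q].
Proof.
have [[P [q [q0 ->]]] [S [s [s0 ->]]]] := (rfracP f, rfracP g).
exists (P * polyA s), (S * polyA q), (q * s).
by split; rewrite ?mulf_neq0 -?rfrac_ext // [q * s]mulrC -rfrac_ext.
Qed.

Lemma rfracP3 f g h :
  exists P S T q, [/\ q != 0, f = rfrac P q, g = rfrac S q & h = rfrac T q].
Proof.
have [[P [S [q [q0 -> ->]]]] [T [t [t0 ->]]]] := (rfracP2 f g, rfracP h).
exists (P * polyA t), (S * polyA t), (T * polyA q), (q * t).
by split; rewrite ?mulf_neq0 -?rfrac_ext // [q * t]mulrC -rfrac_ext.
Qed.

Definition radd (f g : ratfun) : ratfun :=
  rfrac (rnum f * polyA (rden g) + rnum g * polyA (rden f)) (rden f * rden g).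
Definition ropp (f : ratfun) : ratfun := rfrac (- rnum f) (rden f).
Definition rmul (f g : ratfun) : ratfun :=
  rfrac (rnum f * rnum g) (rden f * rden g).
Definition rscale (c : F) (f : ratfun) : ratfun :=
  rfrac (polyA c%:P * rnum f) (rden f).
Definition rderiv (f : ratfun) : ratfun :=
  rfrac ((rnum f)^`() * polyA (rden f) - rnum f * polyA (rden f)^`())
        (rden f ^+ 2).

Lemma rfrac_num P q : q != 0 ->
  rnum (rfrac P q) * polyA q = P * polyA (rden (rfrac P q)).
Proof. by move=> q0; apply/rfrac_eq; rewrite ?rden_neq0 ?rfracK. Qed.

Lemma polyACA (q s : {poly F}) (P S : {poly R}) :
  (P * polyA q) * (S * polyA s) = P * S * polyA (q * s).
Proof. by rewrite polyAM mulrA -(mulrA P) polyAC !mulrA. Qed.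

Lemma raddE P S q : q != 0 -> radd (rfrac P q) (rfrac S q) = rfrac (P + S) q.
Proof.
move=> q0; set f := rfrac P q; set g := rfrac S q.
apply/rfrac_eq; rewrite ?mulf_neq0 ?rden_neq0 // mulrDl !mulrDl.
rewrite polyAAC rfrac_num // -mulrA -polyAM; congr (_ + _).
by rewrite polyAAC rfrac_num // -mulrA -polyAM [rden g * _]mulrC.
Qed.

Lemma roppE P q : q != 0 -> ropp (rfrac P q) = rfrac (- P) q.
Proof.
by move=> q0; apply/rfrac_eq; rewrite ?rden_neq0 // !mulNr rfrac_num.
Qed.

Lemma rmulE P S q s : q != 0 -> s != 0 ->
  rmul (rfrac P q) (rfrac S s) = rfrac (P * S) (q * s).
Proof.
move=> q0 s0; apply/rfrac_eq; rewrite ?mulf_neq0 ?rden_neq0 //.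
by rewrite -!polyACA !rfrac_num.
Qed.

Lemma rscaleE c P q : q != 0 ->
  rscale c (rfrac P q) = rfrac (polyA c%:P * P) q.
Proof.
by move=> q0; apply/rfrac_eq; rewrite ?rden_neq0 // -!mulrA rfrac_num.
Qed.

Lemma deriv_polyA (q : {poly F}) : (polyA q)^`() = polyA q^`().
Proof. exact: deriv_map. Qed.

Lemma rderivE P q : q != 0 ->
  rderiv (rfrac P q) = rfrac (P^`() * polyA q - P * polyA q^`()) (q ^+ 2).
Proof.
move=> q0; set f := rfrac P q; have d0 := rden_neq0 f.
have E := rfrac_num P q0; rewrite -/f in E.
have /(congr1 (@deriv _)) := E; rewrite !derivM !deriv_polyA => E'.
apply/rfrac_eq; rewrite ?expf_neq0 // !expr2 !polyAM !mulrA.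
move: (rnum f) (rden f) E E' => N D E E'.
have {}E' : N^`() * polyA q = P^`() * polyA D + P * polyA D^`() - N * polyA q^`().
  by rewrite -E' addrK.
rewrite !mulrBl (polyAAC D q) E' !mulrBl !mulrDl.
rewrite (polyAAC q^`() D N) (polyAAC q^`() q (N * polyA D)) (polyAAC D q N).
rewrite (polyAAC D^`() q N) E (polyAAC D^`() D P).
rewrite (polyAAC D q (P^`() * polyA D)) (polyAAC D q P^`()).
rewrite (polyAAC D q^`() (P * polyA D)) (polyAAC D q^`() P).
by rewrite [X in X - _]addrAC addrK.
Qed.

Lemma rfrac0 q : q != 0 -> rfrac 0 q = rfrac 0 1.
Proof. by move=> q0; apply/rfrac_eq; rewrite ?oner_neq0 // !mul0r. Qed.

Fact raddA : associative radd.
Proof.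
move=> f g h; have [P [S [T [q [q0 -> -> ->]]]]] := rfracP3 f g h.
by rewrite !raddE // addrA.
Qed.
Fact raddC : commutative radd.
Proof.
move=> f g; have [P [S [q [q0 -> ->]]]] := rfracP2 f g.
by rewrite !raddE // addrC.
Qed.
Fact radd0 : left_id (rfrac 0 1) radd.
Proof.
move=> f; have [P [q [q0 ->]]] := rfracP f.
by rewrite -(rfrac0 q0) raddE // add0r.
Qed.
Fact raddN : left_inverse (rfrac 0 1) ropp radd.
Proof.
move=> f; have [P [q [q0 ->]]] := rfracP f.
by rewrite roppE // raddE // addNr rfrac0.
Qed.
HB.instance Definition _ := GRing.isZmodule.Build ratfun raddA raddC radd0 raddN.

Fact rmulA : associative rmul.
Proof.
move=> f g h; have [P [S [T [q [q0 -> -> ->]]]]] := rfracP3 f g h.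
by rewrite !rmulE ?mulf_neq0 // !mulrA.
Qed.
Fact rmul1 : left_id (rfrac 1 1) rmul.
Proof.
move=> f; have [P [q [q0 ->]]] := rfracP f.
by rewrite rmulE ?oner_neq0 // !mul1r.
Qed.
Fact rmulr1 : right_id (rfrac 1 1) rmul.
Proof.
move=> f; have [P [q [q0 ->]]] := rfracP f.
by rewrite rmulE ?oner_neq0 // !mulr1.
Qed.
Fact rmulDl : left_distributive rmul +%R.
Proof.
move=> f g h; have [P [S [T [q [q0 -> -> ->]]]]] := rfracP3 f g h.
by rewrite [_ + _]raddE // !rmulE // [RHS]raddE ?mulf_neq0 // mulrDl.
Qed.
Fact rmulDr : right_distributive rmul +%R.
Proof.
move=> f g h; have [P [S [T [q [q0 -> -> ->]]]]] := rfracP3 f g h.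
by rewrite [_ + _]raddE // !rmulE // [RHS]raddE ?mulf_neq0 // mulrDr.
Qed.
Fact rone_neq0 : rfrac 1 1 != 0.
Proof.
apply/eqP => /(rfrac_eq _ _ (oner_neq0 _) (oner_neq0 _)) /eqP.
by rewrite polyA1 !mulr1 oner_eq0.
Qed.
HB.instance Definition _ := GRing.Zmodule_isNzRing.Build ratfun
  rmulA rmul1 rmulr1 rmulDl rmulDr rone_neq0.

Fact rscaleA c e f : rscale c (rscale e f) = rscale (c * e) f.
Proof.
have [P [q [q0 ->]]] := rfracP f.
by rewrite !rscaleE // mulrA -polyAM polyCM.
Qed.
Fact rscale1 : left_id 1 rscale.
Proof.
move=> f; have [P [q [q0 ->]]] := rfracP f.
by rewrite rscaleE // polyA1 mul1r.
Qed.
Fact rscaleDr : right_distributive rscale +%R.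
Proof.
move=> c f g; have [P [S [q [q0 -> ->]]]] := rfracP2 f g.
by rewrite [_ + _]raddE // !rscaleE // [RHS]raddE // mulrDr.
Qed.
Fact rscaleDl f : {morph rscale^~ f : c e / c + e}.
Proof.
move=> c e; have [P [q [q0 ->]]] := rfracP f.
rewrite !rscaleE // [RHS]raddE // -mulrDl; congr (rfrac (_ * _) _).
by rewrite polyCD /polyA rmorphD.
Qed.
HB.instance Definition _ := GRing.Zmodule_isLmodule.Build F ratfun
  rscaleA rscale1 rscaleDr rscaleDl.

Fact rscaleAl (c : F) (f g : ratfun) : c *: (f * g) = (c *: f) * g.
Proof.
have [P [S [q [q0 -> ->]]]] := rfracP2 f g.
rewrite [_ * rfrac _ _]rmulE // [LHS]rscaleE ?mulf_neq0 //.
by rewrite [c *: _]rscaleE // [RHS]rmulE // mulrA.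
Qed.
HB.instance Definition _ := GRing.Lmodule_isLalgebra.Build F ratfun rscaleAl.

Fact rscaleAr (c : F) (f g : ratfun) : c *: (f * g) = f * (c *: g).
Proof.
have [P [S [q [q0 -> ->]]]] := rfracP2 f g.
rewrite [_ * rfrac _ _]rmulE // [LHS]rscaleE ?mulf_neq0 //.
by rewrite [c *: _]rscaleE // [RHS]rmulE // !mulrA polyAC.
Qed.
HB.instance Definition _ := GRing.Lalgebra_isAlgebra.Build F ratfun rscaleAr.

Fact rderiv_linear : linear rderiv.
Proof.
move=> c f g; have [P [S [q [q0 -> ->]]]] := rfracP2 f g.
have q20 : q ^+ 2 != 0 by rewrite expf_neq0.
rewrite [c *: rfrac _ _]rscaleE // [_ + _]raddE // !rderivE //.
rewrite [_ *: _]rscaleE // [RHS]raddE //; congr (rfrac _ _).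
rewrite derivD derivM deriv_polyA derivC /polyA map_poly0 mul0r add0r -/(polyA _).
by rewrite mulrBr !mulrDl opprD !mulrA addrACA.
Qed.
HB.instance Definition _ :=
  GRing.isLinear.Build F ratfun ratfun _ rderiv rderiv_linear.

Fact rderivM (f g : ratfun) : rderiv (f * g) = rderiv f * g + f * rderiv g.
Proof.
have [P [S [q [q0 -> ->]]]] := rfracP2 f g.
have q20 : q ^+ 2 != 0 by rewrite expf_neq0.
rewrite [_ * rfrac S _]rmulE // !rderivE ?mulf_neq0 //.
rewrite [_ * rfrac _ _]rmulE // [rfrac _ _ * _]rmulE //.
rewrite [q * q ^+ 2]mulrC [RHS]raddE ?mulf_neq0 //.
have -> : (q * q) ^+ 2 = q ^+ 2 * q * q by rewrite !expr2 !mulrA.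
rewrite [RHS](@rfrac_ext _ _ q) ?mulf_neq0 //; congr (rfrac _ _).
have polyAD (s t : {poly F}) : polyA (s + t) = polyA s + polyA t by exact: rmorphD.
have c1 (X Y : {poly R}) s : X * polyA s * Y = X * Y * polyA s.
  by rewrite -mulrA polyAC mulrA.
rewrite !derivM polyAD !polyAM !(mulrDl, mulrDr) !(mulNr, mulrN) !mulrA.
rewrite !(c1 _ S) (polyAAC q q^`()).
by rewrite opprD addrACA.
Qed.

Definition ratfun_dz : derivation ratfun := Derivation rderivM.

(* f is defined at a and takes the value r there. *)
Definition ratfun_val (f : ratfun) (a : F) (r : R) : Prop :=
  exists (P : {poly R}) (q : {poly F}),
    [/\ q.[a] != 0, f = rfrac P q & r = q.[a]^-1 *: P.[a%:A]].

Lemma ratfun_val_uniq f a r r' : ratfun_val f a r -> ratfun_val f a r' -> r = r'.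
Proof.
have nz (q : {poly F}) : q.[a] != 0 -> q != 0.
  by apply: contra_neq => ->; rewrite horner0.
have valM (P : {poly R}) (q : {poly F}) : (P * polyA q).[a%:A] = q.[a] *: P.[a%:A].
  have E : (polyA q).[a%:A] = (q.[a])%:A :> R by exact: horner_map.
  rewrite hornerM_comm ?E; first by rewrite -[LHS]scalerAr mulr1.
  by rewrite /comm_poly E -[LHS]scalerAl mul1r -[RHS]scalerAr mulr1.
move=> [P [q [q0 -> ->]]] [P' [q' [q0' /(rfrac_eq _ _ (nz _ q0) (nz _ q0')) E ->]]].
have := congr1 (fun p => p.[a%:A]) E; rewrite !valM => {}E.
apply: (scalerI (mulf_neq0 q0 q0')); rewrite {1}mulrC -!scalerA.
by rewrite !(scalerA _ _^-1) !divff // !scale1r.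
Qed.

End RationalFunctions.

Section GaudinOperators.
Variables (F : fieldType) (A : algType F) (d : derivation A) (n : nat).

(* D - L *)
Definition gaudin_op (L : 'M[A]_n) : 'M[diffop d]_n :=
  (dop_D d)%:M - map_mx (dop_const d) L.

Definition S_ (L : 'M[A]_n) (p : nat) : A :=
  (-1) ^+ p * dop_coef 0 (tr_sym p (gaudin_op L)).

Definition QH (L : 'M[A]_n) (i : nat) : A :=
  dop_coef i (det_column (gaudin_op L)).

End GaudinOperators.

Section FormalLax.
Variables (F : fieldType) (R : algType F) (inv : bool).

(* A formal series in u and v is the function (a, b) |-> coefficient of u^a v^b. *)
Definition ser_u (f : laurent R) (a b : int) : R := zcoef inv f a *+ (b == 0).
Definition ser_v (f : laurent R) (a b : int) : R := zcoef inv f b *+ (a == 0).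
Definition ser_bracket (f g : laurent R) (a b : int) : R :=
  bracket (zcoef inv f a) (zcoef inv g b).
Definition mul_u_sub_v (G : int -> int -> R) (a b : int) : R :=
  G (a - 1) b - G a (b - 1).

(* The relation is multiplied by u - v, which is not a zero divisor on series  *)
(* whose exponents in u and v are all bounded on the same side.                 *)
Definition series_gaudin_lax (n : nat) (L : 'M[laurent R]_n) : Prop :=
  forall (i j k l : 'I_n) (a b : int),
    mul_u_sub_v (ser_bracket (L i j) (L k l)) a b =
      ser_v (L i l) a b *+ (j == k) - ser_u (L i l) a b *+ (j == k)
      - ser_v (L k j) a b *+ (l == i) + ser_u (L k j) a b *+ (l == i).

Definition series_commute (f g : laurent R) : Prop :=
  forall a b : int, ser_bracket f g a b = 0.

End FormalLax.

Section RationalLax.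
Variables (F : fieldType) (R : algType F).

Definition ratfun_mx_val (n : nat) (L : 'M[ratfun R]_n) (a : F) (La : 'M[R]_n) :
  Prop := forall i j, ratfun_val (L i j) a (La i j).

(* The relation between rational functions in u and v, at all points where its *)
(* two sides are defined.                                                       *)
Definition rational_gaudin_lax (n : nat) (L : 'M[ratfun R]_n) : Prop :=
  forall (u v : F) (Lu Lv : 'M[R]_n), u != v ->
    ratfun_mx_val L u Lu -> ratfun_mx_val L v Lv ->
    forall i j k l : 'I_n,
      bracket (Lu i j) (Lv k l) =
      (u - v)^-1 *: (Lv i l *+ (j == k) - Lu i l *+ (j == k)
                     - Lv k j *+ (l == i) + Lu k j *+ (l == i)).

Definition rational_commute (f g : ratfun R) : Prop :=
  forall (z u : F) (x y : R),
    ratfun_val f z x -> ratfun_val g u y -> bracket x y = 0.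

End RationalLax.

(* Main.v *)
Require Import Defs.
From HB Require Import structures.
From mathcomp Require Import all_boot all_order all_fingroup all_algebra.
From mathcomp Require Import generic_quotient.
From mathcomp Require Import boolp classical_sets fsbigop.
From mathcomp Require Import reals complex.
From mathcomp Require Import zify ring.

Set Implicit Arguments.
Unset Strict Implicit.
Unset Printing Implicit Defensive.

Import Order.TTheory GRing.Theory Num.Theory.
Local Open Scope ring_scope.

(** The theorem rests on two facts.

    The first is that all coefficients of [QH_i(u)] and [QH_j(v)] commute
    ([QH_commute]).  Put [M = d_u - L(u)], [N = d_v - L(v)] and [s = 1/(u - v)]
    in the differential operators over series in [u] and [v]; one has to show
    [det M * det N = det N * det M] ([talalaev]).  A column determinant is a
    product of fermions: if the [psi_i] anticommute, the product over [j] of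
    the columns [\sum_i psi_i M_ij] is [det M * psi_0 ... psi_(n-1)]
    ([prod_dress]).  Take one species [psi] for [M] and another, [phi], for
    [N].  The columns of [M] and of [N] do not anticommute with each other,
    but after adding terms that turn a [phi] into a [psi], or conversely, they
    become generators [Psi_j] and [Ups_l] whose relations close ([exchange],
    [star_exchange]).  In such an algebra the vector
    [W(K) = Psi_K s Ups_K v], with [Psi_K] and [Ups_K] the ordered products
    over a list [K], obeys [W(l :: K) = +- Psi_l s Ups_l s^-1 W(K)]
    ([fusion_step]), and the same holds with [Psi] and [Ups] exchanged.  Since
    [Psi_l s Ups_l + Ups_l s Psi_l] is a multiple of the charge [h], and [h]
    kills [W(K)], the two orders agree up to sign ([exchange_order]).  On the
    states that occur here the added terms amount to a conjugation by [s], so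
    that the two orders evaluate to [s det M det N] and [s det N det M].  The
    recursion itself is proved with a third species [al]: [Psi_K] is the top
    coefficient of the product of the [1 + al_j Psi_j], and the commutator of
    that product with [Ups_l] has a closed form ([gexp_Ups]).

    The second fact is that the symmetric traces lie in every algebra that is
    closed under [d/dz] and contains all [QH_i] ([S_in_closure]).  On the
    diagonal [u = v] the Lax relation says that [M = d_z - L(z)] is a Manin
    matrix, [[M_ij, M_kl] = [M_kj, M_il]] ([lax_same_point], [gaudin_manin]).  Hence
    [M] has a left adjugate [B] with [B M = det M] ([cadjM]).  Differentiating
    with respect to the symbol [d_z], for which the derivative of [M_ij] is
    [delta_ij], gives [B^(r) M + r B^(r-1) = (det M)^(r)] and
    [tr B = (det M)'], so that the [B^(r)] are left combinations of the powers
    of [M]; taking traces expresses every [tr M^k] through derivatives of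
    [det M] ([Z_ptr]).  Expanding permanents along their first row expresses
    the symmetric traces through the [tr M^k] ([perm_open_rec],
    [Z_perm_trace]).

    The centralizer of any set of coefficients is an algebra closed under
    [d/dz].  Applied to the coefficients of the [QH_j], the second fact shows
    that [S_k] commutes with [QH_l]; applied then to the coefficients of the
    [S_l], it shows that [S_k] commutes with [S_l].

    A rational Lax matrix is expanded at [z = 0] ([rat_ser]).  Its relation,
    known at pairs of scalars, is an identity between polynomials after
    multiplication by a common denominator, hence holds for the expansions
    ([lax_series]); commutation comes back to values because the coefficients
    of a numerator are combinations of those of the expansion
    ([series_rat_commute]). *)

(** * Deciding identities modulo oriented relations in a noncommutative ring *)

Inductive nexp : Type :=
  | Nvar of nat | Nzero | None_ | Nadd of nexp & nexp | Nopp of nexp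
  | Nmul of nexp & nexp.

(** A polynomial is a list of signed words; [true] stands for the sign minus. *)
Definition npoly := seq (bool * seq nat).

Definition npoly_mul (x y : npoly) : npoly :=
  flatten [seq [seq (m.1 (+) k.1, m.2 ++ k.2) | k <- y] | m <- x].

Fixpoint npoly_of (x : nexp) : npoly :=
  match x with
  | Nvar i => [:: (false, [:: i])]
  | Nzero => [::]
  | None_ => [:: (false, [::])]
  | Nadd y z => npoly_of y ++ npoly_of z
  | Nopp y => [seq (~~ m.1, m.2) | m <- npoly_of y]
  | Nmul y z => npoly_mul (npoly_of y) (npoly_of z)
  end.

Definition nrule := (seq nat * npoly)%type.

(** First occurrence of a left-hand side inside a word: the letters before it,
    its replacement, and the letters after it. *)
Fixpoint find_redex (rules : seq nrule) (w : seq nat) :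
    option (seq nat * npoly * seq nat) :=
  if [seq r <- rules | prefix r.1 w] is r :: _
  then Some ([::], r.2, drop (size r.1) w)
  else if w is i :: w' then
    omap (fun t => (i :: t.1.1, t.1.2, t.2)) (find_redex rules w')
  else None.

(** Words that cancel are removed as soon as they meet in [acc]. *)
Fixpoint cancel_word (m : bool * seq nat) (acc : npoly) : npoly :=
  if acc is k :: acc' then
    if (k.2 == m.2) && (k.1 != m.1) then acc' else k :: cancel_word m acc'
  else [:: m].

Fixpoint rewrite_words (fuel : nat) (rules : seq nrule) (x acc : npoly) : npoly :=
  if fuel is fuel'.+1 then
    if x is m :: x' then
      if find_redex rules m.2 is Some (a, r, b) then
        rewrite_words fuel' rules
          ([seq (m.1 (+) k.1, a ++ k.2 ++ b) | k <- r] ++ x') acc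
      else rewrite_words fuel' rules x' (cancel_word m acc)
    else acc
  else x ++ acc.

Definition nrule_of (r : nexp * nexp) : seq nrule :=
  if npoly_of r.1 is [:: (false, w)] then [:: (w, npoly_of r.2)] else [::].

Section Soundness.
Variables (A : pzRingType) (env : seq A).

Fixpoint neval (x : nexp) : A :=
  match x with
  | Nvar i => nth 0 env i
  | Nzero => 0
  | None_ => 1
  | Nadd y z => neval y + neval z
  | Nopp y => - neval y
  | Nmul y z => neval y * neval z
  end.

Definition weval (w : seq nat) : A := foldr (fun i => *%R (nth 0 env i)) 1 w.
Definition seval (m : bool * seq nat) : A := if m.1 then - weval m.2 else weval m.2.
Definition peval (x : npoly) : A := foldr (fun m => +%R (seval m)) 0 x.

Lemma weval_cat v w : weval (v ++ w) = weval v * weval w.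
Proof. by elim: v => [|i v IH] /=; rewrite ?mul1r // IH mulrA. Qed.

Lemma peval_cat x y : peval (x ++ y) = peval x + peval y.
Proof. by elim: x => [|m x IH] /=; rewrite ?add0r // IH addrA. Qed.

Lemma peval_context b a r c :
  peval [seq (b (+) k.1, a ++ k.2 ++ c) | k <- r] =
  (if b then - (weval a * peval r * weval c) else weval a * peval r * weval c).
Proof.
elim: r => [|[s k] r IH] /=; first by rewrite mulr0 mul0r oppr0; case: b.
rewrite IH /seval /= !weval_cat; case: b s {IH} => [] [] /=;
  by rewrite !(mulrDr, mulrDl, mulrN, mulNr, opprD, opprK) mulrA.
Qed.

Lemma peval_mul x y : peval (npoly_mul x y) = peval x * peval y.
Proof.
elim: x => [|[s m] x IH] /=; first by rewrite mul0r.
rewrite /npoly_mul /= peval_cat -/(npoly_mul x y) IH mulrDl; congr (_ + _).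
have -> : [seq (s (+) k.1, m ++ k.2) | k <- y] =
          [seq (s (+) k.1, m ++ k.2 ++ [::]) | k <- y].
  by apply: eq_map => k; rewrite cats0.
by rewrite peval_context /= mulr1 /seval /=; case: s; rewrite ?mulNr.
Qed.

Lemma npoly_ofP x : peval (npoly_of x) = neval x.
Proof.
elim: x => [i|||y IHy z IHz|y IHy|y IHy z IHz] /=.
- by rewrite /seval /= addr0 mulr1.
- by [].
- by rewrite /seval /= addr0.
- by rewrite peval_cat IHy IHz.
- rewrite -IHy; elim: (npoly_of y) => [|[s m] r IH] /=; first by rewrite oppr0.
  by rewrite IH opprD /seval /=; case: s; rewrite /= ?opprK.
- by rewrite peval_mul IHy IHz.
Qed.

Definition sound (rules : seq nrule) := {in rules, forall r, weval r.1 = peval r.2}.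

Lemma find_redexP rules w a r b : sound rules ->
  find_redex rules w = Some (a, r, b) -> weval w = weval a * peval r * weval b.
Proof.
move=> ok; elim: w a r b => [|i w IH] a r b /=.
  case E: [seq _ <- _ | _] => [|r0 rs] //= [<- <- <-].
  have : r0 \in [seq x <- rules | prefix x.1 [::]] by rewrite E mem_head.
  rewrite mem_filter => /andP[/prefixP[w' Ew] /ok Er].
  by rewrite mul1r -Er -weval_cat; case: (r0.1) Ew.
case E: [seq _ <- _ | _] => [|r0 rs] /=.
  case F: (find_redex rules w) => [[[a' r'] b']|] //= [<- <- <-] /=.
  by rewrite (IH _ _ _ F) !mulrA.
move=> [<- <- <-] /=.
have : r0 \in [seq x <- rules | prefix x.1 (i :: w)] by rewrite E mem_head.
rewrite mem_filter => /andP[/prefixP[w' Ew] /ok Er].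
by rewrite mul1r -Er -weval_cat -[_ * weval w]/(weval (i :: w)) Ew drop_size_cat.
Qed.

Lemma cancel_wordP m acc : peval (cancel_word m acc) = seval m + peval acc.
Proof.
elim: acc => [|k acc IH] //=; case: ifP => [/andP[/eqP Ew Es]|_] /=.
  rewrite addrA /seval Ew; case: (k.1) (m.1) Es => [] [] //= _;
  by rewrite ?addNr ?addrN add0r.
by rewrite IH addrCA.
Qed.

Lemma rewrite_wordsP fuel rules x acc : sound rules ->
  peval (rewrite_words fuel rules x acc) = peval x + peval acc.
Proof.
move=> ok; elim: fuel x acc => [|fuel IH] x acc /=; first by rewrite peval_cat.
case: x => [|[s w] x] /=; first by rewrite add0r.
case F: (find_redex rules w) => [[[a r] b]|].
  rewrite IH peval_cat peval_context /seval /= (find_redexP ok F).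
  by case: s.
by rewrite IH cancel_wordP addrCA addrA.
Qed.

Fixpoint all_hold (eqs : seq (nexp * nexp)) : Prop :=
  if eqs is e :: eqs' then neval e.1 = neval e.2 /\ all_hold eqs' else True.

Lemma all_hold_sound eqs : all_hold eqs -> sound (flatten (map nrule_of eqs)).
Proof.
elim: eqs => [|[x y] eqs IH] //= [Exy /IH ok] r; rewrite mem_cat => /orP[|/ok //].
rewrite /nrule_of /=; case Ex: (npoly_of x) => [|[[] w] [|? ?]] //.
rewrite inE => /eqP -> /=; rewrite npoly_ofP -Exy -npoly_ofP Ex /= addr0.
by rewrite /seval.
Qed.

Lemma nc_solve fuel eqs x y : all_hold eqs ->
  rewrite_words fuel (flatten (map nrule_of eqs)) (npoly_of (Nadd x (Nopp y))) [::] = [::] ->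
  neval x = neval y.
Proof.
move=> /all_hold_sound ok E; apply/eqP; rewrite -subr_eq0; apply/eqP.
rewrite -[LHS]/(neval (Nadd x (Nopp y))) -npoly_ofP -[LHS]addr0.
by rewrite -[RHS]/(peval [::]) -E rewrite_wordsP.
Qed.

End Soundness.

Ltac nc_mem a l :=
  match l with
  | nil => constr:(false)
  | cons a _ => constr:(true)
  | cons _ ?l' => nc_mem a l'
  end.

Ltac nc_atoms t l :=
  match t with
  | GRing.add ?x ?y => let l' := nc_atoms x l in nc_atoms y l'
  | GRing.opp ?x => nc_atoms x l
  | GRing.mul ?x ?y => let l' := nc_atoms x l in nc_atoms y l'
  | GRing.zero => l
  | GRing.one _ => l
  | _ => match nc_mem t l with true => l | false => constr:(cons t l) end
  end.

Ltac nc_index a l :=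
  match l with
  | cons a _ => constr:(O)
  | cons _ ?l' => let i := nc_index a l' in constr:(S i)
  end.

Ltac nc_reify l t :=
  match t with
  | GRing.add ?x ?y =>
      let x' := nc_reify l x in let y' := nc_reify l y in constr:(Nadd x' y')
  | GRing.opp ?x => let x' := nc_reify l x in constr:(Nopp x')
  | GRing.mul ?x ?y =>
      let x' := nc_reify l x in let y' := nc_reify l y in constr:(Nmul x' y')
  | GRing.zero => constr:(Nzero)
  | GRing.one _ => constr:(None_)
  | _ => let i := nc_index t l in constr:(Nvar i)
  end.

Ltac nc_rules_atoms h l :=
  match h with
  | pair ?h' ?e =>
      let l' := nc_rules_atoms h' l in
      let T := type of e in
      match T with
      | ?x = ?y => let l'' := nc_atoms x l' in nc_atoms y l''
      end
  | tt => l
  end.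

Ltac nc_rules_reify l h :=
  match h with
  | pair ?h' ?e =>
      let T := type of e in
      match T with
      | ?x = ?y =>
          let x' := nc_reify l x in let y' := nc_reify l y in
          let r := nc_rules_reify l h' in constr:(cons (x', y') r)
      end
  | tt => constr:(@nil (nexp * nexp))
  end.

Ltac nc_rules_proof h :=
  match h with
  | pair ?h' ?e => let p := nc_rules_proof h' in constr:(conj e p)
  | tt => constr:(I)
  end.

(** [nc (tt, e1, .., ek)] proves an identity by expanding it into words and
    rewriting with the equations [ei], from left to right. *)
Ltac nc h :=
  match goal with
  | |- @eq ?A ?x ?y =>
      let l0 := constr:(@nil A) in
      let l1 := nc_rules_atoms h l0 in
      let l2 := nc_atoms x l1 in
      let l := nc_atoms y l2 in
      let x' := nc_reify l x in
      let y' := nc_reify l y in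
      let r := nc_rules_reify l h in
      let p := nc_rules_proof h in
      apply: (@nc_solve _ l 5000 r x' y' p); vm_compute; reflexivity
  end.

(** * An exchange algebra and the fusion of its ordered products *)

Section ExchangeAlgebra.
Variables (A : nzRingType) (I : eqType).
Implicit Types (Psi Ups p q : I -> A) (s t h : A) (i j l : I).

(** Relations of the corrected columns [Psi] of [d_u - L(u)] and [Ups] of
    [d_v - L(v)]: [s] is [1/(u - v)], [t] its inverse, [p j] and [q j] are [s]
    times the fermions of the two species, and [h] is the difference of the
    numbers of fermions of the two species. *)
Record exchange Psi Ups p q s t h : Prop := Exchange {
  xst : s * t = 1;
  xts : t * s = 1;
  xPP : forall j l, Psi j * Psi l = - (Psi l * Psi j);
  xP2 : forall j, Psi j * Psi j = 0;
  xUU : forall j l, Ups j * Ups l = - (Ups l * Ups j);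
  xU2 : forall j, Ups j * Ups j = 0;
  xpp : forall j l, p j * p l = - (p l * p j);
  xp2 : forall j, p j * p j = 0;
  xqq : forall j l, q j * q l = - (q l * q j);
  xq2 : forall j, q j * q j = 0;
  xpq : forall j l, p j * q l = - (q l * p j);
  xPU : forall j l, Psi j * Ups l =
    - (Ups l * Psi j) - q j * Psi l + p l * Ups j - q j * p l * h;
  xPp : forall j l, Psi j * p l = - (p l * Psi j) - p j * p l;
  xPq : forall j l, Psi j * q l = - (q l * Psi j) - (p j * q l + q j * p l);
  xUq : forall j l, Ups j * q l = - (q l * Ups j) + q j * q l;
  xUp : forall j l, Ups j * p l = - (p l * Ups j) + (q j * p l + p j * q l);
  xPs : forall j, Psi j * s = s * Psi j - s * p j;
  xUs : forall j, Ups j * s = s * Ups j + s * q j;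
  xsp : forall j, p j * s = s * p j;
  xsq : forall j, q j * s = s * q j;
  xhP : forall j, h * Psi j = Psi j * h + Psi j;
  xhU : forall j, h * Ups j = Ups j * h - Ups j;
  xhp : forall j, h * p j = p j * h + p j;
  xhq : forall j, h * q j = q j * h - q j;
  xhs : h * s = s * h }.

(** Exchanging the two points reverses the sign of [u - v]. *)
Lemma exchange_swap Psi Ups p q s t h :
  exchange Psi Ups p q s t h ->
  exchange Ups Psi (fun j => - q j) (fun j => - p j) (- s) (- t) (- h).
Proof.
case=> Est Ets EPP EP2 EUU EU2 Epp Ep2 Eqq Eq2 Epq EPU EPp EPq EUq EUp EPs EUs
  Esp Esq EhP EhU Ehp Ehq Ehs.
split=> [||j l|j|j l|j|j l|j|j l|j|j l|j l|j l|j l|j l|j l|j|j|j|j|j|j|j|j|].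
- by rewrite mulrNN.
- by rewrite mulrNN.
- exact: EUU.
- exact: EU2.
- exact: EPP.
- exact: EP2.
- by rewrite !mulrNN.
- by rewrite !mulrNN.
- by rewrite !mulrNN.
- by rewrite !mulrNN.
- by rewrite !mulrNN (Epq l) opprK.
- by rewrite (EPU l j) mulrNN (Epq j l); nc tt.
- by rewrite !(mulrN, mulNr) (EUq j l); nc tt.
- by rewrite !(mulrN, mulNr) (EUp j l); nc tt.
- by rewrite !(mulrN, mulNr) (EPp j l); nc tt.
- by rewrite !(mulrN, mulNr) (EPq j l); nc tt.
- by rewrite mulrN EUs; nc tt.
- by rewrite mulrN EPs; nc tt.
- by rewrite !mulrNN.
- by rewrite !mulrNN.
- by rewrite mulNr EhU; nc tt.
- by rewrite mulNr EhP; nc tt.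
- by rewrite mulrNN Ehq; nc tt.
- by rewrite mulrNN Ehp; nc tt.
- by rewrite !mulrNN.
Qed.

(** The inductive step of [gexp_Ups], as a statement about finitely many
    elements: [al], [Pj], [pj], [qj], [Uj] belong to the new index, [F] and [G]
    are the generating product of the other indices applied to [g] and to
    [Ups a * g], and the last two hypotheses are the induction hypothesis at [a]
    and at the new index. *)
Lemma exchange_step (al Pa pa Pj pj qj Ua Uj h u w Y F G : A) :
  al * al = 0 -> Pj * Pj = 0 ->
  Pa * al = - (al * Pa) -> pa * al = - (al * pa) -> Pj * al = - (al * Pj) ->
  pj * al = - (al * pj) -> qj * al = - (al * qj) -> Ua * al = - (al * Ua) ->
  u * al = al * u -> w * al = al * w -> Y * al = al * Y ->
  Pa * Pj = - (Pj * Pa) -> pa * Pj = - (Pj * pa) - pj * pa ->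
  pa * pj = - (pj * pa) -> pa * qj = - (qj * pa) -> pj * qj = - (qj * pj) ->
  u * Pj = Pj * u + pj * u -> w * Pj = Pj * w + pj * w + qj * u ->
  u * pj = pj * u -> u * qj = qj * u -> w * pj = pj * w -> w * qj = qj * w ->
  u * pa = pa * u -> w * pa = pa * w -> w * u = u * w ->
  Y * Pj = Pj * Y ->
  Ua * Pj = - (Pj * Ua) - qj * Pa + pa * Uj - qj * pa * h -> h * F = Y * F ->
  (1 + u) * (G - Ua * F) = - (w * (Pa + pa * Y) * F) ->
  (1 + u) * (Uj * F) = w * (Pj + pj * Y) * F ->
  (1 + (al * pj + u)) * ((1 + al * Pj) * G - Ua * ((1 + al * Pj) * F)) =
  - ((al * qj + w) * (Pa + pa * (al * Pj + Y)) * ((1 + al * Pj) * F)).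
Proof.
move=> r1 r2 r3 r4 r5 r6 r7 r8 r9 r10 r11 r12 r13 r14 r15 r16 r17 r18 r19 r20.
move=> r21 r22 r23 r24 r25 r26 r27 r28 IHa IHj.
have Ga : u * G = - G + Ua * F + u * Ua * F - w * (Pa + pa * Y) * F.
  rewrite -[RHS]addr0 -(subrr ((1 + u) * (G - Ua * F))) {2}IHa; nc tt.
have Gj : u * Uj * F = w * (Pj + pj * Y) * F - Uj * F by rewrite -IHj; nc tt.
nc (tt, r1, r2, r3, r4, r5, r6, r7, r8, r9, r10, r11, r12, r13, r14, r15, r16,
    r17, r18, r19, r20, r21, r22, r23, r24, r25, r26, r27, r28, Ga, Gj).
Qed.

Definition anticommute (x y : I -> A) := forall i j, x i * y j = - (y j * x i).

(** Fermions [al] with annihilators [e], independent of the exchange algebra;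
    they make the ordered product of the [Psi] a coefficient of a product in
    which the order does not matter. *)
Record ghosts (al e : I -> A) Psi Ups p q s t h : Prop := Ghosts {
  gaa : anticommute al al;
  ga2 : forall i, al i * al i = 0;
  gee : anticommute e e;
  ge2 : forall i, e i * e i = 0;
  gea : forall i j, e i * al j = (i == j)%:R - al j * e i;
  gPa : anticommute Psi al;
  gUa : anticommute Ups al;
  gpa : anticommute p al;
  gqa : anticommute q al;
  gPe : anticommute Psi e;
  gUe : anticommute Ups e;
  gpe : anticommute p e;
  gqe : anticommute q e;
  gsa : forall i, s * al i = al i * s;
  gta : forall i, t * al i = al i * t;
  gha : forall i, h * al i = al i * h;
  gse : forall i, s * e i = e i * s;
  gte : forall i, t * e i = e i * t }.

Section Ghosts.
Variables (Psi Ups p q : I -> A) (s t h : A) (al e : I -> A).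
Hypothesis ex : exchange Psi Ups p q s t h.
Hypothesis gh : ghosts al e Psi Ups p q s t h.

Let x j := al j * Psi j.
Let ep j := al j * p j.
Let om j := al j * q j.

(** The generating product of the [Psi]; [gX], [gu] and [gw] are the sums of
    the [Psi], [p] and [q] weighted by the same ghosts. *)
Definition gexp S := \prod_(j <- S) (1 + x j).
Definition gX S := \sum_(j <- S) x j.
Definition gu S := \sum_(j <- S) ep j.
Definition gw S := \sum_(j <- S) om j.

Lemma mulr_sumC (z : A) (f g : I -> A) S :
  (forall j, z * f j = f j * z + g j) ->
  z * (\sum_(j <- S) f j) = (\sum_(j <- S) f j) * z + \sum_(j <- S) g j.
Proof.
by move=> E; rewrite mulr_sumr mulr_suml -big_split; apply: eq_bigr.
Qed.

Lemma mulr_sum_comm (z : A) (f : I -> A) S : (forall j, z * f j = f j * z) ->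
  z * (\sum_(j <- S) f j) = (\sum_(j <- S) f j) * z.
Proof.
by move=> E; rewrite mulr_sumr mulr_suml; apply: eq_bigr.
Qed.

Lemma al_u a S : al a * gu S = gu S * al a.
Proof.
apply: mulr_sum_comm => j; rewrite /ep.
nc (tt, gaa gh a j, gpa gh j a).
Qed.

Lemma al_w a S : al a * gw S = gw S * al a.
Proof.
by apply: mulr_sum_comm => j; rewrite /om; nc (tt, gaa gh a j, gqa gh j a).
Qed.

Lemma al_X a S : al a * gX S = gX S * al a.
Proof.
by apply: mulr_sum_comm => j; rewrite /x; nc (tt, gaa gh a j, gPa gh j a).
Qed.

Lemma p_u a S : p a * gu S = gu S * p a.
Proof.
by apply: mulr_sum_comm => j; rewrite /ep; nc (tt, gpa gh a j, xpp ex a j).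
Qed.

Lemma p_w a S : p a * gw S = gw S * p a.
Proof.
by apply: mulr_sum_comm => j; rewrite /om; nc (tt, gpa gh a j, xpq ex a j).
Qed.

Lemma q_u a S : q a * gu S = gu S * q a.
Proof.
by apply: mulr_sum_comm => j; rewrite /ep; nc (tt, gqa gh a j, xpq ex j a).
Qed.

Lemma q_w a S : q a * gw S = gw S * q a.
Proof.
by apply: mulr_sum_comm => j; rewrite /om; nc (tt, gqa gh a j, xqq ex a j).
Qed.

Lemma w_u S T : gw T * gu S = gu S * gw T.
Proof.
apply: mulr_sum_comm => j; symmetry; apply: mulr_sum_comm => i; rewrite /ep /om.
nc (tt, gpa gh j i, gqa gh i j, xpq ex j i, gaa gh j i).
Qed.

Lemma Psi_u a S : Psi a * gu S = gu S * Psi a - p a * gu S.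
Proof.
rewrite [p a * _]mulr_sumr -sumrN; apply: mulr_sumC => j; rewrite /ep.
by nc (tt, gPa gh a j, gpa gh a j, xPp ex a j).
Qed.

Lemma Psi_w a S : Psi a * gw S = gw S * Psi a - (p a * gw S + q a * gu S).
Proof.
rewrite [p a * _]mulr_sumr [q a * _]mulr_sumr -big_split -sumrN /=; apply: mulr_sumC => j; rewrite /ep /om.
by nc (tt, gPa gh a j, gpa gh a j, gqa gh a j, xPq ex a j).
Qed.

Lemma Psi_X a S : Psi a * gX S = gX S * Psi a.
Proof.
by apply: mulr_sum_comm => j; rewrite /x; nc (tt, gPa gh a j, xPP ex a j).
Qed.

Lemma Ups_u a S : Ups a * gu S = gu S * Ups a + (q a * gu S + p a * gw S).
Proof.
rewrite [p a * _]mulr_sumr [q a * _]mulr_sumr -big_split /=; apply: mulr_sumC => j; rewrite /ep /om.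
by nc (tt, gUa gh a j, gpa gh a j, gqa gh a j, xUp ex a j).
Qed.

Lemma h_gexp S : h * gexp S = gexp S * h + gX S * gexp S.
Proof.
rewrite /gexp /gX; elim: S => [|j S IH]; first by rewrite !big_nil; nc tt.
rewrite !big_cons; set E := \prod_(_ <- _) _ in IH *; set X := \sum_(_ <- _) _ in IH *.
have EX : Psi j * X = X * Psi j := Psi_X j S.
have EaX : al j * X = X * al j := al_X j S.
rewrite /x; nc (tt, IH, gPa gh j j, ga2 gh j, xP2 ex j, gha gh j, xhP ex j, EX, EaX).
Qed.

(** Moving [Ups a] through the generating product produces only the even
    elements [gu], [gw] and [gX]: the hypothesis at the new index turns the
    terms [Ups j] created by [Psi j * Ups a] back into such elements. *)
Lemma gexp_Ups S g r : (forall z, r * z = z * r) ->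
  {in S, forall i, Ups i * g = 0} -> h * g = - (r * g) ->
  forall a, (1 + gu S) * (gexp S * (Ups a * g) - Ups a * (gexp S * g)) =
    - (gw S * (Psi a + p a * (gX S - r)) * (gexp S * g)).
Proof.
move=> rC; elim: S => [|j S IH] killed hg a.
  by rewrite /gexp /gu /gw /gX !big_nil; nc tt.
have killed' : {in S, forall i, Ups i * g = 0}.
  by move=> i iS; apply: killed; rewrite in_cons iS orbT.
have {}IH := IH killed' hg.
have IHj := IH j; rewrite killed ?mem_head // in IHj.
have hE := h_gexp S.
rewrite /gexp /gu /gw /gX !big_cons -/(gexp S) -/(gu S) -/(gw S) -/(gX S).
rewrite -[x j + gX S - _]addrA -[(1 + x j) * gexp S * _]mulrA.
rewrite -[(1 + x j) * gexp S * g]mulrA.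
set Y := gX S - r.
apply: (@exchange_step (al j) (Psi a) (p a) (Psi j) (p j) (q j) (Ups a) (Ups j) h
  (gu S) (gw S) Y (gexp S * g) (gexp S * (Ups a * g)));
  try by [exact: (ga2 gh)|exact: (xP2 ex)|exact: (gPa gh)|exact: (gpa gh)
         |exact: (gqa gh)|exact: (gUa gh)|exact: (xPP ex)|exact: (xpp ex)|exact: (xpq ex)
         |rewrite al_u|rewrite al_w|rewrite p_u|rewrite q_u|rewrite p_w|rewrite q_w|exact: w_u].
- by rewrite /Y mulrBl mulrBr al_X rC.
- by nc (tt, xPp ex j a, xpp ex a j).
- by nc (tt, Psi_u j S).
- by nc (tt, Psi_w j S).
- by rewrite /Y mulrBl mulrBr Psi_X rC.
- by nc (tt, xPU ex j a).
- by have rE := rC (gexp S); rewrite /Y; nc (tt, hE, hg, rE).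
- exact: IH.
- rewrite mulr0 sub0r mulrN in IHj.
  by have /eqP := IHj; rewrite eqr_opp => /eqP.
Qed.

(** The inverse of [1 + gu S], which exists because the [al j * p j] commute and
    square to zero. *)
Fixpoint gc (S : seq I) : A :=
  if S is j :: S' then gc S' - ep j * (gc S' * gc S') else 1.

Lemma ep_comm i S : ep i * gu S = gu S * ep i.
Proof. by have [E1 E2] := (al_u i S, p_u i S); rewrite /ep; nc (tt, E1, E2). Qed.

Lemma inverse_comm (u c z : A) : (1 + u) * c = 1 -> c * (1 + u) = 1 ->
  z * u = u * z -> z * c = c * z.
Proof.
move=> uc cu zu; have E : z * (1 + u) = (1 + u) * z by nc (tt, zu).
by rewrite -[LHS]mul1r -cu -mulrA (mulrA (1 + u)) -E -mulrA uc mulr1.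
Qed.

Lemma gc_inv S : (1 + gu S) * gc S = 1 /\ gc S * (1 + gu S) = 1.
Proof.
elim: S => [|j S [uc cu]] /=; first by rewrite /gu big_nil; split; nc tt.
have ee : ep j * ep j = 0 by rewrite /ep; nc (tt, gpa gh j j, ga2 gh j).
have eu := ep_comm j S; have ec := inverse_comm uc cu eu.
have uc' : gu S * gc S = 1 - gc S by rewrite -uc; nc tt.
have cu' : gc S * gu S = 1 - gc S by rewrite -cu; nc tt.
rewrite /gu !big_cons -/(gu S).
by split; nc (tt, ee, eu, ec, uc', cu').
Qed.

Lemma gc_comm z S : z * gu S = gu S * z -> z * gc S = gc S * z.
Proof. by have [uc cu] := gc_inv S; exact: inverse_comm. Qed.

Lemma gu_gc S : gu S * gc S = 1 - gc S.
Proof. by have [<- _] := gc_inv S; nc tt. Qed.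

Lemma gc_gu S : gc S * gu S = 1 - gc S.
Proof. by have [_ <-] := gc_inv S; nc tt. Qed.

Lemma gc_conj z y S : z * gu S = gu S * z + y -> z * gc S = gc S * z - gc S * y * gc S.
Proof.
have [uc cu] := gc_inv S => E.
have {}E : (1 + gu S) * z = z * (1 + gu S) - y by nc (tt, E).
rewrite -[LHS]mul1r -cu -mulrA (mulrA (1 + gu S)) E mulrBl -(mulrA z) uc mulr1.
by rewrite mulrBr mulrA.
Qed.

Lemma Psi_c a S : Psi a * gc S = gc S * Psi a + p a * (gc S - gc S * gc S).
Proof.
rewrite (@gc_conj _ (- (p a * gu S))) ?Psi_u //.
have E := gc_comm (p_u a S); have E' := gu_gc S; nc (tt, E, E').
Qed.

Lemma Ups_c a S : Ups a * gc S = gc S * Ups a - gc S * (q a * gu S + p a * gw S) * gc S.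
Proof. by rewrite (gc_conj (Ups_u a S)). Qed.

Lemma p_t j : p j * t = t * p j.
Proof.
by rewrite -[LHS]mul1r -(xts ex) -mulrA (mulrA s) -(xsp ex) -mulrA (xst ex) mulr1.
Qed.

Lemma Psi_t j : Psi j * t = t * Psi j + t * p j.
Proof.
have sP : s * Psi j = Psi j * s + s * p j by rewrite (xPs ex j) subrK.
rewrite -[LHS]mul1r -(xts ex) -mulrA (mulrA s) sP.
by nc (tt, xst ex, p_t j, xts ex, xsp ex j).
Qed.

Lemma gexp_t S : gexp S * t = t * ((1 + gu S) * gexp S).
Proof.
elim: S => [|j S IH]; first by rewrite /gexp /gu !big_nil; nc tt.
rewrite /gexp /gu !big_cons -/(gexp S) -/(gu S).
have [E1 E2] := (esym (al_u j S), Psi_u j S); have E3 := p_u j S.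
rewrite /x /ep; nc (tt, IH, Psi_t j, gta gh j, E1, E2, E3, gPa gh j j, gpa gh j j, ga2 gh j).
Qed.

(** Number operator of the ghosts.  It agrees with [gX S] on [gexp S * y]
    ([gN_exp]), and the top coefficient sees it as the number [size S]
    ([gI_N]). *)
Definition gN S := \sum_(j <- S) al j * e j.

(** Extraction of the coefficient of the product of all the [al j]; the sign is
    that of carrying the remaining annihilators through [Psi j]. *)
Fixpoint gI (S : seq I) : A :=
  if S is j :: S' then (-1) ^+ size S' * (gI S' * e j) else 1.

Lemma sign_comm (z : A) k : z * (-1) ^+ k = (-1) ^+ k * z.
Proof. exact: commr_sign. Qed.

Lemma gI_odd z S : (forall j, z * e j = - (e j * z)) ->
  gI S * z = (-1) ^+ size S * (z * gI S).
Proof.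
move=> E; elim: S => [|j S IH] /=; first by rewrite !mul1r mulr1.
have eE : e j * z = - (z * e j) by rewrite E opprK.
have sE := sign_comm z (size S); rewrite exprS; nc (tt, eE, IH, sE).
Qed.

Lemma anticommute_sym (y z : I -> A) : anticommute y z -> anticommute z y.
Proof. by move=> E i j; rewrite E opprK. Qed.

Lemma e_gexp j S : j \notin S -> e j * gexp S = gexp S * e j.
Proof.
elim: S => [|i S IH]; first by rewrite /gexp !big_nil => _; nc tt.
rewrite in_cons negb_or /gexp big_cons -/(gexp S) => /andP[ji /IH E].
have ea : e j * al i = - (al i * e j) by rewrite (gea gh) (negbTE ji) sub0r.
have eP := anticommute_sym (gPe gh) j i; rewrite /x; nc (tt, ea, eP, E).
Qed.

Lemma e_N j S : j \notin S -> e j * gN S = gN S * e j.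
Proof.
elim: S => [|i S IH]; first by rewrite /gN !big_nil => _; nc tt.
rewrite in_cons negb_or /gN big_cons -/(gN S) => /andP[ji /IH E].
have ea : e j * al i = - (al i * e j) by rewrite (gea gh) (negbTE ji) sub0r.
by nc (tt, ea, gee gh j i, E).
Qed.

Lemma e_factor j S y : j \notin S -> e j * y = 0 ->
  e j * ((1 + x j) * (gexp S * y)) = Psi j * (gexp S * y).
Proof.
move=> jS ey; have ea : e j * al j = 1 - al j * e j by rewrite (gea gh) eqxx.
have E := e_gexp jS; rewrite /x; have Pe := gPe gh j j.
have eP : e j * Psi j = - (Psi j * e j) by rewrite Pe opprK.
nc (tt, ea, eP, E, ey).
Qed.

Lemma gI_gexp S y : uniq S -> {in S, forall i, e i * y = 0} ->
  gI S * (gexp S * y) = (\prod_(j <- S) Psi j) * y.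
Proof.
elim: S => [|j S IH]; first by rewrite /gexp !big_nil !mul1r.
move=> /andP[jS uS] ey /=; rewrite /gexp !big_cons -/(gexp S).
have {}IH := IH uS (fun i iS => ey i (mem_behead (s := j :: S) iS)).
have E := e_factor jS (ey j (mem_head _ _)).
rewrite -!mulrA E -IH (mulrA (gI S)) (gI_odd S (fun i => gPe gh j i)).
by rewrite -!mulrA signrMK.
Qed.

Lemma gI_N S : uniq S -> gI S * gN S = (size S)%:R * gI S.
Proof.
elim: S => [|j S IH] /=; first by rewrite /gN big_nil !(mulr0, mul0r).
move=> /andP[jS uS]; rewrite /gN big_cons -/(gN S).
have {}IH := IH uS; have E := e_N jS.
have ea : e j * al j = 1 - al j * e j by rewrite (gea gh) eqxx.
have rc (z : A) : z * (size S)%:R = (size S)%:R * z by exact: commr_nat.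
rewrite mulrS; move: ((size S)%:R : A) IH rc => r IH rc.
have rs := rc ((-1) ^+ size S); move: ((-1) ^+ size S : A) rs => z rs.
by nc (tt, E, ea, ge2 gh j, IH, rs).
Qed.

Lemma gN_exp S y : uniq S -> {in S, forall i, e i * y = 0} ->
  gN S * (gexp S * y) = gX S * (gexp S * y).
Proof.
elim: S => [|j S IH]; first by rewrite /gN /gX !big_nil !mul0r.
move=> /andP[jS uS] ey; rewrite /gN /gX /gexp !big_cons -/(gexp S) -/(gN S) -/(gX S).
have {}IH := IH uS (fun i iS => ey i (mem_behead (s := j :: S) iS)).
have E := e_factor jS (ey j (mem_head _ _)).
have Nx : gN S * x j = x j * gN S.
  have aN : al j * gN S = gN S * al j.
    rewrite mulr_sumr mulr_suml big_seq [RHS]big_seq; apply: eq_bigr => i iS.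
    have ea : e i * al j = - (al j * e i).
      by rewrite (gea gh); case: eqP => [E'|]; [rewrite -E' iS in jS | rewrite sub0r].
    by nc (tt, ea, gaa gh j i).
  have PN : Psi j * gN S = gN S * Psi j.
    by apply: mulr_sum_comm => i; nc (tt, gPa gh j i, gPe gh j i).
  by rewrite /x; nc (tt, aN, PN).
have Xx : gX S * x j = x j * gX S.
  by have [E1 E2] := (al_X j S, Psi_X j S); rewrite /x; nc (tt, E1, E2).
have xx : x j * x j = 0 by rewrite /x; nc (tt, gPa gh j j, ga2 gh j).
rewrite -[(1 + x j) * _ * y]mulrA; move: E IH; set F := gexp S * y => E IH.
rewrite mulrDl -(mulrA (al j)) E (mulrA (al j)) -/(x j).
by nc (tt, Nx, Xx, xx, IH).
Qed.

Lemma gN_sum S (f : I -> A) : uniq S -> (forall i j, e i * f j = - (f j * e i)) ->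
    (forall i j, al i * f j = - (f j * al i)) ->
  let Y := \sum_(j <- S) al j * f j in gN S * Y = Y * gN S + Y.
Proof.
move=> uS ef af Y; have aY i : al i * Y = Y * al i.
  by apply: mulr_sum_comm => j; have E := af i j; nc (tt, E, gaa gh i j).
have eY i : i \in S -> e i * Y = Y * e i + f i.
  move=> iS; rewrite /Y mulr_sumr mulr_suml [f i in RHS](_ : _ = \sum_(j <- S) (i == j)%:R * f i).
    rewrite -big_split; apply: eq_bigr => j _ /=.
    have E := ef i j; rewrite mulrA (gea gh) mulrBl [RHS]addrC; congr (_ + _); last by nc (tt, E).
    by case: eqP => [->|_]; rewrite // !mul0r.
  rewrite -mulr_suml (bigD1_seq i) //= eqxx big1 ?addr0 ?mul1r // => j.
  by rewrite eq_sym => /negbTE->.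
rewrite /gN [RHS]addrC mulr_suml mulr_sumr -big_split /=.
by apply: eq_big_seq => i iS; have [E1 E2] := (aY i, eY i iS); nc (tt, E1, E2).
Qed.

Lemma gN_u S : uniq S -> gN S * gu S = gu S * gN S + gu S.
Proof.
by move=> uS; apply: gN_sum => // i j; apply: anticommute_sym; [apply: (gpe gh)|apply: (gpa gh)].
Qed.

Lemma gN_w S : uniq S -> gN S * gw S = gw S * gN S + gw S.
Proof.
by move=> uS; apply: gN_sum => // i j; apply: anticommute_sym; [apply: (gqe gh)|apply: (gqa gh)].
Qed.

Lemma gN_c S : uniq S -> gN S * gc S = gc S * gN S - (gc S - gc S * gc S).
Proof.
move=> uS; rewrite (gc_conj (gN_u uS)).
have E' := gc_gu S; nc (tt, E').
Qed.

Lemma gN_comm z S : (forall i, z * al i = - (al i * z)) -> (forall i, z * e i = - (e i * z)) ->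
  z * gN S = gN S * z.
Proof. by move=> za ze; apply: mulr_sum_comm => i; have [E1 E2] := (za i, ze i); nc (tt, E1, E2). Qed.

(** The last summand comes from the commutator of [gN S] with
    [gc S * gc S * gw S]; thanks to it the expression vanishes identically, by
    [Psi l * Psi l = 0]. *)
Lemma theta_vanishes l S :
  (Psi l - p l) * (gc S * gc S) *
    (q l * gu S - gw S * Psi l + (gc S + gc S) * gw S * p l) = 0.
Proof.
have pc := gc_comm (p_u l S); have qc := gc_comm (q_u l S).
have wc := gc_comm (w_u S S).
have [Pc Pu Pw] := And3 (Psi_c l S) (Psi_u l S) (Psi_w l S).
have [pu pw qu qw] := And4 (p_u l S) (p_w l S) (q_u l S) (q_w l S).
have wu := w_u S S; have uc := gu_gc S; have cu := gc_gu S.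
nc (tt, pc, qc, wc, Pc, Pu, Pw, pu, pw, qu, qw, wu, uc, cu, xP2 ex l, xpp ex l l,
   xp2 ex l, xq2 ex l, xpq ex l l, xPp ex l l, xPq ex l l).
Qed.

Definition oprod (f : I -> A) (S : seq I) := \prod_(j <- S) f j.

Lemma oprod_anti (f : I -> A) z S : (forall j, z * f j = - (f j * z)) ->
  z * oprod f S = (-1) ^+ size S * (oprod f S * z).
Proof.
move=> E; elim: S => [|j S IH]; first by rewrite /oprod big_nil !(mul1r, mulr1).
rewrite /oprod big_cons -/(oprod f S) /= exprS.
by have sC := sign_comm (f j) (size S); nc (tt, E j, IH, sC).
Qed.

Lemma oprod_kill (f : I -> A) S i : (forall j l, f j * f l = - (f l * f j)) ->
  f i * f i = 0 -> i \in S -> f i * oprod f S = 0.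
Proof.
move=> fa ff; elim: S => [|j S IH] //; rewrite inE /oprod big_cons -/(oprod f S).
case: eqP => [<- _|_ /= /IH E]; first by nc (tt, ff).
by rewrite mulrA fa mulNr -mulrA E mulr0 oppr0.
Qed.

Lemma h_oprod S v : h * v = 0 -> h * (oprod Ups S * v) = - ((size S)%:R * (oprod Ups S * v)).
Proof.
move=> hv; elim: S => [|j S IH]; first by rewrite /oprod big_nil mul1r hv mul0r oppr0.
rewrite /oprod big_cons -/(oprod Ups S) /= mulrS; move: IH; have := commr_nat (Ups j) (size S).
rewrite /GRing.comm -[Ups j * _ * v]mulrA.
move: (oprod Ups S * v) ((size S)%:R : A) => F r rC IH.
nc (tt, IH, xhU ex j, rC).
Qed.

(** Conjugation by [s] changes [Psi j] into [Psi j - p j], and the generating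
    product only by the factor [gc]. *)
Lemma t_gexp_s S y : t * (gexp S * (s * y)) = gc S * (gexp S * y).
Proof.
have tu : t * gu S = gu S * t.
  by apply: mulr_sum_comm => j; rewrite /ep; nc (tt, gta gh j, p_t j).
have [_ cu] := gc_inv S; have E := gexp_t S.
transitivity (gc S * (1 + gu S) * t * gexp S * s * y); first by rewrite cu; nc tt.
transitivity (gc S * (gexp S * t) * s * y); first by rewrite E; nc (tt, tu).
by nc (tt, xts ex).
Qed.

(** By [gexp_Ups] the difference between the two positions of [Ups l] is an
    explicit multiple of [gexp S * g].  Under [gI S] the number operator in it
    becomes [size S], which cancels the eigenvalue of [h] on [g] up to a
    commutator, and [theta_vanishes] applies. *)
Lemma theta_eq l S g : uniq S -> {in S, forall i, Ups i * g = 0} ->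
  {in S, forall i, e i * g = 0} -> h * g = - ((size S)%:R * g) ->
  (Psi l - p l) * (gI S * (t * (gexp S * (s * (Ups l * g))) -
                   Ups l * (t * (gexp S * (s * g))))) = 0.
Proof.
move=> uS Ug eg hg.
have rC (z : A) : (size S)%:R * z = z * (size S)%:R by rewrite commr_nat.
have L1 := gexp_Ups rC Ug hg l; rewrite !t_gexp_s.
have XN := gN_exp uS eg; have IN := gI_N uS.
have [uc cu] := gc_inv S.
have {L1} L1 : gexp S * (Ups l * g) = Ups l * (gexp S * g) -
    gc S * (gw S * (Psi l + p l * (gN S - (size S)%:R)) * (gexp S * g)).
  have E : gw S * (Psi l + p l * (gN S - (size S)%:R)) * (gexp S * g) =
           gw S * (Psi l + p l * (gX S - (size S)%:R)) * (gexp S * g).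
    by rewrite -!mulrA !mulrDl -!(mulrA (p l)) !(mulrDl _ _ (gexp S * g)) XN.
  have := congr1 (fun y => gc S * y) L1; rewrite /= mulrA cu mul1r => L1'.
  by rewrite E -mulrN -L1' addrC subrK.
rewrite L1; move: (gexp S * g) => F; move: (size S)%:R rC IN => r rC IN.
have sgn := sign_comm (Psi l - p l) (size S).
have IP : gI S * (Psi l - p l) = (-1) ^+ size S * ((Psi l - p l) * gI S).
  by apply: gI_odd => j; have [E1 E2] := (gPe gh l j, gpe gh l j); nc (tt, E1, E2).
(* [gI S] and [Psi l - p l] commute up to sign *)
set T := (X in _ * (gI S * X)); transitivity ((-1) ^+ size S * (gI S * ((Psi l - p l) * T))).
  by rewrite (mulrA (gI S)) IP -!mulrA signrMK.
rewrite [X in _ * X](_ : _ = 0) ?mulr0 // /T.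
have V := theta_vanishes l S.
transitivity (gI S * ((Psi l - p l) * (gc S * gc S) *
    (q l * gu S - gw S * Psi l + (gc S + gc S) * gw S * p l)) * F); last first.
  by rewrite V mulr0 mul0r.
have pc := gc_comm (p_u l S); have qc := gc_comm (q_u l S).
have wc := gc_comm (w_u S S). have pw := p_w l S.
have ucC : gu S * gc S = gc S * gu S by exact: gc_comm.
have NP : Psi l * gN S = gN S * Psi l by apply: gN_comm; [exact: (gPa gh)|exact: (gPe gh)].
have Np : p l * gN S = gN S * p l by apply: gN_comm; [exact: (gpa gh)|exact: (gpe gh)].
have wN : gw S * gN S = gN S * gw S - gw S by rewrite (gN_w uS) addrK.
have cN : gc S * gN S = gN S * gc S + (gc S - gc S * gc S) by rewrite (gN_c uS) subrK.
have [r1 r2 r3 r4] := And4 (esym (rC (gI S))) (esym (rC (Psi l))) (esym (rC (p l))) (esym (rC (gw S))).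
have r5 := esym (rC (gc S)).
nc (tt, pc, qc, wc, pw, ucC, NP, Np, wN, cN, r1, r2, r3, r4, r5, Ups_c l S, IN).
Qed.

(** Both sides are [Psi l] times [s] times a vector in which [Ups l] stands to
    the right, respectively to the left, of the product of the [Psi i - p i];
    [Psi l * s] is [s * (Psi l - p l)], which kills their difference by
    [theta_eq]. *)
Lemma fusion_step l S v : uniq S -> (forall i, e i * v = 0) -> h * v = 0 ->
  oprod Psi (l :: S) * (s * (oprod Ups (l :: S) * v)) =
  (-1) ^+ size S * (Psi l * (s * (Ups l * (t * (oprod Psi S * (s * (oprod Ups S * v))))))).
Proof.
move=> uS ev hv; set g := oprod Ups S * v.
have Ug : {in S, forall i, Ups i * g = 0}.
  by move=> i iS; rewrite mulrA (oprod_kill (xUU ex)) ?(xU2 ex) ?mul0r.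
have eg i : e i * g = 0.
  have := oprod_anti S (fun j => anticommute_sym (gUe gh) i j).
  by rewrite /g mulrA => ->; rewrite -!mulrA ev !mulr0.
have eUg i : e i * (Ups l * g) = 0.
  by have E := anticommute_sym (gUe gh) i l; have E' := eg i; nc (tt, E, E').
have es i y : e i * y = 0 -> e i * (s * y) = 0.
  by move=> E; rewrite mulrA -(gse gh) -mulrA E mulr0.
have := theta_eq l uS Ug (fun i _ => eg i) (h_oprod S hv).
have It y : gI S * (t * y) = t * (gI S * y).
  rewrite !mulrA; congr (_ * _); elim: (S) => [|j S' IH] /=; first by nc tt.
  by have sC := sign_comm t (size S'); nc (tt, esym (gte gh j), IH, sC).
have IU y : gI S * (Ups l * y) = (-1) ^+ size S * (Ups l * (gI S * y)).
  by rewrite mulrA (gI_odd S (fun j => gUe gh l j)) !mulrA.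
rewrite mulrBr IU !It !gI_gexp //; first last.
- by move=> i _; exact: es.
- by move=> i _; exact: es.
rewrite /oprod !big_cons -/(oprod Psi S) -/(oprod Ups S) -(mulrA (Psi l)) -(mulrA (Ups l)) -/g.
set X := oprod Psi S * _; set Z := oprod Psi S * _; set sg : A := (-1) ^+ _ => H.
have [c1 c2 c3] := And3 (sign_comm (Psi l) (size S)) (sign_comm (p l) (size S)) (sign_comm s (size S)).
rewrite -/sg in c1 c2 c3.
apply/eqP; rewrite -subr_eq0; apply/eqP; rewrite -[RHS](mulr0 s) -H.
by nc (tt, c1, c2, c3, Psi_t l, p_t l, xst ex, xPs ex l).
Qed.

End Ghosts.

End ExchangeAlgebra.

Section Duality.
Variables (A : nzRingType) (I : eqType).
Variables (Psi Ups p q : I -> A) (s t h : A) (al e : I -> A).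
Hypothesis ex : exchange Psi Ups p q s t h.
Hypothesis gh : ghosts al e Psi Ups p q s t h.

Lemma ghosts_swap :
  ghosts al e Ups Psi (fun j => - q j) (fun j => - p j) (- s) (- t) (- h).
Proof.
by split; [exact: gaa gh|exact: ga2 gh|exact: gee gh|exact: ge2 gh|exact: gea gh
  |exact: gUa gh|exact: gPa gh| | |exact: gUe gh|exact: gPe gh| | | | | | |];
  move=> *; rewrite mulNr mulrN;
  rewrite ?(gpa gh) ?(gqa gh) ?(gpe gh) ?(gqe gh) ?(gsa gh) ?(gta gh) ?(gha gh) ?(gse gh) ?(gte gh).
Qed.

Variable v : A.
Hypothesis hv : h * v = 0.
Hypothesis ev : forall i, e i * v = 0.

Lemma h_pair S : h * (oprod Psi S * (s * (oprod Ups S * v))) = 0.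
Proof.
have hP y : h * (oprod Psi S * y) = oprod Psi S * (h * y) + (size S)%:R * (oprod Psi S * y).
  elim: S => [|j S IH]; first by rewrite /oprod big_nil !mul1r mul0r addr0.
  rewrite /oprod big_cons -/(oprod Psi S) /= mulrS -![Psi j * _ * _]mulrA.
  rewrite mulrA (xhP ex) mulrDl -mulrA IH mulrDr (mulrA (Psi j) _%:R) commr_nat.
  by rewrite mulrDl mul1r -!mulrA -addrA; congr (_ + _); rewrite addrC.
rewrite hP; have := h_oprod ex S hv; have [c1 c2] := (commr_nat (oprod Psi S) (size S), commr_nat s (size S)).
rewrite /GRing.comm in c1 c2; move: (_%:R : A) c1 c2 => r c1 c2 hU.
by nc (tt, xhs ex, hU, c1, c2).
Qed.

(** Both sides obey the recursion of [fusion_step].  One pair of factors changes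
    sign with its order, up to a multiple of [h], which vanishes by [h_pair]. *)
Lemma exchange_order S : uniq S ->
  oprod Psi S * (s * (oprod Ups S * v)) =
  (-1) ^+ size S * (oprod Ups S * (s * (oprod Psi S * v))).
Proof.
elim: S => [|l S IH]; first by rewrite /oprod !big_nil !mul1r.
move=> /andP[_ uS]; have {}IH := IH uS.
rewrite (fusion_step ex gh) //.
have mhv : - h * v = 0 by rewrite mulNr hv oppr0.
have := fusion_step (exchange_swap ex) ghosts_swap l uS ev mhv.
rewrite !(mulrN, mulNr) opprK; have := h_pair S; rewrite IH; move: (oprod Ups S * _) => W hW.
have [c1 c2 c3] := And3 (sign_comm h (size S)) (sign_comm t (size S)) (sign_comm s (size S)).
have [c4 c5] := (sign_comm (Psi l) (size S), sign_comm (Ups l) (size S)).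
have sg2 := signrMK (size S) (1 : A).
rewrite /= exprS; move: ((-1) ^+ size S) hW c1 c2 c3 c4 c5 sg2 => z hW c1 c2 c3 c4 c5.
rewrite mulr1 => coef_uv.
move=> /eqP; rewrite eqr_opp => /eqP E.
transitivity (- (z * (oprod Ups (l :: S) * (s * (oprod Psi (l :: S) * v))))); last by nc tt.
rewrite E; have th : t * h = h * t.
  by rewrite -[LHS]mulr1 -(xst ex) -mulrA (mulrA h) (xhs ex) -!mulrA (mulrA t) (xts ex) mul1r.
have D : Psi l * s * Ups l = - (Ups l * s * Psi l) - s * q l * p l * h.
  nc (tt, xPs ex l, xUs ex l, xPU ex l l).
have {}hW : z * h * W = 0 by rewrite -c1 -mulrA.
have hW' : h * W = 0 by rewrite -[W]mul1r -coef_uv; nc (tt, c1, hW).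
by nc (tt, c1, c2, c3, c4, c5, D, coef_uv, esym th, hW').
Qed.

End Duality.

(** * Fermionic Fock spaces *)

Record fermions (A : nzRingType) (J : eqType) (c d : J -> A) : Prop := Fermions {
  fcc : anticommute c c;
  fc2 : forall i, c i * c i = 0;
  fdd : anticommute d d;
  fd2 : forall i, d i * d i = 0;
  fdc : forall i j, d i * c j = (i == j)%:R - c j * d i }.

(** Fermions adjoined to [B].  The vacuum [v] is an element of the ring, so that
    states are ring elements too, and [B] acts faithfully on it. *)
Record fock (B A : nzRingType) (iota : {rmorphism B -> A}) (J : eqType)
    (c d : J -> A) (v : A) : Prop := Fock {
  fock_car : fermions c d;
  fock_c : forall b i, iota b * c i = c i * iota b;
  fock_d : forall b i, iota b * d i = d i * iota b;
  fock_v : forall i, d i * v = 0;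
  fock_inj : forall b, iota b * v = 0 -> b = 0 }.

(** One more fermion is adjoined by passing to two by two matrices; the old
    fermions act with opposite signs on the two blocks, and therefore
    anticommute with the new one. *)
Section Doubling.
Variables (B A : nzRingType) (iota : {rmorphism B -> A}) (N : nat).
Variables (c d : 'I_N -> A) (v : A).
Hypothesis fk : fock iota c d v.

Definition mx2 (x y z w : A) : 'M[A]_2 :=
  \matrix_(i, j) if i == 0 then if j == 0 then x else y
                 else if j == 0 then z else w.

Lemma mx2E (X Y : 'M[A]_2) : X 0 0 = Y 0 0 -> X 0 1 = Y 0 1 -> X 1 0 = Y 1 0 ->
  X 1 1 = Y 1 1 -> X = Y.
Proof.
move=> E1 E2 E3 E4; apply/matrixP => i j.
have ord2 (k : 'I_2) : k = 0 \/ k = 1.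
  by case: k => [[|[|]]] // ?; [left|right]; apply: val_inj.
by case: (ord2 i) => ->; case: (ord2 j) => ->.
Qed.

Lemma mx2M x y z w x' y' z' w' : mx2 x y z w * mx2 x' y' z' w' =
  mx2 (x * x' + y * z') (x * y' + y * w') (z * x' + w * z') (z * y' + w * w').
Proof.
by apply: mx2E; rewrite !mxE !big_ord_recl big_ord0 !mxE /= addr0.
Qed.

Lemma mx2D x y z w x' y' z' w' :
  mx2 x y z w + mx2 x' y' z' w' = mx2 (x + x') (y + y') (z + z') (w + w').
Proof. by apply: mx2E; rewrite !mxE. Qed.

Lemma mx2N x y z w : - mx2 x y z w = mx2 (- x) (- y) (- z) (- w).
Proof. by apply: mx2E; rewrite !mxE. Qed.

Lemma mx2_0 : 0 = mx2 0 0 0 0.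
Proof. by apply: mx2E; rewrite !mxE. Qed.

Lemma mx2_1 : 1 = mx2 1 0 0 1.
Proof. by apply: mx2E; rewrite !mxE. Qed.

Definition iota2 (b : B) : 'M[A]_2 := mx2 (iota b) 0 0 (iota b).

Fact iota2_additive : zmod_morphism iota2.
Proof. by move=> x y; rewrite /iota2 mx2N mx2D !rmorphB /= !subr0. Qed.
HB.instance Definition _ :=
  GRing.isZmodMorphism.Build B 'M[A]_2 iota2 iota2_additive.
Fact iota2_multiplicative : monoid_morphism iota2.
Proof.
split=> [|x y]; first by rewrite /iota2 rmorph1 mx2_1.
by rewrite /iota2 mx2M !rmorphM /= !(mul0r, mulr0, addr0, add0r).
Qed.
HB.instance Definition _ :=
  GRing.isMonoidMorphism.Build B 'M[A]_2 iota2 iota2_multiplicative.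

Definition extend2 (f : 'I_N -> A) (g : 'M[A]_2) (i : 'I_N.+1) : 'M[A]_2 :=
  if unlift ord0 i is Some k then mx2 (f k) 0 0 (- f k) else g.

Local Notation simp := (mx2M, mx2N, mul0r, mulr0, mul1r, mulr1, mulrN, mulNr,
  addr0, add0r, oppr0, opprK).

Lemma fock_double :
  fock iota2 (extend2 c (mx2 0 0 1 0)) (extend2 d (mx2 0 1 0 0)) (mx2 v 0 0 0).
Proof.
have [[cc c2 dd d2 dc] ic id dv inj] := fk.
split; first split.
- move=> i j; rewrite /extend2; case: unliftP => [k _|_]; case: unliftP => [l _|_];
  by rewrite !simp // -(cc k l).
- move=> i; rewrite /extend2; case: unliftP => [k _|_];
  by rewrite !simp ?c2 mx2_0.
- move=> i j; rewrite /extend2; case: unliftP => [k _|_]; case: unliftP => [l _|_];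
  by rewrite !simp // -(dd k l).
- move=> i; rewrite /extend2; case: unliftP => [k _|_];
  by rewrite !simp ?d2 mx2_0.
- move=> i j; rewrite /extend2; case: unliftP => [k ->|->]; case: unliftP => [l ->|->].
  + rewrite (inj_eq lift_inj) !simp dc; case: eqP => _;
    by rewrite ?mulr1n ?mulr0n ?[1 in RHS]mx2_1 ?[X in _ = X + _]mx2_0 mx2D !simp.
  + by rewrite -[lift _ _ == _]negbK eq_sym neq_lift mulr0n !simp.
  + by rewrite -[_ == lift _ _]negbK neq_lift mulr0n !simp.
  + by rewrite eqxx mulr1n [1 in RHS]mx2_1 !simp mx2D !simp subrr.
- move=> b i; rewrite /extend2 /iota2; case: unliftP => [k _|_]; by rewrite !simp ?ic.
- move=> b i; rewrite /extend2 /iota2; case: unliftP => [k _|_]; by rewrite !simp ?id.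
- move=> i; rewrite /extend2; case: unliftP => [k _|_]; by rewrite !simp ?dv mx2_0.
- move=> b; rewrite /iota2 !simp => /matrixP/(_ 0 0); rewrite !mxE /=; exact: inj.
Qed.

End Doubling.

Lemma fock_ord (B : nzRingType) N : exists (A : nzRingType)
  (iota : {rmorphism B -> A}) (c d : 'I_N -> A) (v : A), fock iota c d v.
Proof.
elim: N => [|N [A [iota [c [d [v fk]]]]]].
  exists B, idfun, (fun=> 0), (fun=> 0), 1.
  by split=> [|? []|? []|[]|b]; rewrite ?mulr1 //; split=> [[]|[]|[]|[]|[]].
do 5!eexists; exact: (fock_double fk).
Qed.

Lemma fock_exists (B : nzRingType) (J : finType) : exists (A : nzRingType)
  (iota : {rmorphism B -> A}) (c d : J -> A) (v : A), fock iota c d v.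
Proof.
have [A [iota [c [d [v [[cc c2 dd d2 dc] ic id dv inj]]]]]] := fock_ord B #|J|.
exists A, iota, (fun j => c (enum_rank j)), (fun j => d (enum_rank j)), v.
split=> [|b i|b i|i|b] /=; [|exact: ic|exact: id|exact: dv|exact: inj].
split=> [i j|i|i j|i|i j] /=; [exact: cc|exact: c2|exact: dd|exact: d2|].
by rewrite dc (inj_eq enum_rank_inj).
Qed.

(** * The exchange algebra of two Lax matrices *)

Section Dressing.
Variables (A : nzRingType) (n : nat).
Implicit Types (f g : 'I_n -> A) (M : 'I_n -> 'I_n -> A).

Definition dress f M (j : 'I_n) := \sum_i f i * M i j.

Lemma dress_comm z f g M j : (forall i, z * f i = f i * z + g i) ->
  (forall i, z * M i j = M i j * z) -> z * dress f M j = dress f M j * z + dress g M j.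
Proof.
by move=> E1 E2; apply: mulr_sumC => i; have [E3 E4] := (E1 i, E2 i); nc (tt, E3, E4).
Qed.

Lemma dress_comm0 z f M j : (forall i, z * f i = f i * z) ->
  (forall i, z * M i j = M i j * z) -> z * dress f M j = dress f M j * z.
Proof.
by move=> E1 E2; apply: mulr_sum_comm => i; have [E3 E4] := (E1 i, E2 i); nc (tt, E3, E4).
Qed.

Lemma dress_anti z f M j : (forall i, z * f i = - (f i * z)) ->
  (forall i, z * M i j = M i j * z) -> dress f M j * z = - (z * dress f M j).
Proof.
move=> E1 E2; rewrite mulr_sumr mulr_suml -sumrN; apply: eq_bigr => i _.
by have [E3 E4] := (E1 i, E2 i); nc (tt, E3, E4).
Qed.

Lemma dress_s s f M j : (forall i, f i * s = s * f i) ->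
  (forall i, M i j * s = s * M i j - (i == j)%:R * (s * s)) ->
  dress f M j * s = s * dress f M j - f j * (s * s).
Proof.
move=> E1 E2; rewrite [f j](_ : _ = \sum_i (i == j)%:R * f i).
  rewrite mulr_sumr !mulr_suml -sumrB; apply: eq_bigr => i _.
  have [E3 E4] := (E1 i, E2 i); have E5 := commr_nat (f i) (i == j).
  by rewrite /GRing.comm in E5; move: _%:R E4 E5 => r E4 E5; nc (tt, E3, E4, E5).
rewrite (bigD1 j) //= eqxx mul1r big1 ?addr0 // => i /negbTE->; exact: mul0r.
Qed.

Hypothesis tor : forall z : A, z = - z -> z = 0.

(** The columns of a Manin matrix anticommute once dressed with fermions: the
    coefficient of [f i * f k] in the anticommutator is symmetric in [i] and
    [k]. *)
Lemma dress_manin f M j l : anticommute f f ->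
  (forall i k a, M i a * f k = f k * M i a) ->
  (forall i k a b, M i a * M k b - M k b * M i a = M k a * M i b - M i b * M k a) ->
  dress f M j * dress f M l = - (dress f M l * dress f M j).
Proof.
move=> ff Mf MM; apply/eqP; rewrite -addr_eq0; apply/eqP/tor.
have E a b : dress f M a * dress f M b = \sum_i \sum_k f i * f k * (M i a * M k b).
  rewrite mulr_suml; apply: eq_bigr => i _; rewrite mulr_sumr; apply: eq_bigr => k _.
  by have E := Mf i k a; nc (tt, E).
rewrite !E -big_split /= -sumrN.
rewrite [LHS](_ : _ = \sum_i \sum_k f i * f k * (M i j * M k l + M i l * M k j)); last first.
  by apply: eq_bigr => i _; rewrite -big_split; apply: eq_bigr => k _ /=; rewrite mulrDr.
rewrite exchange_big; apply: eq_bigr => k _ /=; rewrite -big_split -sumrN; apply: eq_bigr => i _ /=.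
have E1 := ff i k; have E2 : M i j * M k l = M k l * M i j + M k j * M i l - M i l * M k j.
  by rewrite -addrA -(MM i k j l) addrC subrK.
nc (tt, E1, E2).
Qed.

End Dressing.

Section Star.
Variables (A : nzRingType) (n : nat) (J : finType) (c d : J -> A).
Hypothesis fm : fermions c d.

(** A sum of products of a fermion and an annihilator acts on fermions as a
    derivation; likewise on annihilators in [pair_d]. *)
Lemma pair_c (f : 'I_n -> A) (k : 'I_n -> J) j : injective k ->
  (forall i, f i * c (k j) = - (c (k j) * f i)) ->
  (\sum_i f i * d (k i)) * c (k j) = c (k j) * (\sum_i f i * d (k i)) + f j.
Proof.
move=> kI fc; rewrite [f j](_ : _ = \sum_i (i == j)%:R * f i); last first.
  by rewrite (bigD1 j) //= eqxx mul1r big1 ?addr0 // => i /negbTE->; exact: mul0r.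
rewrite mulr_sumr mulr_suml -big_split; apply: eq_bigr => i _ /=.
have E1 := fdc fm (k i) (k j); rewrite (inj_eq kI) in E1.
have E2 := fc i; have := commr_nat (f i) (i == j); rewrite /GRing.comm.
by move: (_%:R) E1 => r E1 E3; nc (tt, E1, E2, E3).
Qed.

Lemma pair_d (g : 'I_n -> A) (k : 'I_n -> J) j : injective k ->
  (forall i, g i * d (k j) = - (d (k j) * g i)) ->
  (\sum_i c (k i) * g i) * d (k j) = d (k j) * (\sum_i c (k i) * g i) - g j.
Proof.
move=> kI fc; rewrite [g j](_ : _ = \sum_i (j == i)%:R * g i); last first.
  by rewrite (bigD1 j) //= eqxx mul1r big1 ?addr0 // => i; rewrite eq_sym => /negbTE->; exact: mul0r.
rewrite mulr_sumr mulr_suml -sumrB; apply: eq_bigr => i _ /=.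
have E1 := fdc fm (k j) (k i); rewrite (inj_eq kI) in E1.
have E2 := fc i.
by move: (_%:R) E1 => r E1; nc (tt, E1, E2).
Qed.

Lemma pair_comm (f g : 'I_n -> A) z : (forall i, f i * z = - (z * f i)) ->
  (forall i, g i * z = - (z * g i)) ->
  (\sum_i f i * g i) * z = z * \sum_i f i * g i.
Proof.
move=> fz gz; rewrite mulr_sumr mulr_suml; apply: eq_bigr => i _ /=.
by have [E1 E2] := (fz i, gz i); nc (tt, E1, E2).
Qed.

Lemma pair_comm0 (f g : 'I_n -> A) z : (forall i, f i * z = (z * f i)) ->
  (forall i, g i * z = (z * g i)) ->
  (\sum_i f i * g i) * z = z * \sum_i f i * g i.
Proof.
move=> fz gz; rewrite mulr_sumr mulr_suml; apply: eq_bigr => i _ /=.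
by have [E1 E2] := (fz i, gz i); nc (tt, E1, E2).
Qed.

(** The modes are split into the species [psi] of the first point, [phi] of the
    second, and the ghosts [al]. *)
Variables (kp kf ka : 'I_n -> J).
Hypothesis (kpI : injective kp) (kfI : injective kf) (kaI : injective ka).
Hypothesis kpf : forall i j, (kp i == kf j) = false.
Hypothesis kpa : forall i j, (kp i == ka j) = false.
Hypothesis kfa : forall i j, (kf i == ka j) = false.

Let psi i := c (kp i).
Let phi i := c (kf i).
Let al i := c (ka i).
Let a i := d (kp i).
Let b i := d (kf i).
Let e i := d (ka i).

Lemma fdc_neq i j : (i == j) = false -> d i * c j = - (c j * d i).
Proof. by move=> E; rewrite (fdc fm) E sub0r. Qed.

Lemma fcd_neq i j : (i == j) = false -> c j * d i = - (d i * c j).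
Proof. by move/fdc_neq=> ->; rewrite opprK. Qed.

Variables (M N : 'I_n -> 'I_n -> A) (s t : A).
Hypothesis (st : s * t = 1) (ts : t * s = 1).
Hypothesis Mc : forall i j k, M i j * c k = c k * M i j.
Hypothesis Md : forall i j k, M i j * d k = d k * M i j.
Hypothesis Nc : forall i j k, N i j * c k = c k * N i j.
Hypothesis Nd : forall i j k, N i j * d k = d k * N i j.
Hypothesis sc : forall k, s * c k = c k * s.
Hypothesis sd : forall k, s * d k = d k * s.
Hypothesis tor : forall z : A, z = - z -> z = 0.
Hypothesis MM : forall i k a b,
  M i a * M k b - M k b * M i a = M k a * M i b - M i b * M k a.
Hypothesis NN : forall i k a b,
  N i a * N k b - N k b * N i a = N k a * N i b - N i b * N k a.
Hypothesis Ms : forall i j, M i j * s = s * M i j - (i == j)%:R * (s * s).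
Hypothesis Ns : forall i j, N i j * s = s * N i j + (i == j)%:R * (s * s).
Hypothesis MN : forall i j k l, M i j * N k l = N k l * M i j +
  (j == k)%:R * (M i l * s - s * N i l) + (l == i)%:R * (N k j * s - s * M k j).

Definition phi_to_psi := \sum_i psi i * b i.
Definition psi_to_phi := \sum_i phi i * a i.
Definition charge := \sum_i psi i * a i - \sum_i phi i * b i.
Let P := dress psi M.
Let P' := dress phi M.
Let Q := dress phi N.
Let Q' := dress psi N.

Lemma S_psi j : phi_to_psi * psi j = psi j * phi_to_psi.
Proof.
by apply: pair_comm => i; [exact: (fcc fm)|apply: fdc_neq; rewrite eq_sym kpf].
Qed.
Lemma S_phi j : phi_to_psi * phi j = phi j * phi_to_psi + psi j.
Proof. by apply: pair_c => // i; exact: (fcc fm). Qed.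
Lemma T_phi j : psi_to_phi * phi j = phi j * psi_to_phi.
Proof. by apply: pair_comm => i; [exact: (fcc fm)|apply: fdc_neq; rewrite kpf]. Qed.
Lemma T_psi j : psi_to_phi * psi j = psi j * psi_to_phi + phi j.
Proof. by apply: pair_c => // i; exact: (fcc fm). Qed.
Lemma S_s : phi_to_psi * s = s * phi_to_psi.
Proof. by apply: pair_comm0 => i; rewrite ?sc ?sd. Qed.
Lemma T_s : psi_to_phi * s = s * psi_to_phi.
Proof. by apply: pair_comm0 => i; rewrite ?sc ?sd. Qed.
Lemma h_s : charge * s = s * charge.
Proof.
by rewrite /charge mulrBl mulrBr; congr (_ - _); apply: pair_comm0 => i; rewrite ?sc ?sd.
Qed.
Lemma S_M i j : phi_to_psi * M i j = M i j * phi_to_psi.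
Proof. by apply: pair_comm0 => k; rewrite ?Mc ?Md. Qed.
Lemma S_N i j : phi_to_psi * N i j = N i j * phi_to_psi.
Proof. by apply: pair_comm0 => k; rewrite ?Nc ?Nd. Qed.
Lemma T_M i j : psi_to_phi * M i j = M i j * psi_to_phi.
Proof. by apply: pair_comm0 => k; rewrite ?Mc ?Md. Qed.
Lemma T_N i j : psi_to_phi * N i j = N i j * psi_to_phi.
Proof. by apply: pair_comm0 => k; rewrite ?Nc ?Nd. Qed.
Lemma h_M i j : charge * M i j = M i j * charge.
Proof.
by rewrite /charge mulrBl mulrBr; congr (_ - _); apply: pair_comm0 => k; rewrite ?Mc ?Md.
Qed.
Lemma h_N i j : charge * N i j = N i j * charge.
Proof.
by rewrite /charge mulrBl mulrBr; congr (_ - _); apply: pair_comm0 => k; rewrite ?Nc ?Nd.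
Qed.
Lemma h_psi j : charge * psi j = psi j * charge + psi j.
Proof.
have E1 : (\sum_i psi i * a i) * psi j = psi j * (\sum_i psi i * a i) + psi j.
  by apply: pair_c => // i; exact: (fcc fm).
have E2 : (\sum_i phi i * b i) * psi j = psi j * \sum_i phi i * b i.
  apply: pair_comm => i; first exact: (fcc fm).
  by apply: fdc_neq; rewrite eq_sym kpf.
by rewrite /charge; nc (tt, E1, E2).
Qed.
Lemma h_phi j : charge * phi j = phi j * charge - phi j.
Proof.
have E1 : (\sum_i phi i * b i) * phi j = phi j * (\sum_i phi i * b i) + phi j.
  by apply: pair_c => // i; exact: (fcc fm).
have E2 : (\sum_i psi i * a i) * phi j = phi j * \sum_i psi i * a i.
  apply: pair_comm => i; first exact: (fcc fm).
  by apply: fdc_neq; rewrite kpf.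
by rewrite /charge; nc (tt, E1, E2).
Qed.
Lemma h_a j : charge * a j = a j * charge - a j.
Proof.
have E1 : (\sum_i psi i * a i) * a j = a j * (\sum_i psi i * a i) - a j.
  by apply: pair_d => // i; exact: (fdd fm).
have E2 : (\sum_i phi i * b i) * a j = a j * \sum_i phi i * b i.
  apply: pair_comm => i; last exact: (fdd fm).
  by apply: fcd_neq; rewrite kpf.
by rewrite /charge; nc (tt, E1, E2).
Qed.
Lemma h_b j : charge * b j = b j * charge + b j.
Proof.
have E1 : (\sum_i phi i * b i) * b j = b j * (\sum_i phi i * b i) - b j.
  by apply: pair_d => // i; exact: (fdd fm).
have E2 : (\sum_i psi i * a i) * b j = b j * \sum_i psi i * a i.
  apply: pair_comm => i; last exact: (fdd fm).
  by apply: fcd_neq; rewrite eq_sym kpf.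
by rewrite /charge; nc (tt, E1, E2).
Qed.
Lemma h_al j : charge * al j = al j * charge.
Proof.
rewrite /charge mulrBl mulrBr; congr (_ - _); apply: pair_comm => i; try exact: (fcc fm);
by apply: fdc_neq; rewrite ?kpa ?kfa.
Qed.
Lemma h_S : charge * phi_to_psi = phi_to_psi * charge + (phi_to_psi + phi_to_psi).
Proof.
rewrite -big_split; apply: mulr_sumC => i /=.
by nc (tt, h_psi i, h_b i).
Qed.
Lemma h_T : charge * psi_to_phi = psi_to_phi * charge - (psi_to_phi + psi_to_phi).
Proof.
rewrite -big_split -sumrN; apply: mulr_sumC => i /=.
by nc (tt, h_phi i, h_a i).
Qed.
Lemma S_T : phi_to_psi * psi_to_phi = psi_to_phi * phi_to_psi + charge.
Proof.
rewrite /charge -sumrB; apply: mulr_sumC => i.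
have E : phi_to_psi * a i = a i * phi_to_psi - b i by apply: pair_d => // k; exact: (fdd fm).
by nc (tt, S_phi i, E).
Qed.

(** The Lax relation at two points, in dressed form.  It mixes the two species,
    hence the correction terms of [sPsi] and [sUps] below. *)
Lemma P_Q j l : P j * Q l = - (Q l * P j) - phi j * P l * s + phi j * s * Q' l
  + psi l * Q j * s - psi l * s * P' j.
Proof.
have E k : P j * N k l = N k l * P j + (j == k)%:R * (P l * s - s * Q' l)
    + psi l * (N k j * s - s * M k j).
  have -> : psi l * (N k j * s - s * M k j) =
      \sum_i (l == i)%:R * (psi i * (N k j * s - s * M k j)).
    rewrite (bigD1 l) //= eqxx mul1r big1 ?addr0 // => i.
    by rewrite eq_sym => /negbTE->; exact: mul0r.
  have -> : P l * s - s * Q' l = \sum_i psi i * (M i l * s - s * N i l).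
    rewrite mulr_suml mulr_sumr -sumrB; apply: eq_bigr => i _.
    by have E3 := sc (kp i); rewrite -/(psi i) in E3; nc (tt, E3).
  rewrite mulr_suml !mulr_sumr -!big_split /=.
  apply: eq_bigr => i _.
  have [c1 c2] := (commr_nat (psi i) (j == k), commr_nat (psi i) (l == i)).
  rewrite /GRing.comm in c1 c2; have E1 := MN i j k l.
  have [E2 E3] := (Nc k l (kp i), sc (kp i)); rewrite -/(psi i) in E2 E3.
  move: (j == k)%:R (l == i)%:R c1 c2 E1 => r1 r2 c1 c2 E1.
  by nc (tt, c1, c2, E1, E2, E3).
have Pphi k : P j * phi k = - (phi k * P j).
  by apply: dress_anti => i; [exact: (fcc fm)|rewrite -Mc].
rewrite {1}/Q /dress mulr_sumr.
transitivity (\sum_i (- (phi i * N i l * P j) - (j == i)%:R * (phi i * (P l * s - s * Q' l)) +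
   psi l * (phi i * N i j * s - s * (phi i * M i j)))).
  apply: eq_bigr => k _; have [E1 E2] := (E k, Pphi k).
  have c1 := commr_nat (phi k) (j == k); rewrite /GRing.comm in c1.
  have E3 : phi k * psi l = - (psi l * phi k) by exact: (fcc fm).
  have E4 := sc (kf k); rewrite -/(phi k) in E4.
  move: (j == k)%:R c1 E1 => r c1 E1; by nc (tt, c1, E1, E2, E3, E4).
rewrite big_split big_split /= sumrN -mulr_suml -/(dress phi N l) -/(Q l).
rewrite sumrN (bigD1 j) //= eqxx mul1r big1 ?addr0; last first.
  by move=> i; rewrite eq_sym => /negbTE->; exact: mul0r.
rewrite -mulr_sumr sumrB -mulr_suml -mulr_sumr -/(dress phi N j) -/(dress phi M j).
by rewrite -/(Q j) -/(P' j); nc tt.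
Qed.

Lemma S_P j : phi_to_psi * P j = P j * phi_to_psi.
Proof. by apply: dress_comm0 => i; [exact: S_psi|exact: S_M]. Qed.
Lemma S_Q j : phi_to_psi * Q j = Q j * phi_to_psi + Q' j.
Proof. by apply: dress_comm => i; [exact: S_phi|exact: S_N]. Qed.
Lemma T_P j : psi_to_phi * P j = P j * psi_to_phi + P' j.
Proof. by apply: dress_comm => i; [exact: T_psi|exact: T_M]. Qed.
Lemma T_Q j : psi_to_phi * Q j = Q j * psi_to_phi.
Proof. by apply: dress_comm0 => i; [exact: T_phi|exact: T_N]. Qed.
Lemma h_P j : charge * P j = P j * charge + P j.
Proof. by apply: dress_comm => i; [exact: h_psi|exact: h_M]. Qed.
Lemma h_Q j : charge * Q j = Q j * charge - Q j.
Proof.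
rewrite /Q /dress [X in _ = _ - X](_ : _ = - \sum_i (- phi i) * N i j); last first.
  by rewrite -sumrN; apply: eq_bigr => i _; rewrite mulNr opprK.
by rewrite opprK; apply: dress_comm => i; [exact: h_phi|exact: h_N].
Qed.
Lemma P_c k j : P j * c k = - (c k * P j).
Proof. by apply: dress_anti => i; [exact: (fcc fm)|rewrite -Mc]. Qed.
Lemma Q_c k j : Q j * c k = - (c k * Q j).
Proof. by apply: dress_anti => i; [exact: (fcc fm)|rewrite -Nc]. Qed.
Lemma P_psi k j : P j * psi k = - (psi k * P j). Proof. exact: P_c. Qed.
Lemma P_phi k j : P j * phi k = - (phi k * P j). Proof. exact: P_c. Qed.
Lemma Q_psi k j : Q j * psi k = - (psi k * Q j). Proof. exact: Q_c. Qed.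
Lemma Q_phi k j : Q j * phi k = - (phi k * Q j). Proof. exact: Q_c. Qed.
Lemma psi_s k : psi k * s = s * psi k. Proof. by rewrite [RHS]sc. Qed.
Lemma phi_s k : phi k * s = s * phi k. Proof. by rewrite [RHS]sc. Qed.
Lemma P_e i j : P j * e i = - (e i * P j).
Proof.
by apply: dress_anti => k; [apply: fdc_neq; rewrite eq_sym kpa|rewrite -Md].
Qed.
Lemma Q_e i j : Q j * e i = - (e i * Q j).
Proof.
by apply: dress_anti => k; [apply: fdc_neq; rewrite eq_sym kfa|rewrite -Nd].
Qed.
Lemma S_al i : phi_to_psi * al i = al i * phi_to_psi.
Proof.
by apply: pair_comm => k; [exact: (fcc fm)|apply: fdc_neq; rewrite kfa].
Qed.
Lemma T_al i : psi_to_phi * al i = al i * psi_to_phi.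
Proof.
by apply: pair_comm => k; [exact: (fcc fm)|apply: fdc_neq; rewrite kpa].
Qed.
Lemma S_e i : phi_to_psi * e i = e i * phi_to_psi.
Proof.
by apply: pair_comm => k; [apply: fcd_neq; rewrite eq_sym kpa|exact: (fdd fm)].
Qed.
Lemma T_e i : psi_to_phi * e i = e i * psi_to_phi.
Proof.
by apply: pair_comm => k; [apply: fcd_neq; rewrite eq_sym kfa|exact: (fdd fm)].
Qed.
Lemma P_P j l : P j * P l = - (P l * P j).
Proof.
apply: dress_manin => // [i k|i k x]; [exact: (fcc fm)|exact: Mc].
Qed.
Lemma Q_Q j l : Q j * Q l = - (Q l * Q j).
Proof.
apply: dress_manin => // [i k|i k x]; [exact: (fcc fm)|exact: Nc].
Qed.
Lemma P_s j : P j * s = s * P j - psi j * (s * s).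
Proof. by apply: dress_s => i; [exact: (esym (sc (kp i)))|exact: Ms]. Qed.
Lemma Q_s j : Q j * s = s * Q j + phi j * (s * s).
Proof.
have Ns' i : N i j * - s = - s * N i j - (i == j)%:R * (- s * - s).
  by have E := Ns i j; move: (i == j)%:R E => r E; nc (tt, E).
have := dress_s (f := phi) (s := - s) (M := N) (j := j) _ Ns'.
rewrite !(mulrN, mulNr) opprK => E; apply/eqP; rewrite -eqr_opp E; last first.
  by move=> i; rewrite mulrN mulNr; congr (- _); exact: (esym (sc (kf i))).
by apply/eqP; rewrite /Q; nc tt.
Qed.

(** The columns of [M] and [N], corrected so that their relations close. *)
Definition sPsi j := P j - s * phi j * phi_to_psi.
Definition sUps j := Q j + s * psi j * psi_to_phi.

Lemma psi_psi i j : psi i * psi j = - (psi j * psi i). Proof. exact: (fcc fm). Qed.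
Lemma phi_phi i j : phi i * phi j = - (phi j * phi i). Proof. exact: (fcc fm). Qed.
Lemma psi_phi i j : psi i * phi j = - (phi j * psi i). Proof. exact: (fcc fm). Qed.

Lemma psi2 j : psi j * psi j = 0. Proof. exact: (fc2 fm). Qed.
Lemma phi2 j : phi j * phi j = 0. Proof. exact: (fc2 fm). Qed.
Lemma sPsi_sPsi j l : sPsi j * sPsi l = - (sPsi l * sPsi j).
Proof.
rewrite /sPsi; nc (tt, S_P j, S_P l, S_phi j, S_phi l, S_psi j, S_psi l, S_s, P_P j l, P_phi l j, P_phi j l,
  P_psi l j, P_psi j l, P_s j, P_s l, phi_phi j l, psi_phi j l, psi_phi l j, psi_psi j l, psi_s j, psi_s l, phi_s j, phi_s l).
Qed.

Lemma sUps_sUps j l : sUps j * sUps l = - (sUps l * sUps j).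
Proof.
rewrite /sUps; nc (tt, T_Q j, T_Q l, T_phi j, T_phi l, T_psi j, T_psi l, T_s, Q_Q j l, Q_phi l j, Q_phi j l,
  Q_psi l j, Q_psi j l, Q_s j, Q_s l, phi_phi j l, psi_phi j l, psi_phi l j, psi_psi j l, psi_s j, psi_s l, phi_s j, phi_s l).
Qed.

Lemma star_exchange : exchange sPsi sUps (fun j => s * psi j) (fun j => s * phi j) s t charge.
Proof.
split=> [||j l|j|j l|j|j l|j|j l|j|j l|j l|j l|j l|j l|j l|j|j|j|j|j|j|j|j|];
  try exact: sPsi_sPsi; try exact: sUps_sUps; rewrite /sPsi /sUps.
- exact: st.
- exact: ts.
- exact/tor/sPsi_sPsi.
- exact/tor/sUps_sUps.
- by nc (tt, psi_psi j l, psi_s j, psi_s l).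
- by nc (tt, psi2 j, psi_s j).
- by nc (tt, phi_phi j l, phi_s j, phi_s l).
- by nc (tt, phi2 j, phi_s j).
- by nc (tt, psi_phi j l, psi_s j, phi_s l).
- have Q's : Q' l * s = s * Q' l + psi l * (s * s).
    have Ns' i : N i l * - s = - s * N i l - (i == l)%:R * (- s * - s).
      by have E := Ns i l; move: (i == l)%:R E => r E; nc (tt, E).
    have := dress_s (f := psi) (s := - s) (M := N) (j := l) _ Ns'.
    rewrite -/(Q' l) !(mulrN, mulNr) opprK => E; apply/eqP; rewrite -eqr_opp E; last first.
      by move=> i; rewrite mulrN mulNr; congr (- _); exact: (esym (sc (kp i))).
    by apply/eqP; nc tt.
  have P's : P' j * s = s * P' j - phi j * (s * s).
    by apply: dress_s => i; [exact: (esym (sc (kf i)))|exact: Ms].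
  nc (tt, P_Q j l, S_Q l, T_P j, Q's, P's, S_T, P_psi l j, P_phi l j, Q_psi l j, Q_phi l j, P_psi j l, P_phi j l, Q_psi j l, Q_phi j l, P_s j, P_s l, Q_s j, Q_s l,
     S_psi j, S_psi l, S_phi j, S_phi l, T_psi j, T_psi l, T_phi j, T_phi l, S_s, T_s, psi_s j, psi_s l, phi_s j, phi_s l,
     psi_psi j l, phi_phi j l, psi_phi j l, psi_phi l j).
- by nc (tt, P_psi l j, P_phi l j, Q_psi l j, Q_phi l j, P_psi j l, P_phi j l, Q_psi j l, Q_phi j l, P_s j, P_s l, Q_s j, Q_s l,
     S_psi j, S_psi l, S_phi j, S_phi l, T_psi j, T_psi l, T_phi j, T_phi l, S_s, T_s, psi_s j, psi_s l, phi_s j, phi_s l,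
     psi_psi j l, phi_phi j l, psi_phi j l, psi_phi l j).
- by nc (tt, P_psi l j, P_phi l j, Q_psi l j, Q_phi l j, P_psi j l, P_phi j l, Q_psi j l, Q_phi j l, P_s j, P_s l, Q_s j, Q_s l,
     S_psi j, S_psi l, S_phi j, S_phi l, T_psi j, T_psi l, T_phi j, T_phi l, S_s, T_s, psi_s j, psi_s l, phi_s j, phi_s l,
     psi_psi j l, phi_phi j l, psi_phi j l, psi_phi l j).
- by nc (tt, P_psi l j, P_phi l j, Q_psi l j, Q_phi l j, P_psi j l, P_phi j l, Q_psi j l, Q_phi j l, P_s j, P_s l, Q_s j, Q_s l,
     S_psi j, S_psi l, S_phi j, S_phi l, T_psi j, T_psi l, T_phi j, T_phi l, S_s, T_s, psi_s j, psi_s l, phi_s j, phi_s l,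
     psi_psi j l, phi_phi j l, psi_phi j l, psi_phi l j).
- by nc (tt, P_psi l j, P_phi l j, Q_psi l j, Q_phi l j, P_psi j l, P_phi j l, Q_psi j l, Q_phi j l, P_s j, P_s l, Q_s j, Q_s l,
     S_psi j, S_psi l, S_phi j, S_phi l, T_psi j, T_psi l, T_phi j, T_phi l, S_s, T_s, psi_s j, psi_s l, phi_s j, phi_s l,
     psi_psi j l, phi_phi j l, psi_phi j l, psi_phi l j).
- by nc (tt, P_s j, S_s, psi_s j, phi_s j).
- by nc (tt, Q_s j, T_s, psi_s j, phi_s j).
- by nc (tt, psi_s j).
- by nc (tt, phi_s j).
- by nc (tt, h_P j, h_S, h_phi j, h_s).
- by nc (tt, h_Q j, h_T, h_psi j, h_s).
- by nc (tt, h_psi j, h_s).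
- by nc (tt, h_phi j, h_s).
- exact: h_s.
Qed.

Lemma star_ghosts : (forall k, t * c k = c k * t) -> (forall k, t * d k = d k * t) ->
  ghosts al e sPsi sUps (fun j => s * psi j) (fun j => s * phi j) s t charge.
Proof.
move=> tc td.
have P_al i j : P j * al i = - (al i * P j) by exact: P_c.
have Q_al i j : Q j * al i = - (al i * Q j) by exact: Q_c.
have psi_al j i : psi j * al i = - (al i * psi j) by exact: (fcc fm).
have phi_al j i : phi j * al i = - (al i * phi j) by exact: (fcc fm).
have psi_e j i : psi j * e i = - (e i * psi j) by apply: fcd_neq; rewrite eq_sym kpa.
have phi_e j i : phi j * e i = - (e i * phi j) by apply: fcd_neq; rewrite eq_sym kfa.
have s_al i : s * al i = al i * s by exact: sc.
have s_e i : s * e i = e i * s by exact: sd.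
split=> [i j|i|i j|i|i j|j i|j i|j i|j i|j i|j i|j i|j i|i|i|i|i|i] /=; rewrite /sPsi /sUps.
- exact: (fcc fm).
- exact: (fc2 fm).
- exact: (fdd fm).
- exact: (fd2 fm).
- by rewrite (fdc fm) (inj_eq kaI).
- by nc (tt, P_al i j, S_al i, phi_al j i, s_al i).
- by nc (tt, Q_al i j, T_al i, psi_al j i, s_al i).
- by nc (tt, psi_al j i, s_al i).
- by nc (tt, phi_al j i, s_al i).
- by nc (tt, P_e i j, S_e i, phi_e j i, s_e i).
- by nc (tt, Q_e i j, T_e i, psi_e j i, s_e i).
- by nc (tt, psi_e j i, s_e i).
- by nc (tt, phi_e j i, s_e i).
- exact: s_al.
- exact: tc.
- exact: h_al.
- exact: s_e.
- exact: td.
Qed.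

End Star.

(** * Column determinants as products of fermions *)

Lemma det_column_map (A A' : pzRingType) (f : {rmorphism A -> A'}) m (X : 'M[A]_m) :
  f (det_column X) = det_column (\matrix_(i, j) f (X i j)).
Proof.
rewrite /det_column rmorph_sum; apply: eq_bigr => s _.
rewrite rmorphM rmorph_sign rmorph_prod; congr (_ * _).
by apply: eq_bigr => i _; rewrite mxE.
Qed.

Section FermionicDeterminant.

Lemma lift_permP n (s : 'S_n.+1) : exists k (s' : 'S_n), s = lift_perm ord0 k s'.
Proof.
pose h k := odflt k (unlift (s ord0) (s (lift ord0 k))).
have hK k : lift (s ord0) (h k) = s (lift ord0 k).
  rewrite /h; have := neq_lift ord0 k.
  by rewrite -(can_eq (permK s)) => /unlift_some[] ? ? ->.
have hI : injective h.
  by move=> i j E; apply/(@lift_inj _ ord0)/(@perm_inj _ s); rewrite -!hK E.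
exists (s ord0), (perm hI); apply/permP => k.
case: (unliftP ord0 k) => [k' ->|->]; last by rewrite lift_perm_id.
by rewrite lift_perm_lift permE hK.
Qed.

Variable A : nzRingType.

Lemma prod_lift n (f : 'I_n.+1 -> A) (k : 'I_n.+1) : anticommute f f ->
  f k * \prod_(j < n) f (lift k j) = (-1) ^+ k * \prod_(j < n.+1) f j.
Proof.
elim: n f k => [|n IH] f k fa.
  by rewrite (ord1 k) big_ord0 big_ord_recl big_ord0 mul1r.
case: (unliftP ord0 k) => [k' ->|->]; last by rewrite [in RHS]big_ord_recl mul1r.
rewrite big_ord_recl (_ : lift (lift ord0 k') ord0 = ord0); last exact: val_inj.
rewrite (eq_bigr (fun j => f (lift ord0 (lift k' j)))); last first.
  by move=> j _; congr f; apply: val_inj; rewrite /= /bump /= !add1n ltnS addnS.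
rewrite mulrA fa mulNr -mulrA (IH (fun j => f (lift ord0 j))); last by move=> i j; exact: fa.
by rewrite [in RHS]big_ord_recl /= /bump add1n exprS mulN1r mulNr !mulrA sign_comm.
Qed.

Lemma prod_perm n (f : 'I_n -> A) (s : 'S_n) : anticommute f f ->
  \prod_(j < n) f (s j) = (-1) ^+ s * \prod_(j < n) f j.
Proof.
elim: n f s => [|n IH] f s fa.
  by rewrite !big_ord0 mulr1 (_ : s = 1%g) ?odd_perm1 //; apply/permP => -[].
have [k [s' ->]] := lift_permP s; rewrite big_ord_recl lift_perm_id.
rewrite (eq_bigr (fun j => f (lift k (s' j)))); last by move=> j _; rewrite lift_perm_lift.
rewrite (IH (fun j => f (lift k j))); last by move=> i j; exact: fa.
rewrite odd_lift_perm /= signr_addb signr_odd sign_comm -mulrA -prod_lift //.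
by rewrite !mulrA sign_comm.
Qed.

Lemma prod_nuniq (I : eqType) (f : I -> A) (r : seq I) : anticommute f f ->
  (forall i, f i * f i = 0) -> ~~ uniq r -> \prod_(j <- r) f j = 0.
Proof.
move=> fa ff; elim: r => // i r IH /=; rewrite negb_and negbK big_cons.
by case/orP => [|/IH ->]; [exact: oprod_kill|rewrite mulr0].
Qed.

Lemma prod_mul_comm (I : Type) (f g : I -> A) (r : seq I) :
  (forall i j, f i * g j = g j * f i) ->
  \prod_(j <- r) (f j * g j) = (\prod_(j <- r) g j) * \prod_(j <- r) f j.
Proof.
move=> fg; elim: r => [|i r IH]; first by rewrite !big_nil mulr1.
rewrite !big_cons IH -!mulrA (mulrA (f i)) fg -!mulrA; congr (_ * _).
rewrite !mulrA; congr (_ * _); elim: (r) => [|j r' IH']; first by rewrite big_nil; nc tt.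
by rewrite !big_cons mulrA fg -!mulrA IH'.
Qed.

(** Choosing the same row twice gives zero, and the choices along a permutation
    produce its sign. *)
Lemma prod_dress n (f : 'I_n -> A) (M : 'I_n -> 'I_n -> A) : anticommute f f ->
  (forall i, f i * f i = 0) -> (forall i j k, M i j * f k = f k * M i j) ->
  \prod_(j < n) dress f M j =
  det_column (\matrix_(i, j) M i j) * \prod_(j < n) f j.
Proof.
move=> fa ff Mf; rewrite /dress bigA_distr_bigA /=.
rewrite (eq_bigr (fun g : {ffun 'I_n -> 'I_n} =>
   (\prod_j M (g j) j) * \prod_j f (g j))); last first.
  move=> g _; apply: (prod_mul_comm (f := fun j => f (g j)) (g := fun j => M (g j) j)).
  by move=> i j; rewrite Mf.
rewrite (bigID (fun g : {ffun 'I_n -> 'I_n} => injectiveb g)) /= addrC big1 ?add0r; last first.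
  move=> g gN; have -> : \prod_j f (g j) = 0; last exact: mulr0.
  by rewrite -(big_map g xpredT) prod_nuniq // [index_enum _]unlock -enumT.
rewrite /det_column mulr_suml (reindex_onto (fun s : 'S_n => pval s) (fun g : {ffun 'I_n -> 'I_n} => insubd (1%g : {perm 'I_n}) g)) /=; last first.
  by move=> g gI; rewrite val_insubd gI.
apply: eq_big => [s|s _].
  by rewrite (valP s) /=; apply/eqP; apply: val_inj; rewrite val_insubd (valP s).
have E : \prod_j f ((pval s) j) = \prod_j f (s j) by apply: eq_bigr => j _; rewrite pvalE.
rewrite E prod_perm // mulrA sign_comm; congr (_ * _ * _).
by apply: eq_bigr => j _; rewrite mxE pvalE.
Qed.

Lemma prod_dress_map (B : nzRingType) (iota : {rmorphism B -> A}) n (f : 'I_n -> A)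
    (M : 'I_n -> 'I_n -> B) : anticommute f f -> (forall i, f i * f i = 0) ->
  (forall b i, iota b * f i = f i * iota b) ->
  \prod_(j < n) dress f (fun i j => iota (M i j)) j =
  iota (det_column (\matrix_(i, j) M i j)) * \prod_(j < n) f j.
Proof.
move=> fa ff bf; rewrite prod_dress // det_column_map; congr (det_column _ * _).
by apply/matrixP => i j; rewrite !mxE.
Qed.

End FermionicDeterminant.

(** * Commutation of two column determinants *)

(** The correction [s * g j * S] vanishes on products without the species that
    [S] consumes, and on products filled with the species [g] it acts as the
    conjugation of [P j] by [s]. *)
Section Reorder.
Variables (A : nzRingType) (I : eqType) (f g P Psi : I -> A) (s S : A).
Hypothesis PsiE : forall j, Psi j = P j - s * g j * S.

Lemma oprod_vacuum v r : S * v = 0 -> (forall j, S * P j = P j * S) ->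
  oprod Psi r * v = oprod P r * v.
Proof.
move=> Sv SP; elim: r => [|j r IH]; first by rewrite /oprod !big_nil.
have SV : S * (oprod P r * v) = 0.
  elim: (r) => [|i r' IH']; first by rewrite /oprod !big_nil mul1r.
  by rewrite /oprod big_cons -/(oprod P r'); nc (tt, SP i, IH').
by rewrite /oprod !big_cons -/(oprod Psi r) -/(oprod P r) PsiE; nc (tt, IH, SV).
Qed.

Lemma oprod_filled y r : (forall j, g j * y = 0) ->
  (forall j k, P j * g k = - (g k * P j)) -> (forall j, s * g j = g j * s) ->
  (forall j, S * g j = g j * S + f j) -> (forall j, f j * s = s * f j) ->
  (forall j, P j * s = s * P j - f j * (s * s)) ->
  oprod Psi r * (s * y) = s * (oprod P r * y).
Proof.
move=> gy Pg sg Sg fs Ps; elim: r => [|j r IH]; first by rewrite /oprod !big_nil !mul1r.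
have gV k : g k * (oprod P r * y) = 0.
  elim: (r) => [|i r' IH']; first by rewrite /oprod !big_nil mul1r.
  rewrite /oprod big_cons -/(oprod P r'); have E : g k * P i = - (P i * g k) by rewrite Pg opprK.
  by nc (tt, E, IH').
rewrite /oprod !big_cons -/(oprod Psi r) -/(oprod P r) PsiE.
have E : g j * S = S * g j - f j by rewrite Sg addrK.
have E' := esym (sg j).
by nc (tt, IH, E, E', gV j, fs j, Ps j).
Qed.

End Reorder.

(** The annihilators undo the creation of the modes of [r]. *)
Lemma fock_undo (A : nzRingType) (J : eqType) (c d : J -> A) (v x : A) r : fermions c d ->
  (forall i, d i * v = 0) -> (forall i, x * d i = d i * x) -> uniq r ->
  x * (oprod c r * v) = 0 -> x * v = 0.
Proof.
move=> fm dv xd; elim: r => [|j r IH] /=; first by rewrite /oprod big_nil mul1r.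
move=> /andP[jr ur]; rewrite /oprod big_cons -/(oprod c r) => H; apply: IH => //.
have dY : d j * (oprod c r * v) = 0.
  elim: (r) jr => [|i r' IH'] /=; first by rewrite /oprod big_nil mul1r dv.
  rewrite inE negb_or => /andP[ji /IH' E]; rewrite /oprod big_cons -/(oprod c r').
  have := fdc fm j i; rewrite (negbTE ji) sub0r => E1; nc (tt, E1, E).
have := fdc fm j j; rewrite eqxx mulr1n => E1.
transitivity (d j * (x * (c j * oprod c r * v))); last by rewrite H mulr0.
by nc (tt, esym (xd j), E1, dY).
Qed.

(** [exchange_order] for the list of all indices, evaluated on the vacuum: in
    each of the two products the inner factors meet a state without the other
    species ([oprod_vacuum]), and the outer ones a filled state
    ([oprod_filled]). *)
Theorem talalaev (B : nzRingType) (n : nat) (M N : 'I_n -> 'I_n -> B) (s t hf : B) :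
  hf + hf = 1 -> s * t = 1 -> t * s = 1 ->
  (forall i k a b, M i a * M k b - M k b * M i a = M k a * M i b - M i b * M k a) ->
  (forall i k a b, N i a * N k b - N k b * N i a = N k a * N i b - N i b * N k a) ->
  (forall i j, M i j * s = s * M i j - (i == j)%:R * (s * s)) ->
  (forall i j, N i j * s = s * N i j + (i == j)%:R * (s * s)) ->
  (forall i j k l, M i j * N k l = N k l * M i j +
    (j == k)%:R * (M i l * s - s * N i l) + (l == i)%:R * (N k j * s - s * M k j)) ->
  let dM := det_column (\matrix_(i, j) M i j) in
  let dN := det_column (\matrix_(i, j) N i j) in
  dM * dN = dN * dM.
Proof.
move=> hfE st ts MM NN Ms Ns MN dM dN.
have [A [iota [c [d [v [fm ic id dv inj]]]]]] := fock_exists B ('I_n + 'I_n + 'I_n)%type.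
pose M' i j := iota (M i j); pose N' i j := iota (N i j).
pose s' := iota s; pose t' := iota t.
have tor (z : A) : z = - z -> z = 0.
  move=> E; rewrite -[z]mul1r -(rmorph1 iota) -hfE rmorphD mulrDl -mulrDr.
  by rewrite {2}E subrr mulr0.
pose kp i : 'I_n + 'I_n + 'I_n := inl (inl i).
pose kf i : 'I_n + 'I_n + 'I_n := inl (inr i).
pose ka i : 'I_n + 'I_n + 'I_n := inr i.
have kpI : injective kp by move=> i j [].
have kfI : injective kf by move=> i j [].
have kaI : injective ka by move=> i j [].
have kpf i j : (kp i == kf j) = false by [].
have kpa i j : (kp i == ka j) = false by [].
have kfa i j : (kf i == ka j) = false by [].
have st' : s' * t' = 1 by rewrite -rmorphM st rmorph1.
have ts' : t' * s' = 1 by rewrite -rmorphM ts rmorph1.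
have MM' i k a b : M' i a * M' k b - M' k b * M' i a = M' k a * M' i b - M' i b * M' k a.
  by rewrite -!rmorphM -!rmorphB MM.
have NN' i k a b : N' i a * N' k b - N' k b * N' i a = N' k a * N' i b - N' i b * N' k a.
  by rewrite -!rmorphM -!rmorphB NN.
have Ms' i j : M' i j * s' = s' * M' i j - (i == j)%:R * (s' * s').
  by rewrite -(rmorph_nat iota) -!rmorphM -!rmorphB Ms.
have Ns' i j : N' i j * s' = s' * N' i j + (i == j)%:R * (s' * s').
  by rewrite -(rmorph_nat iota) -!rmorphM -!rmorphD Ns.
have MN' i j k l : M' i j * N' k l = N' k l * M' i j +
    (j == k)%:R * (M' i l * s' - s' * N' i l) + (l == i)%:R * (N' k j * s' - s' * M' k j).
  by rewrite -!(rmorph_nat iota) -!rmorphM -!rmorphB -!rmorphM -!rmorphD MN.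
have ex := star_exchange fm kpI kfI kpf st' ts'
  (fun i j k => ic _ k) (fun i j k => id _ k) (fun i j k => ic _ k) (fun i j k => id _ k)
  (fun k => ic _ k) (fun k => id _ k) tor MM' NN' Ms' Ns' MN'.
have gh := star_ghosts fm kaI kpa kfa (M := M') (N := N')
  (fun i j k => ic _ k) (fun i j k => id _ k) (fun i j k => ic _ k) (fun i j k => id _ k)
  (fun k => ic s k) (fun k => id s k) (fun k => ic t k) (fun k => id t k).
pose K := index_enum 'I_n.
have Sv : phi_to_psi c d kp kf * v = 0.
  by rewrite /phi_to_psi mulr_suml big1 // => i _; rewrite -mulrA dv mulr0.
have Tv : psi_to_phi c d kp kf * v = 0.
  by rewrite /psi_to_phi mulr_suml big1 // => i _; rewrite -mulrA dv mulr0.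
have hv : charge c d kp kf * v = 0.
  by rewrite /charge mulrBl !mulr_suml !big1 ?subrr // => i _; rewrite -mulrA dv mulr0.
have uK : uniq K by exact: index_enum_uniq.
have := exchange_order ex gh hv (fun i => dv (ka i)) uK.
pose psi i := c (kp i); pose phi i := c (kf i).
pose P := dress psi M'; pose Q := dress phi N'.
have SP j : phi_to_psi c d kp kf * P j = P j * phi_to_psi c d kp kf.
  by apply: S_P => // i j' k; rewrite /M' ?ic ?id.
have TQ j : psi_to_phi c d kp kf * Q j = Q j * psi_to_phi c d kp kf.
  by apply: T_Q => // i j' k; rewrite /N' ?ic ?id.
have PsiE j : sPsi c d kp kf M' s' j = P j - s' * phi j * phi_to_psi c d kp kf by [].
have UpsE j : sUps c d kp kf N' s' j = Q j - - s' * psi j * psi_to_phi c d kp kf.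
  by rewrite !mulNr opprK.
rewrite (oprod_vacuum UpsE K Tv TQ) (oprod_vacuum PsiE K Sv SP).
have detP : oprod P K = iota dM * oprod psi K.
  by apply: prod_dress_map => [i j|i|b i]; [exact: (fcc fm)|exact: (fc2 fm)|exact: ic].
have detQ : oprod Q K = iota dN * oprod phi K.
  by apply: prod_dress_map => [i j|i|b i]; [exact: (fcc fm)|exact: (fc2 fm)|exact: ic].
have comm_oprod b (k : 'I_n -> 'I_n + 'I_n + 'I_n) r :
    iota b * oprod (fun i => c (k i)) r = oprod (fun i => c (k i)) r * iota b.
  elim: r => [|i r IH]; first by rewrite /oprod big_nil mulr1 mul1r.
  by rewrite /oprod big_cons mulrA ic -mulrA IH mulrA.
have kill (f : 'I_n -> 'I_n + 'I_n + 'I_n) b y j : c (f j) * (iota b * oprod (fun i => c (f i)) K * y) = 0.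
  rewrite !mulrA -ic -(mulrA (iota b)) oprod_kill ?mulr0 ?mul0r ?mem_index_enum //.
    by move=> *; exact: (fcc fm).
  exact: (fc2 fm).
rewrite (oprod_filled (f := psi) PsiE K); first last.
- by move=> j; exact: (P_s kp (fun k => ic s k) Ms').
- by move=> j; rewrite /psi /s' ic.
- by move=> j; apply: S_phi.
- by move=> j; rewrite /phi /s' ic.
- by move=> j k; exact: (P_c fm kp (fun i j k => ic (M i j) k)).
- by move=> j; rewrite detQ kill.
have -> : oprod (sUps c d kp kf N' s') K * (s' * (oprod P K * v)) = s' * (oprod Q K * (oprod P K * v)).
  have := oprod_filled (f := phi) (y := oprod P K * v) UpsE K.
  rewrite !mulNr !mulrN => H; apply/oppr_inj/H => {H}.
  - by move=> j; rewrite detP kill.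
  - by move=> j k; exact: (Q_c fm kf (fun i j k => ic (N i j) k)).
  - by move=> j; rewrite mulrN mulNr /psi /s' ic.
  - by move=> j; apply: T_psi.
  - by move=> j; rewrite mulrN mulNr /phi /s' ic.
  - move=> j; have E : Q j * s' = s' * Q j + phi j * (s' * s').
      exact: (Q_s kf (fun k => ic s k) Ns').
    by nc (tt, E).
rewrite detP detQ => /(congr1 (fun y => t' * y)); set m := size K => E.
pose z : A := (-1) ^+ m.
have anti i : phi i * oprod psi K = z * (oprod psi K * phi i).
  by apply: oprod_anti => j; exact: (fcc fm).
have swap : oprod phi K * oprod psi K = z * (oprod psi K * oprod phi K).
  suff -> r : oprod phi r * oprod psi K = (-1) ^+ (m * size r) * (oprod psi K * oprod phi r).
    by rewrite -signr_odd oddM andbb signr_odd -/z.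
  elim: r => [|i r IH]; first by rewrite /oprod big_nil mulr1 mul1r muln0 expr0 mul1r.
  rewrite /oprod big_cons -/(oprod phi r) -/(oprod psi K) /= mulnS exprD -/z.
  have sg := sign_comm (phi i) (m * size r); have sg2 := sign_comm z (m * size r).
  move: ((-1) ^+ (m * size r) : A) IH sg sg2 => w IH sg sg2.
  by nc (tt, IH, anti i, sg, sg2).
have {E} : iota (dM * dN - dN * dM) * (oprod psi K * oprod phi K * v) = 0.
  have [c1 c2] := (comm_oprod dN kp K, comm_oprod dM kf K); rewrite -/psi -/phi in c1 c2.
  have sg : z * z = 1 by rewrite -expr2 sqrr_sign.
  have [s1 s2 s3] := And3 (sign_comm (iota dN) m) (sign_comm s' m) (sign_comm t' m).
  have s4 := sign_comm (iota dM) m; rewrite -/z in s1 s2 s3 s4 E.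
  have -> : iota (dM * dN - dN * dM) = iota dM * iota dN - iota dN * iota dM.
    by rewrite rmorphB !rmorphM.
  apply/eqP; rewrite -[X in _ == X](subrr (t' * (s' * (iota dM * oprod psi K * (iota dN * oprod phi K * v))))).
  rewrite {2}E; apply/eqP.
  nc (tt, ts', esym c1, esym c2, sg, s1, s2, s3, s4, swap).
rewrite (_ : oprod psi K * oprod phi K = oprod c (map kp K ++ map kf K)); last first.
  by rewrite /oprod big_cat !big_map.
move=> /(fock_undo fm dv (fun i => id _ i)) H; apply/eqP; rewrite -subr_eq0; apply/eqP.
apply: inj; apply: H; rewrite cat_uniq !map_inj_uniq // uK /= andbT.
by apply/hasPn => _ /mapP[i _ ->]; apply/mapP => -[].
Qed.

(** * Functoriality of differential operators *)

Section DiffopTheory.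
Variables (F : fieldType) (A : algType F) (d : derivation A).
Implicit Types (p q : diffop d) (a b : A).

Fact dop_const_additive : zmod_morphism (dop_const d).
Proof. by move=> a b; rewrite /dop_const polyCB. Qed.
HB.instance Definition _ :=
  GRing.isZmodMorphism.Build A (diffop d) (dop_const d) dop_const_additive.
Fact dop_const_multiplicative : monoid_morphism (dop_const d).
Proof.
split=> // a b; rewrite dop_constM; apply/polyP => i.
by rewrite coefZ !coefC; case: eqP; rewrite ?mulr0.
Qed.
HB.instance Definition _ :=
  GRing.isMonoidMorphism.Build A (diffop d) (dop_const d) dop_const_multiplicative.

Lemma dop_DXn k : dop_D d ^+ k = 'X^k :> {poly A}.
Proof.
elim: k => [|k IH]; first by rewrite !expr0.
by rewrite exprS IH -[dop_D d]/('X^1 : {poly A}) {1}/GRing.mul /= diffop_mulXn /= lmulDXn.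
Qed.

Lemma dop_coef_monom a i k : dop_coef k (dop_const d a * dop_D d ^+ i) = if k == i then a else 0.
Proof.
rewrite dop_constM dop_DXn /dop_coef coefZ coefXn.
by case: eqP; rewrite ?mulr1 ?mulr0.
Qed.

Lemma diffop_ind (P : diffop d -> Prop) :
  (forall a k, P (dop_const d a * dop_D d ^+ k)) ->
  (forall p q, P p -> P q -> P (p + q)) -> forall p, P p.
Proof.
move=> Pm PD p; rewrite (diffopE p); elim/big_ind: _ => //.
by have := Pm 0 0%N; rewrite raddf0 mul0r.
Qed.

End DiffopTheory.

Section DiffopMap.
Variables (F : fieldType) (A A' : algType F) (d : derivation A) (d' : derivation A').
Variables (f : {rmorphism A -> A'}) (fd : forall a, f (d a) = d' (f a)).

Definition dop_map of (forall a, f (d a) = d' (f a)) := fun p : diffop d => (map_poly f p : diffop d').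

Fact dop_map_additive : zmod_morphism (dop_map fd).
Proof. by move=> p q; rewrite /dop_map rmorphB. Qed.
HB.instance Definition _ :=
  GRing.isZmodMorphism.Build (diffop d) (diffop d') (dop_map fd) dop_map_additive.

Lemma dop_map_lmulD (p : {poly A}) i :
  map_poly f (iter i (lmulD d) p) = iter i (lmulD d') (map_poly f p).
Proof.
elim: i => //= i <-; rewrite /lmulD rmorphD rmorphM /= map_polyX; congr (_ + _).
by apply/polyP => k; rewrite !coef_map /= fd.
Qed.

Fact dop_map_multiplicative : monoid_morphism (dop_map fd).
Proof.
split=> [|p q]; first exact: (rmorph1 (map_poly f)).
rewrite /dop_map /GRing.mul /= {1}/diffop_mul rmorph_sum /=.
rewrite (@diffop_mul_wide _ _ _ (size (p : {poly A}))) ?size_poly //.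
by apply: eq_bigr => i _; rewrite map_polyZ dop_map_lmulD coef_map.
Qed.
HB.instance Definition _ :=
  GRing.isMonoidMorphism.Build (diffop d) (diffop d') (dop_map fd) dop_map_multiplicative.

Lemma dop_map_const a : dop_map fd (dop_const d a) = dop_const d' (f a).
Proof. by rewrite /dop_map /dop_const map_polyC. Qed.
Lemma dop_map_D : dop_map fd (dop_D d) = dop_D d'.
Proof. by rewrite /dop_map /dop_D map_polyX. Qed.
Lemma dop_map_coef k p : dop_coef k (dop_map fd p) = f (dop_coef k p).
Proof. by rewrite /dop_coef coef_map. Qed.

End DiffopMap.

(** A derivation that commutes with [d] acts on the coefficients. *)
Section DiffopDerivation.
Variables (F : fieldType) (A : algType F) (d e : derivation A).
Hypothesis de : forall a, d (e a) = e (d a).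

Definition dop_der_fun (p : diffop d) : diffop d := map_poly e p.

Fact dop_der_linear : linear dop_der_fun.
Proof.
move=> c p q; rewrite /dop_der_fun.
have sE (r : diffop d) : (c *: r) = (c%:A : A) *: (r : {poly A}) :> {poly A} by [].
rewrite raddfD sE; congr (_ + _); rewrite sE; apply/polyP => k.
by rewrite coef_map !coefZ coef_map /= derM linearZ_LR /= (der1 e) scaler0 mul0r add0r.
Qed.
HB.instance Definition _ :=
  GRing.isLinear.Build F (diffop d) (diffop d) _ dop_der_fun dop_der_linear.

Fact dop_derM p q : dop_der_fun (p * q) = dop_der_fun p * q + p * dop_der_fun q.
Proof.
have eD i (r : {poly A}) : map_poly e (iter i (lmulD d) r) = iter i (lmulD d) (map_poly e r).
  elim: i => //= i <-; rewrite /lmulD raddfD /=; congr (_ + _).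
    by apply/polyP => k; rewrite coef_map !coefMX coef_map; case: eqP; rewrite ?raddf0.
  by apply/polyP => k; rewrite !coef_map /= de.
rewrite /dop_der_fun /GRing.mul /= {1 3}/diffop_mul.
rewrite (@diffop_mul_wide _ _ _ (size (p : {poly A}))) ?size_poly //.
rewrite raddf_sum -big_split; apply: eq_bigr => i _ /=.
apply/polyP => k; rewrite coef_map coefD !coefZ /= derM coef_map -eD coef_map //.
Qed.

Definition dop_der : derivation (diffop d) := Derivation dop_derM.

Lemma dop_der_const a : dop_der (dop_const d a) = dop_const d (e a).
Proof. by rewrite /= /dop_der_fun /dop_const; apply/polyP => k; rewrite coef_map !coefC; case: eqP; rewrite ?raddf0. Qed.
Lemma dop_der_D : dop_der (dop_D d) = 0.
Proof.
rewrite /= /dop_der_fun /dop_D; apply/polyP => k; rewrite coef_map coefX coef0.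
by case: eqP => _; [exact: (der1 e)|exact: raddf0].
Qed.

End DiffopDerivation.

(** * Laurent series in one and two variables *)

Section LaurentMonomials.
Variable R : nzRingType.
Implicit Types (f g : laurent R) (a b : R) (k m : int).

(** Any finite set of exponents outside which the terms vanish may be summed over. *)
Lemma lmulE f g m (r : seq int) : uniq r ->
  (forall i, i \notin r -> f i * g (m - i) = 0) ->
  (f * g) m = \sum_(i <- r) f i * g (m - i).
Proof.
move=> ur fg0; rewrite [LHS]/(lmul_fun f g m) /lmul_fun (@fsbigE _ _ _ _ _ r) //=.
  by apply: eq_bigl => i; rewrite in_setT.
by move=> i _; exact: fg0.
Qed.

Fact lmon_subproof k a : exists N, lbounded (fun m => if m == k then a else 0) N.
Proof. by exists k => m /lt_eqF ->. Qed.
Definition lmon k a : laurent R := Laurent (lmon_subproof k a).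

Lemma lmonMl k a f m : (lmon k a * f) m = a * f (m - k).
Proof.
rewrite (@lmulE _ _ _ [:: k]) //= ?big_seq1 ?eqxx // => i.
by rewrite inE => /negbTE->; rewrite mul0r.
Qed.

Lemma lmonMr k a f m : (f * lmon k a) m = f (m - k) * a.
Proof.
rewrite (@lmulE _ _ _ [:: m - k]) //= ?big_seq1 ?opprB ?[_ + (k - m)]addrC ?subrK ?eqxx // => i.
rewrite inE => /negbTE E; case: eqP => [Ei|_]; last by rewrite mulr0.
by rewrite -Ei opprB addrC subrK eqxx in E.
Qed.

Lemma lmonM k l a b : lmon k a * lmon l b = lmon (k + l) (a * b).
Proof.
by apply: laurentP => m; rewrite lmonMl /= subr_eq [l + k]addrC; case: eqP; rewrite ?mulr0.
Qed.

Lemma lmon_one : lmon 0 1 = 1.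
Proof. by apply: laurentP => m /=; case: eqP. Qed.

Lemma lmon1C k f : lmon k 1 * f = f * lmon k 1.
Proof. by apply: laurentP => m; rewrite lmonMl lmonMr mul1r mulr1. Qed.

Definition lconst := lmon 0.

Fact lconst_additive : zmod_morphism lconst.
Proof. by move=> a b; apply: laurentP => m /=; case: eqP; rewrite ?subr0. Qed.
HB.instance Definition _ :=
  GRing.isZmodMorphism.Build R (laurent R) lconst lconst_additive.
Fact lconst_multiplicative : monoid_morphism lconst.
Proof. by split=> [|a b]; [exact: lmon_one|rewrite /lconst lmonM addr0]. Qed.
HB.instance Definition _ :=
  GRing.isMonoidMorphism.Build R (laurent R) lconst lconst_multiplicative.

Lemma lconstMl a f m : (lconst a * f) m = a * f m.
Proof. by rewrite lmonMl subr0. Qed.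
Lemma lconstMr a f m : (f * lconst a) m = f m * a.
Proof. by rewrite lmonMr subr0. Qed.

End LaurentMonomials.

Section LaurentMap.
Variables (R S : nzRingType) (phi : {rmorphism R -> S}).

Fact lmap_subproof (f : laurent R) : exists N, lbounded (fun m => phi (f m)) N.
Proof. by have [N bN] := lcoefP f; exists N => m /bN ->; rewrite rmorph0. Qed.
Definition lmap (f : laurent R) : laurent S := Laurent (lmap_subproof f).

Lemma laurent_window (f g : laurent R) m : exists N (K : nat),
  forall i, i \notin [seq N + k%:Z | k <- iota 0 K] -> f i = 0 \/ g (m - i) = 0.
Proof.
have [N [bf bg]] := lcommon f g; exists N, (absz (m - (N + N))%R).+1 => i.
case: (ltP i N) => [/bf ->|leN]; first by left.
have [k ->] := le_addnat leN => H; right; apply: bg.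
have := lt_absS (N + N) m; set K := absz _ in H *; move=> ltm.
suff : ~~ (k < K.+1)%N by lia.
by apply: contra H => H; apply/mapP; exists k; rewrite // mem_iota add0n.
Qed.

Lemma iota_shift_uniq N K : uniq [seq N + k%:Z | k <- iota 0 K].
Proof. by rewrite map_inj_uniq ?iota_uniq // => i j /addrI []. Qed.

Fact lmap_additive : zmod_morphism lmap.
Proof. by move=> f g; apply: laurentP => m /=; rewrite rmorphB. Qed.
HB.instance Definition _ :=
  GRing.isZmodMorphism.Build (laurent R) (laurent S) lmap lmap_additive.
Fact lmap_multiplicative : monoid_morphism lmap.
Proof.
split=> [|f g]; apply: laurentP => m; first by rewrite /= rmorph_nat.
have [N [K H]] := laurent_window f g m; have U := iota_shift_uniq N K.
transitivity (phi ((f * g) m)) => //; rewrite (lmulE U); last by move=> i /H[] ->; rewrite ?mul0r ?mulr0.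
rewrite (lmulE U); last by move=> i /H[] /= ->; rewrite rmorph0 ?mul0r ?mulr0.
by rewrite rmorph_sum; apply: eq_bigr => i _; rewrite rmorphM.
Qed.
HB.instance Definition _ :=
  GRing.isMonoidMorphism.Build (laurent R) (laurent S) lmap lmap_multiplicative.

End LaurentMap.

Section LaurentDerivation.
Variables (F : fieldType) (A : algType F) (d : derivation A).

Fact lder_subproof (f : laurent A) : exists N, lbounded (fun m => d (f m)) N.
Proof. by have [N bN] := lcoefP f; exists N => m /bN ->; rewrite raddf0. Qed.
Definition lder_fun (f : laurent A) : laurent A := Laurent (lder_subproof f).

Fact lder_linear : linear lder_fun.
Proof. by move=> c f g; apply: laurentP => m /=; rewrite linearP. Qed.
HB.instance Definition _ :=
  GRing.isLinear.Build F (laurent A) (laurent A) _ lder_fun lder_linear.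
Fact lder_M f g : lder_fun (f * g) = lder_fun f * g + f * lder_fun g.
Proof.
apply: laurentP => m; have [N [K H]] := laurent_window f g m; have U := iota_shift_uniq N K.
transitivity (d ((f * g) m)) => //.
transitivity ((lder_fun f * g) m + (f * lder_fun g) m) => //.
have H' i : i \notin [seq N + k%:Z | k <- iota 0 K] -> f i * g (m - i) = 0.
  by move=> /H[] ->; rewrite ?mul0r ?mulr0.
rewrite !(lmulE U) //; first last.
- by move=> i /H[] /= ->; rewrite ?raddf0 ?mul0r ?mulr0.
- by move=> i /H[] /= ->; rewrite ?raddf0 ?mul0r ?mulr0.
by rewrite raddf_sum -big_split; apply: eq_bigr => i _; rewrite /= derM.
Qed.
Definition lder : derivation (laurent A) := Derivation lder_M.

End LaurentDerivation.

Ltac done_or_lia := solve [done | lia].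

Section TwoVariables.
Variables (F : fieldType) (R : algType F) (inv : bool).
Let A1 : algType F := laurent R.
Let A2 : algType F := laurent A1.
Implicit Types (f g : A1) (G : A2) (a b : int).

Definition zsign : int := if inv then -1 else 1.
Definition inU : {rmorphism A1 -> A2} := @lconst A1.
Definition inV : {rmorphism A1 -> A2} := lmap (@lconst R).
Definition zvar : A1 := lmon zsign 1.
Definition uv_diff : A2 := inU zvar - inV zvar.

(** [1 / (u - v)], with coefficients indexed by the exponent of the outer
    variable [v]: it is [\sum_m v^m u^(-m-1)] in positive powers, and
    [- \sum_m u^m v^(-m-1)] in inverse powers, so that the outer exponents are
    bounded below in both cases. *)
Fact uv_inv_subproof : exists N, lbounded (fun m : int =>
  (if inv then if 1 <= m then - lmon (1 - m) 1 else 0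
   else if 0 <= m then lmon (- m - 1) 1 else 0 : A1)) N.
Proof. by exists 0 => m ltm; case: inv; rewrite ifN //; lia. Qed.
Definition uv_inv : A2 := Laurent uv_inv_subproof.

Definition coef_uv G a b : R := zcoef inv (zcoef inv G b) a.

Lemma coef_uv_inj G G' : (forall a b, coef_uv G a b = coef_uv G' a b) -> G = G'.
Proof.
move=> E; apply: laurentP => m; apply: laurentP => k.
have := E (if inv then - k else k) (if inv then - m else m).
by rewrite /coef_uv /zcoef; case: inv; rewrite ?opprK.
Qed.

Lemma coef_uv_inU f a b : coef_uv (inU f) a b = ser_u inv f a b.
Proof.
by rewrite /coef_uv /ser_u /zcoef /=; case: inv; rewrite ?oppr_eq0; case: eqP.
Qed.

Lemma coef_uv_inV f a b : coef_uv (inV f) a b = ser_v inv f a b.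
Proof.
by rewrite /coef_uv /ser_v /zcoef /=; case: inv; rewrite ?oppr_eq0; case: eqP.
Qed.

Lemma inVE g (m : int) : inV g m = lconst (g m). Proof. by []. Qed.

Lemma coef_uv_UV f g a b : coef_uv (inU f * inV g) a b = zcoef inv f a * zcoef inv g b.
Proof. by rewrite /coef_uv /zcoef lconstMl inVE lconstMr. Qed.

Lemma coef_uv_VU f g a b : coef_uv (inV g * inU f) a b = zcoef inv g b * zcoef inv f a.
Proof. by rewrite /coef_uv /zcoef lconstMr inVE lconstMl. Qed.

Lemma inV_zvar : inV zvar = lmon zsign 1 :> A2.
Proof.
apply: laurentP => m; apply: laurentP => k /=.
by case: (m == zsign) => //=; case: eqP.
Qed.

Lemma uv_diffE G m : (uv_diff * G) m = zvar * G m - G (m - zsign).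
Proof.
rewrite /uv_diff mulrBl -[LHS]/((inU zvar * G) m - (inV zvar * G) m).
by rewrite lconstMl inV_zvar lmonMl mul1r.
Qed.

Lemma coef_uv_diff G a b : coef_uv (uv_diff * G) a b = coef_uv G (a - 1) b - coef_uv G a (b - 1).
Proof.
rewrite /coef_uv /zcoef uv_diffE -[LHS]/((zvar * _) _ - _) /zvar lmonMl mul1r /zsign.
by case: inv; rewrite /= ?opprB ?opprK ?[1 - _]addrC.
Qed.

Lemma uv_diff_comm G : uv_diff * G = G * uv_diff.
Proof.
apply: laurentP => m; rewrite uv_diffE /uv_diff mulrBr.
transitivity ((G * inU zvar) m - (G * inV zvar) m) => //.
by rewrite lconstMr inV_zvar lmonMr mulr1 /zvar lmon1C.
Qed.

Lemma uv_diff_inv : uv_diff * uv_inv = 1.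
Proof.
apply: laurentP => m; rewrite uv_diffE.
transitivity ((if m == 0 then 1 else 0) : A1); last by rewrite /=; case: eqP.
rewrite /zvar /zsign /=; case: inv.
  case: (ltrgtP m 0) => m0 /=.
  - by rewrite !ifN ?mulr0 ?subrr //; lia.
  - rewrite !ifT; try done_or_lia; rewrite mulrN lmonM mulr1 opprK.
    by rewrite (_ : -1 + (1 - m) = 1 - (m - -1)) ?addNr //; lia.
  - rewrite ifN; last done_or_lia; rewrite ifT; last done_or_lia.
    by rewrite mulr0 sub0r opprK m0 /= lmon_one.
case: (ltrgtP m 0) => m0 /=.
- by rewrite !ifN ?mulr0 ?subrr //; lia.
- rewrite !ifT; try done_or_lia; rewrite lmonM mulr1.
  by rewrite (_ : 1 + (- m - 1) = - (m - 1) - 1) ?subrr //; lia.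
- rewrite ifN; last done_or_lia.
  by rewrite subr0 lmonM mulr1 m0 /= lmon_one.
Qed.

Lemma uv_inv_diff : uv_inv * uv_diff = 1.
Proof. by rewrite -uv_diff_comm uv_diff_inv. Qed.

Lemma uv_inv_comm G : uv_inv * G = G * uv_inv.
Proof.
rewrite -[LHS]mulr1 -uv_diff_inv mulrA -(mulrA uv_inv) -uv_diff_comm.
by rewrite mulrA uv_inv_diff mul1r.
Qed.

Definition der_u : derivation A2 := lder (laurent_dz R inv).
Definition der_v : derivation A2 := laurent_dz A1 inv.

Lemma der_uv G : der_u (der_v G) = der_v (der_u G).
Proof. by apply: laurentP => m /=; rewrite /lderiv_fun /= raddfMz. Qed.

Lemma der_inU_u f : der_u (inU f) = inU (laurent_dz R inv f).
Proof. by apply: laurentP => m /=; case: eqP => // _; exact: raddf0. Qed.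

Lemma der_inU_v f : der_v (inU f) = 0.
Proof.
apply: laurentP => m /=; rewrite /lderiv_fun /=.
by case: eqP => [->|_]; rewrite ?mulr0 ?mulr0z ?mul0rz.
Qed.

Lemma der_inV_u f : der_u (inV f) = 0.
Proof.
apply: laurentP => m; apply: laurentP => k /=; rewrite /lderiv_fun /=.
by case: eqP => [->|_]; rewrite ?mulr0 ?mulr0z ?mul0rz.
Qed.

Lemma der_inV_v f : der_v (inV f) = inV (laurent_dz R inv f).
Proof.
apply: laurentP => m; rewrite inVE; pose sg : int := (-1) ^+ inv.
transitivity (lconst (f (m + sg)) *~ (sg * (m + sg))) => //.
by rewrite -raddfMz.
Qed.

Lemma dz_zvar : laurent_dz R inv zvar = 1.
Proof.
apply: laurentP => m /=; rewrite /lderiv_fun /= /zsign; case: inv => /=.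
  rewrite expr1; case: (m =P 0) => [->|/eqP m0] //.
  by rewrite ifN ?mul0rz //; apply: contra m0 => /eqP E; apply/eqP; lia.
rewrite expr0; case: (m =P 0) => [->|/eqP m0] //.
by rewrite ifN ?mul0rz //; apply: contra m0 => /eqP E; apply/eqP; lia.
Qed.

Lemma der_inv (e : derivation A2) (x y c : A2) : (forall z, y * z = z * y) ->
  x * y = 1 -> e x = c -> e y = - (c * (y * y)).
Proof.
move=> yC xy ex; have := congr1 e xy; rewrite derM (der1 e) ex => E.
have yx : y * x = 1 by rewrite yC.
have Exy : x * e y = - (c * y) by apply/eqP; rewrite -addr_eq0 addrC -E.
by rewrite -[LHS]mul1r -yx -mulrA Exy mulrN mulrA yC -mulrA.
Qed.

Lemma der_u_inv : der_u uv_inv = - (uv_inv * uv_inv).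
Proof.
rewrite (der_inv uv_inv_comm uv_diff_inv (c := 1)) ?mul1r //.
transitivity (der_u (inU zvar) - der_u (inV zvar)); first exact: raddfB.
by rewrite der_inU_u der_inV_u subr0 dz_zvar rmorph1.
Qed.

Lemma der_v_inv : der_v uv_inv = uv_inv * uv_inv.
Proof.
rewrite (der_inv uv_inv_comm uv_diff_inv (c := -1)) ?mulN1r ?opprK //.
transitivity (der_v (inU zvar) - der_v (inV zvar)); first exact: raddfB.
by rewrite der_inU_v der_inV_v sub0r dz_zvar rmorph1.
Qed.

Variables (n : nat) (L : 'M[laurent R]_n).
Hypothesis lax : series_gaudin_lax inv L.

Lemma lax_two_points i j k l :
  inU (L i j) * inV (L k l) = inV (L k l) * inU (L i j) + uv_inv *
   ((j == k)%:R * (inV (L i l) - inU (L i l)) - (l == i)%:R * (inV (L k j) - inU (L k j))).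
Proof.
apply/eqP; rewrite addrC -subr_eq; apply/eqP.
set X := _ - _; set Y := (X in _ = _ * X).
suff E : uv_diff * X = Y by rewrite -E mulrA uv_inv_diff mul1r.
have natE (b : bool) (G : A2) : b%:R * G = G *+ b by rewrite mulr_natl.
have zzB G G' a b : coef_uv (G - G') a b = coef_uv G a b - coef_uv G' a b by [].
have zzM G (c : bool) a b : coef_uv (G *+ c) a b = coef_uv G a b *+ c by case: c.
apply: coef_uv_inj => a b; rewrite coef_uv_diff.
have XE a' b' : coef_uv X a' b' = ser_bracket inv (L i j) (L k l) a' b'.
  by rewrite /X zzB coef_uv_UV coef_uv_VU.
rewrite !XE.
have -> : coef_uv Y a b = (ser_v inv (L i l) a b - ser_u inv (L i l) a b) *+ (j == k)
    - (ser_v inv (L k j) a b - ser_u inv (L k j) a b) *+ (l == i).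
  rewrite /Y !natE zzB 2!zzM.
  rewrite 2!zzB.
  by rewrite !coef_uv_inU !coef_uv_inV.
have := lax i j k l a b; rewrite /mul_u_sub_v => ->.
by rewrite !mulrnBl opprB addrA addrAC.
Qed.

End TwoVariables.

(** * The Lax relation at coinciding points *)

Section SamePoint.
Variables (F : fieldType) (R : algType F) (inv : bool).
Implicit Types (f g : laurent R) (a b c : int) (K : nat).

Lemma zmulE f g c (r : seq int) : uniq r ->
  (forall a, a \notin r -> zcoef inv f a * zcoef inv g (c - a) = 0) ->
  zcoef inv (f * g) c = \sum_(a <- r) zcoef inv f a * zcoef inv g (c - a).
Proof.
pose sg (x : int) := if inv then - x else x.
have sK : involutive sg by rewrite /sg => x; case: inv; rewrite ?opprK.
have sB x y : sg (x - y) = sg x - sg y by rewrite /sg; case: inv; lia.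
move=> ur fg0; transitivity ((f * g) (sg c)) => //.
have zE (h : laurent R) a : zcoef inv h a = h (sg a) by [].
rewrite (@lmulE _ _ _ _ [seq sg a | a <- r]).
- by rewrite big_map; apply: eq_bigr => a _; rewrite !zE sB.
- by rewrite map_inj_uniq //; exact: inv_inj.
move=> i; rewrite -(sK i); move: (sg i) => a.
by rewrite (mem_map (inv_inj sK)) => /fg0; rewrite !zE sB.
Qed.

Lemma zcoef_support f g c : exists K0 : nat, forall a : int, K0%:Z <= `|a| ->
  zcoef inv f a = 0 \/ zcoef inv g (c - a) = 0.
Proof.
have [N [bf bg]] := lcommon f g; exists (absz N + absz c)%N.+1 => a leK.
rewrite /zcoef; set x := if inv then - a else a; set y := if inv then _ else _.
have [xN|Nx] := ltP x N; first by left; exact: bf.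
by right; apply: bg; move: Nx; rewrite /x /y; case: inv; lia.
Qed.

(** Summation by parts; the boundary terms vanish. *)
Lemma abel_sum (H : int -> R) K : H (- K%:Z - 1) = 0 -> H K%:Z = 0 ->
  \sum_(k < (K + K).+1) H (k%:Z - K%:Z) =
  \sum_(k < (K + K).+1) (H (k%:Z - K%:Z - 1) - H (k%:Z - K%:Z)) *~ (k%:Z - K%:Z).
Proof.
move=> H1 H2.
have E m : \sum_(k < m) (H (k%:Z - K%:Z - 1) - H (k%:Z - K%:Z)) *~ (k%:Z - K%:Z) =
  \sum_(k < m) H (k%:Z - K%:Z) - H (m%:Z - K%:Z - 1) *~ (m%:Z - K%:Z).
  elim: m => [|m IH]; first by rewrite !big_ord0 !sub0r H1 mul0rz oppr0.
  rewrite !big_ord_recr /= IH.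
  have -> : m.+1%:Z - K%:Z - 1 = m%:Z - K%:Z by lia.
  have -> : m.+1%:Z - K%:Z = m%:Z - K%:Z + 1 by lia.
  move: (m%:Z - K%:Z) => a; rewrite mulrzBl mulrzDr mulr1z.
  move: (H (a - 1) *~ a) (H a *~ a) (\sum_(i < m) _) => x y z.
  by rewrite addrA subrK opprD addrA addrAC addrK.
rewrite E; have -> : (K + K).+1%:Z - K%:Z - 1 = K%:Z by lia.
by rewrite H2 mul0rz subr0.
Qed.

Lemma delta_sum (K : nat) (x : int -> R) c : `|c| <= K%:Z ->
  \sum_(k < (K + K).+1) (x (k%:Z - K%:Z) *+ (c - (k%:Z - K%:Z) == 0)) *~ (k%:Z - K%:Z) = x c *~ c.
Proof.
move=> cK; have ltk : (absz (c + K%:Z)%R < (K + K).+1)%N by lia.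
have Ek : (absz (c + K%:Z)%R)%:Z - K%:Z = c by lia.
rewrite (bigD1 (Ordinal ltk)) //= Ek subrr eqxx big1 ?addr0 // => k kN.
case: eqP => [E|_]; last by rewrite mulr0n mul0rz.
by case/eqP: kN; apply: val_inj => /=; lia.
Qed.

Variables (n : nat) (L : 'M[laurent R]_n).
Hypothesis lax : series_gaudin_lax inv L.

(** The coefficient of [z^c] in the commutator is the sum of the commutators of
    coefficients of exponents [a] and [c - a].  The relation at [u^a v^(c+1-a)]
    gives the difference of two consecutive terms, so that this sum is the sum
    of the right-hand sides weighted by [a] ([abel_sum]); the weight [c + 1] of
    the only surviving term is the one of a derivative. *)
Lemma lax_same_point i j k l : L i j * L k l - L k l * L i j =
  lderiv inv (L k j) *+ (l == i) - lderiv inv (L i l) *+ (j == k).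
Proof.
suff E c : zcoef inv (L i j * L k l - L k l * L i j) c =
    zcoef inv (lderiv inv (L k j) *+ (l == i) - lderiv inv (L i l) *+ (j == k)) c.
  apply: laurentP => m; have := E (if inv then - m else m); rewrite /zcoef.
  by case: inv; rewrite ?opprK.
have zB (f g : laurent R) a : zcoef inv (f - g) a = zcoef inv f a - zcoef inv g a by [].
have zM (f : laurent R) (b : bool) a : zcoef inv (f *+ b) a = zcoef inv f a *+ b by case: b.
rewrite !zB !zM !zcoef_lderiv.
have [K0 W] := zcoef_support (L i j) (L k l) c.
pose K := (K0 + absz (c + 1)%R).+1.
pose H a := bracket (zcoef inv (L i j) a) (zcoef inv (L k l) (c - a)).
have H0 a : K%:Z <= `|a| -> H a = 0.
  move=> Ka; have [|E|E] := W a; first (by lia); by rewrite /H /bracket E ?mulr0 ?mul0r subrr.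
pose r := [seq x%:Z - K%:Z | x <- iota 0 (K + K).+1].
have ur : uniq r by rewrite map_inj_uniq ?iota_uniq // => x y; lia.
have out a : a \notin r -> K%:Z <= `|a|.
  move=> Ha; rewrite leNgt; apply: contra Ha => Ha; apply/mapP.
  by exists (absz (a + K%:Z)); rewrite ?mem_iota; lia.
have sumr (G : int -> R) : \sum_(a <- r) G a = \sum_(x < (K + K).+1) G (x%:Z - K%:Z).
  by rewrite big_map -[iota 0 _]/(index_iota 0 (K + K).+1) big_mkord.
rewrite (zmulE ur); last first.
  by move=> a /out Ha; have [|->|->] := W a; rewrite ?mulr0 ?mul0r //; lia.
have -> : zcoef inv (L k l * L i j) c =
    \sum_(a <- r) zcoef inv (L k l) (c - a) * zcoef inv (L i j) a.
  rewrite (@zmulE _ _ _ [seq c - a | a <- r]).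
  - by rewrite big_map; apply: eq_bigr => a _; rewrite subKr.
  - by rewrite map_inj_uniq // => x y; lia.
  move=> a Ha; have /out Ka : c - a \notin r.
    by apply: contra Ha => Ha; apply/mapP; exists (c - a); rewrite ?subKr.
  have [|E|E] := W (c - a); first lia; first by rewrite E mulr0.
  by rewrite subKr in E; rewrite E mul0r.
rewrite -sumrB; transitivity (\sum_(a <- r) H a) => //.
rewrite sumr abel_sum; [|by apply: H0; lia|by apply: H0; lia].
pose X := L i l; pose Y := L k j.
have step a : H (a - 1) - H a = ser_v inv X a (c + 1 - a) *+ (j == k) - ser_u inv X a (c + 1 - a) *+ (j == k)
      - ser_v inv Y a (c + 1 - a) *+ (l == i) + ser_u inv Y a (c + 1 - a) *+ (l == i).
  rewrite -(lax i j k l a (c + 1 - a)) /mul_u_sub_v /H /ser_bracket.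
  by congr (bracket _ (zcoef _ _ _) - bracket _ (zcoef _ _ _)); lia.
have u_sum f (b : bool) : \sum_(x < (K + K).+1) (ser_u inv f (x%:Z - K%:Z) (c + 1 - (x%:Z - K%:Z)) *+ b) *~ (x%:Z - K%:Z)
    = zcoef inv f (c + 1) *~ (c + 1) *+ b.
  rewrite -(@delta_sum K _ (c + 1)); last by rewrite /K; lia.
  by rewrite -sumrMnl; apply: eq_bigr => x _; case: b; rewrite ?mul0rz.
have v_sum f (b : bool) : \sum_(x < (K + K).+1) (ser_v inv f (x%:Z - K%:Z) (c + 1 - (x%:Z - K%:Z)) *+ b) *~ (x%:Z - K%:Z) = 0.
  apply: big1 => x _; rewrite /ser_v.
  by case: (_ - _ =P 0) => [->|_]; rewrite ?mulr0z // mulr0n mul0rn mul0rz.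
under eq_bigr do rewrite step mulrzDl !mulrzBl.
by rewrite big_split !sumrB /= !u_sum !v_sum sub0r subr0 addrC.
Qed.

End SamePoint.

(** * Commuting determinant coefficients of a series Lax matrix *)

Section Manin.
Variables (F : fieldType) (A : algType F) (d : derivation A) (n : nat).
Variable L : 'M[A]_n.
Notation M := (gaudin_op d L).

Lemma gaudin_opE i j : M i j = (i == j)%:R * dop_D d - dop_const d (L i j).
Proof. by rewrite !mxE mulr_natl. Qed.

Hypothesis lax : forall i j k l, L i j * L k l - L k l * L i j =
  d (L k j) *+ (l == i) - d (L i l) *+ (j == k).

Lemma gaudin_manin i k a b :
  M i a * M k b - M k b * M i a = M k a * M i b - M i b * M k a.
Proof.
rewrite !gaudin_opE; set D := dop_D d; pose c := dop_const d.
have DC x : D * c x = c x * D + c (d x) by exact: dop_DM.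
have LL i' j k' l : c (L i' j) * c (L k' l) = c (L k' l) * c (L i' j) +
    (l == i')%:R * c (d (L k' j)) - (j == k')%:R * c (d (L i' l)).
  have E : c (L i' j * L k' l - L k' l * L i' j) = c (d (L k' j) *+ (l == i') - d (L i' l) *+ (j == k')).
    by rewrite lax.
  have cM x y : c (x * y) = c x * c y by exact: rmorphM.
  have cB x y : c (x - y) = c x - c y by exact: raddfB.
  have cn x (b' : bool) : c (x *+ b') = c x *+ b' by exact: raddfMn.
  rewrite !cB !cM !cn in E.
  by rewrite !mulr_natl -addrA -E addrC subrK.
have E1 := LL i a k b; have E2 := LL k a i b.
have [D1 D2 D3 D4] := And4 (DC (L i a)) (DC (L k b)) (DC (L k a)) (DC (L i b)).
rewrite -/(c (L i a)) -/(c (L k b)) -/(c (L k a)) -/(c (L i b)).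
rewrite (eq_sym b i) (eq_sym a k) in E1; rewrite (eq_sym b k) (eq_sym a i) in E2.
have n1 (b' : bool) (x : diffop d) : x * b'%:R = b'%:R * x by rewrite commr_nat.
move: D1 D2 D3 D4 E1 E2.
move: (i == a)%:R (n1 (i == a)) => r1 c1; move: (k == b)%:R (n1 (k == b)) => r2 c2.
move: (k == a)%:R (n1 (k == a)) => r3 c3; move: (i == b)%:R (n1 (i == b)) => r4 c4.
move: (c (L i a)) (c (L k b)) (c (L k a)) (c (L i b)) => x y z w.
move: (c (d (L i a))) (c (d (L k b))) (c (d (L k a))) (c (d (L i b))) => x' y' z' w'.
move=> D1 D2 D3 D4 E1 E2.
nc (tt, D1, D2, D3, D4, E1, E2, c1 D, c1 x, c1 y, c1 z, c1 w,
  c2 D, c2 x, c2 y, c2 z, c2 w, c3 D, c3 x, c3 y, c3 z, c3 w, c4 D, c4 x, c4 y, c4 z, c4 w,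
  c1 r2, c1 r3, c1 r4, c2 r3, c2 r4, c3 r4).
Qed.

End Manin.

Section FirstOrder.
Variable B : nzRingType.
Implicit Types r D E x y s : B.

Lemma first_order_s r D x s : (forall z, r * z = z * r) -> x * s = s * x ->
  D * s = s * D - s * s -> (r * D - x) * s = s * (r * D - x) - r * (s * s).
Proof. by move=> rC E1 E2; have E3 := esym (rC s); nc (tt, E1, E2, E3). Qed.

Lemma first_order_s' r D x s : (forall z, r * z = z * r) -> x * s = s * x ->
  D * s = s * D + s * s -> (r * D - x) * s = s * (r * D - x) + r * (s * s).
Proof. by move=> rC E1 E2; have E3 := esym (rC s); nc (tt, E1, E2, E3). Qed.

Lemma first_order_cross r1 r2 r3 r4 r5 r6 D E x1 x2 x3 y1 y2 y3 s :
  (forall z, r1 * z = z * r1) -> (forall z, r2 * z = z * r2) ->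
  (forall z, r3 * z = z * r3) -> (forall z, r4 * z = z * r4) ->
  r5 = r4 -> r6 = r3 ->
  D * s = s * D - s * s -> E * s = s * E + s * s -> E * D = D * E ->
  D * y1 = y1 * D -> E * x1 = x1 * E ->
  x2 * s = s * x2 -> y3 * s = s * y3 ->
  x1 * y1 = y1 * x1 + s * (r3 * (y2 - x2) - r4 * (y3 - x3)) ->
  (r1 * D - x1) * (r2 * E - y1) = (r2 * E - y1) * (r1 * D - x1) +
   r3 * ((r5 * D - x2) * s - s * (r5 * E - y2)) +
   r4 * ((r6 * E - y3) * s - s * (r6 * D - x3)).
Proof.
move=> c1 c2 c3 c4 -> -> Ds Es ED Dy Ex xs ys H.
nc (tt, Ds, Es, ED, Dy, Ex, xs, ys, H, esym (c1 D), esym (c1 E), esym (c1 x1), esym (c1 y1),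
  esym (c2 D), esym (c2 E), esym (c2 x1), esym (c2 y1), c1 r2,
  esym (c3 s), esym (c4 s), c3 r4).
Qed.

End FirstOrder.

Section TwoPoints.
Variables (F : fieldType) (R : algType F) (inv : bool).
Local Notation dz := (laurent_dz R inv).
Local Notation du := (der_u R inv).
Local Notation dv := (der_v R inv).

Definition dvB : derivation (diffop du) := dop_der (fun G => der_uv inv G).

Fact constV_der f : (@dop_const _ _ du \o inV R) (dz f) = dvB ((@dop_const _ _ du \o inV R) f).
Proof.
transitivity (dvB (dop_const du (inV R f))) => //.
by rewrite dop_der_const der_inV_v.
Qed.

Definition opU : {rmorphism diffop dz -> diffop dvB} :=
  (@dop_const _ _ dvB \o dop_map (fun f => esym (der_inU_u inv f))).
Definition opV : {rmorphism diffop dz -> diffop dvB} := dop_map constV_der.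

Definition cstB (G : laurent (laurent R)) : diffop dvB := dop_const dvB (dop_const du G).
Definition Du : diffop dvB := dop_const dvB (dop_D du).
Definition Dv : diffop dvB := dop_D dvB.

Lemma cstBM G G' : cstB (G * G') = cstB G * cstB G'.
Proof. by rewrite /cstB !rmorphM. Qed.
Lemma cstBB G G' : cstB (G - G') = cstB G - cstB G'.
Proof. by rewrite /cstB !raddfB. Qed.
Lemma cstBD G G' : cstB (G + G') = cstB G + cstB G'.
Proof. by rewrite /cstB !raddfD. Qed.
Lemma cstBN G : cstB (- G) = - cstB G.
Proof. by rewrite /cstB !raddfN. Qed.
Lemma cstB1 : cstB 1 = 1.
Proof. by rewrite /cstB !rmorph1. Qed.
Lemma cstB0 : cstB 0 = 0.
Proof. by rewrite /cstB !raddf0. Qed.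
Lemma cstBn m : cstB m%:R = m%:R.
Proof. by rewrite /cstB !rmorph_nat. Qed.

Lemma Du_cst G : Du * cstB G = cstB G * Du + cstB (du G).
Proof. by rewrite /Du /cstB -!rmorphM -rmorphD dop_DM. Qed.
Lemma Dv_cst G : Dv * cstB G = cstB G * Dv + cstB (dv G).
Proof. by rewrite /Dv /cstB dop_DM dop_der_const. Qed.
Lemma Dv_Du : Dv * Du = Du * Dv.
Proof. by rewrite /Dv /Du dop_DM dop_der_D raddf0 addr0. Qed.

Lemma opU_const f : opU (dop_const dz f) = cstB (inU R f).
Proof. by rewrite /cstB -(dop_map_const (fun f => esym (der_inU_u inv f))). Qed.
Lemma opU_D : opU (dop_D dz) = Du.
Proof. by rewrite /Du -(dop_map_D (fun f => esym (der_inU_u inv f))). Qed.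
Lemma opV_const f : opV (dop_const dz f) = cstB (inV R f).
Proof. exact: (dop_map_const constV_der). Qed.
Lemma opV_D : opV (dop_D dz) = Dv.
Proof. exact: (dop_map_D constV_der). Qed.

Lemma coef_mul_const (F' : fieldType) (A : algType F') (d : derivation A) (p : diffop d) c k :
  d c = 0 -> dop_coef k (p * dop_const d c) = dop_coef k p * c.
Proof.
move=> dc; move: p; apply: diffop_ind => [a i|p q Ep Eq].
  have Dc j : dop_D d ^+ j * dop_const d c = dop_const d c * dop_D d ^+ j.
    elim: j => [|j IH]; first by rewrite expr0 mulr1 mul1r.
    by rewrite exprS -mulrA IH mulrA dop_DM dc raddf0 addr0 -mulrA.
  rewrite -mulrA Dc mulrA -rmorphM !dop_coef_monom.
  by case: eqP; rewrite ?mul0r.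
by rewrite mulrDl /dop_coef !coefD mulrDl -/(dop_coef k _) Ep -/(dop_coef k _) Eq.
Qed.

Lemma coef_const_mul (F' : fieldType) (A : algType F') (d : derivation A) (p : diffop d) c k :
  dop_coef k (dop_const d c * p) = c * dop_coef k p.
Proof. by rewrite dop_constM /dop_coef coefZ. Qed.

(** The two operators involve different derivations, so their product has a
    product of coefficients as coefficient of [d_u^k d_v^l]. *)
Lemma opUV_comm (p q : diffop dz) : opU p * opV q = opV q * opU p ->
  forall k l, series_commute inv (dop_coef k p) (dop_coef l q).
Proof.
move=> E k l; pose pU := dop_map (fun f => esym (der_inU_u inv f)) p : diffop du.
have pU0 : dvB pU = 0.
  apply/polyP => m; rewrite coef_map coef0 /= -[X in lderiv _ X]/(dop_coef m pU).
  by rewrite dop_map_coef; exact: der_inU_v.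
have := congr1 (dop_coef l) E.
rewrite -[opU p]/(dop_const dvB pU) coef_const_mul coef_mul_const // dop_map_coef.
move=> /(congr1 (dop_coef k)); rewrite [LHS]coef_mul_const; last exact: der_inV_u.
rewrite [RHS]coef_const_mul dop_map_coef => {}E a b.
have := congr1 (fun G => coef_uv inv G a b) E; rewrite coef_uv_UV coef_uv_VU /ser_bracket /bracket => ->.
by rewrite subrr.
Qed.

(** The hypotheses of [talalaev] for [d_u - L(u)] and [d_v - L(v)]: the
    derivations drop out of the cross relation because [d_u + d_v] commutes with
    [1 / (u - v)]. *)
Theorem QH_commute (hf : F) (n : nat) (L : 'M[laurent R]_n) : hf + hf = 1 ->
  series_gaudin_lax inv L -> forall k l, series_commute inv (QH dz L k) (QH dz L l).
Proof.
move=> hfE lax k l; apply: opUV_comm; rewrite !det_column_map.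
have manin := gaudin_manin (d := dz) (lax_same_point lax).
set Mg := gaudin_op dz L in manin *.
pose s := cstB (uv_inv R inv).
have nC (b : bool) (z : diffop dvB) : b%:R * z = z * b%:R by rewrite commr_nat.
have csC G : cstB G * s = s * cstB G by rewrite /s -!cstBM uv_inv_comm.
have ME i j : opU (Mg i j) = (i == j)%:R * Du - cstB (inU R (L i j)).
  by rewrite /Mg gaudin_opE rmorphB rmorphM rmorph_nat opU_D opU_const.
have NE i j : opV (Mg i j) = (i == j)%:R * Dv - cstB (inV R (L i j)).
  by rewrite /Mg gaudin_opE rmorphB rmorphM rmorph_nat opV_D opV_const.
apply: (@talalaev _ n (fun i j => opU (Mg i j)) (fun i j => opV (Mg i j))
  (cstB (uv_inv R inv)) (cstB (uv_diff R inv)) (hf *: 1)).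
- by rewrite -scalerDl hfE scale1r.
- by rewrite -cstBM uv_inv_diff cstB1.
- by rewrite -cstBM uv_diff_inv cstB1.
- by move=> i j a b; rewrite -!rmorphM -!rmorphB manin.
- by move=> i j a b; rewrite -!rmorphM -!rmorphB manin.
- move=> i j; rewrite ME; apply: first_order_s; [exact: nC|exact: csC|].
  by have := Du_cst (uv_inv R inv); rewrite der_u_inv cstBN cstBM.
- move=> i j; rewrite NE; apply: first_order_s'; [exact: nC|exact: csC|].
  by have := Dv_cst (uv_inv R inv); rewrite der_v_inv cstBM.
move=> i j k' l'; rewrite !ME !NE.
apply: first_order_cross; try exact: nC; try exact: csC.
- by rewrite eq_sym.
- by rewrite eq_sym.
- by have := Du_cst (uv_inv R inv); rewrite der_u_inv cstBN cstBM.
- by have := Dv_cst (uv_inv R inv); rewrite der_v_inv cstBM.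
- exact: Dv_Du.
- by rewrite Du_cst der_inV_u cstB0 addr0.
- by rewrite Dv_cst der_inU_v cstB0 addr0.
by rewrite -!cstBM (lax_two_points lax) -!cstBn -!cstBB -!cstBM -cstBB -cstBM -cstBD.
Qed.

End TwoPoints.

(** * Manin matrices and their left adjugate *)

Section ManinMatrices.
Variables (B : nzRingType) (hf : B).
Hypothesis hfE : hf + hf = 1.

Definition manin m n (Y : 'I_m -> 'I_n -> B) := forall i k a b,
  Y i a * Y k b - Y k b * Y i a = Y k a * Y i b - Y i b * Y k a.

Definition cdet n (Y : 'I_n -> 'I_n -> B) := det_column (\matrix_(i, j) Y i j).

Lemma half_tor (z : B) : z = - z -> z = 0.
Proof. by move=> E; rewrite -[z]mul1r -hfE mulrDl -mulrDr {2}E subrr mulr0. Qed.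

(** The sign is the one of permuting the anticommuting dressed columns. *)
Lemma cdet_perm n (Y : 'I_n -> 'I_n -> B) (tau : 'S_n) : manin Y ->
  cdet (fun i j => Y i (tau j)) = (-1) ^+ tau * cdet Y.
Proof.
move=> mY; have [A [iota [c [d [v [fm ic id dv inj]]]]]] := fock_exists B 'I_n.
have tor (z : A) : z = - z -> z = 0.
  move=> E; rewrite -[z]mul1r -(rmorph1 iota) -hfE rmorphD mulrDl -mulrDr.
  by rewrite {2}E subrr mulr0.
pose Y' i j := iota (Y i j).
have anti : anticommute (dress c Y') (dress c Y').
  move=> i j; apply: dress_manin => // [|i' k a|i' k a b]; [exact: (fcc fm)|exact: ic|].
  by rewrite -!rmorphM -!rmorphB mY.
have det Z : \prod_(j < n) dress c (fun i j => iota (Z i j)) j = iota (cdet Z) * \prod_(j < n) c j.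
  by apply: prod_dress_map; [exact: (fcc fm)|exact: (fc2 fm)|exact: ic].
have E := prod_perm tau anti; rewrite (det Y) -[LHS]/(\prod_(j < n) dress c (fun i j => iota (Y i (tau j))) j) in E.
rewrite (det (fun i j => Y i (tau j))) in E.
apply/eqP; rewrite -subr_eq0; apply/eqP; apply: inj.
apply: (fock_undo fm dv (fun i => id _ i) (index_enum_uniq 'I_n)).
by rewrite mulrA rmorphB mulrBl E rmorphM rmorph_sign -mulrA subrr mul0r.
Qed.

Lemma cdet_eq0 n (Y : 'I_n -> 'I_n -> B) a b : manin Y -> a != b ->
  (forall i, Y i a = Y i b) -> cdet Y = 0.
Proof.
move=> mY ab E; apply: half_tor.
have := cdet_perm (tperm a b) mY; rewrite odd_tperm ab expr1 mulN1r => <-.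
rewrite /cdet; congr det_column; apply/matrixP => i j; rewrite !mxE.
by case: tpermP => // ->; rewrite E.
Qed.

Section Adjugate.
Variables (n : nat) (M : 'I_n.+1 -> 'I_n.+1 -> B).
Hypothesis mM : manin M.

Definition replace_col j (w : 'I_n.+1 -> B) i k := if k == j then w i else M i k.

(** The second index is that of the row in which the replaced column has its 1. *)
Definition cadj j k := cdet (replace_col j (fun i => (i == k)%:R)).

Lemma manin_replace j k : manin (replace_col j (fun i => (i == k)%:R)).
Proof.
move=> i i' a b; rewrite /replace_col.
have c1 (x : B) : x * (i == k)%:R = (i == k)%:R * x by rewrite commr_nat.
have c2 (x : B) : x * (i' == k)%:R = (i' == k)%:R * x by rewrite commr_nat.
move: (i == k)%:R (i' == k)%:R c1 c2 => x y c1 c2.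
case: (a == j); case: (b == j); last exact: mM.
- by rewrite c2 !subrr.
- by rewrite -c1 -c2 !subrr.
- by rewrite c1 c2 !subrr.
Qed.

Lemma cdet_last (Y : 'I_n.+1 -> 'I_n.+1 -> B) :
  cdet Y = \sum_(s : 'S_n.+1) (-1) ^+ s * (\prod_(i < n) Y (s (widen_ord (leqnSn n) i)) (widen_ord (leqnSn n) i))
     * Y (s ord_max) ord_max.
Proof.
rewrite /cdet /det_column; apply: eq_bigr => s _.
rewrite big_ord_recr /= mxE mulrA; congr (_ * _ * _).
by apply: eq_bigr => i _; rewrite mxE.
Qed.

(** Right multiplication by [M k l] acts on the last factor of each product, so
    the replaced column is first moved to the last place; then the sum over [k]
    puts column [l] in the place of column [j]. *)
Lemma cadjM j l : \sum_k cadj j k * M k l = if j == l then cdet M else 0.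
Proof.
pose Y := replace_col j (M^~ l).
have -> : \sum_k cadj j k * M k l = cdet Y.
  pose tau := tperm j ord_max.
  have sg (x : B) : (-1) ^+ (odd_perm tau) * ((-1) ^+ (odd_perm tau) * x) = x by exact: signrMK.
  have mY : manin Y.
    by move=> i i' a b; rewrite /Y /replace_col; case: (a == j); case: (b == j); rewrite mM.
  rewrite -[cdet Y]sg -(cdet_perm tau mY) cdet_last.
  under eq_bigr => k _ do rewrite /cadj -[cdet _]sg -(cdet_perm tau (manin_replace j k)) cdet_last -mulrA mulr_suml.
  rewrite -mulr_sumr; congr (_ * _); rewrite exchange_big; apply: eq_bigr => s _ /=.
  have rest i : tau (widen_ord (leqnSn n) i) == j = false.
    rewrite /tau; case: tpermP => [E|E|/eqP E _]; [|by have := ltn_ord i; rewrite -[X in (X < _)%N]/(val (widen_ord (leqnSn n) i)) E /= ltnn|exact: negbTE].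
    by apply/eqP => E'; have := ltn_ord i; rewrite -[X in (X < _)%N]/(val (widen_ord (leqnSn n) i)) E -E' /= ltnn.
  rewrite (eq_bigr (fun k => (-1) ^+ s * (\prod_(i < n) M (s (widen_ord (leqnSn n) i)) (tau (widen_ord (leqnSn n) i))) *
     ((s ord_max == k)%:R * M k l))); last first.
    move=> k _; rewrite /replace_col tpermR eqxx [RHS]mulrA; congr (_ * _ * _ * _).
    by apply: eq_bigr => i _; rewrite rest.
  rewrite -mulr_sumr (bigD1 (s ord_max)) //= eqxx mul1r [X in _ + X]big1 ?addr0; last first.
    by move=> k /negbTE kN; rewrite eq_sym kN mul0r.
  rewrite /Y /replace_col tpermR eqxx; congr (_ * _ * _).
  by apply: eq_bigr => i _; rewrite rest.
case: eqP => [jl|/eqP jl].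
  rewrite /cdet; congr det_column; apply/matrixP => i k; rewrite !mxE /Y /replace_col.
  by case: eqP => // ->; rewrite jl.
apply: (cdet_eq0 (a := j) (b := l)) => //.
  by move=> i i' a b; rewrite /Y /replace_col; case: (a == j); case: (b == j); rewrite mM.
by move=> i; rewrite /Y /replace_col eqxx eq_sym (negbTE jl).
Qed.

End Adjugate.

End ManinMatrices.

(** * Derivatives of the adjugate *)

Section Leibniz.
Variables (B : nzRingType) (delta : {additive B -> B}).
Hypothesis deltaM : forall x y, delta (x * y) = delta x * y + x * delta y.

Lemma leibniz_prod m (f : 'I_m -> B) :
  delta (\prod_(i < m) f i) = \sum_(j < m) \prod_(i < m) (if i == j then delta (f i) else f i).
Proof.
have delta1 : delta 1 = 0.
  have := deltaM 1 1; rewrite !mulr1 mul1r => /eqP.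
  by rewrite -[X in X == _]addr0 (inj_eq (addrI _)) eq_sym => /eqP.
elim: m f => [|m IH] f; first by rewrite !big_ord0.
rewrite big_ord_recl deltaM IH [RHS]big_ord_recl; congr (_ + _).
  by rewrite big_ord_recl eqxx.
rewrite mulr_sumr; apply: eq_bigr => j _; rewrite big_ord_recl.
by congr (_ * _); apply: eq_bigr => i _; rewrite (inj_eq lift_inj).
Qed.

Lemma leibniz_iter r x y e : delta y = e -> delta e = 0 ->
  iter r.+1 delta (x * y) = iter r.+1 delta x * y + (iter r delta x * e) *+ r.+1.
Proof.
move=> dy de; elim: r => [|r IH]; first by rewrite /= deltaM dy mulr1n.
rewrite iterS IH raddfD deltaM dy -addrA; congr (_ + _).
by rewrite raddfMn deltaM de mulr0 addr0 -!iterS -mulrS.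
Qed.

(** [delta] is the derivative with respect to the symbol of the derivation. *)
Variables (n : nat) (M : 'I_n.+1 -> 'I_n.+1 -> B) (hf : B).
Hypothesis (hfE : hf + hf = 1) (mM : manin M).
Hypothesis dM : forall i j, delta (M i j) = (i == j)%:R.

Lemma delta_cdet : delta (cdet M) = \sum_j cadj M j j.
Proof.
rewrite /cdet /cadj /det_column raddf_sum exchange_big; apply: eq_bigr => s _ /=.
rewrite raddfMsign leibniz_prod mulr_sumr; apply: eq_bigr => j _; congr (_ * _).
apply: eq_bigr => i _; rewrite !mxE /replace_col; case: eqP => [->|//].
by rewrite dM.
Qed.

Definition adj_der r := \matrix_(j, k) iter r delta (cadj M j k).
Let MM : 'M[B]_n.+1 := \matrix_(i, j) M i j.

Lemma iter_delta_sum r m (f : 'I_m -> B) :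
  iter r delta (\sum_i f i) = \sum_i iter r delta (f i).
Proof. by elim: r => //= r ->; rewrite raddf_sum. Qed.

Lemma iter_delta0 r : iter r delta 0 = 0.
Proof. by elim: r => //= r ->; rewrite raddf0. Qed.

Lemma adj_derM0 : adj_der 0 *m MM = (cdet M)%:M.
Proof.
apply/matrixP => j l; rewrite !mxE.
rewrite (eq_bigr (fun k => cadj M j k * M k l)); last by move=> k _; rewrite !mxE.
by rewrite (cadjM hfE mM) mulrb.
Qed.

Lemma adj_derM r : adj_der r.+1 *m MM + adj_der r *+ r.+1 = (iter r.+1 delta (cdet M))%:M.
Proof.
have delta_nat (b : bool) : delta b%:R = 0.
  have delta1 : delta 1 = 0.
    have := deltaM 1 1; rewrite !mulr1 mul1r => /eqP.
    by rewrite -[X in X == _]addr0 (inj_eq (addrI _)) eq_sym => /eqP.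
  by case: b; rewrite ?raddf0.
apply/matrixP => j l; rewrite !mxE mulmxnE !mxE.
have := congr1 (iter r.+1 delta) (cadjM hfE mM j l); rewrite iter_delta_sum.
rewrite (eq_bigr _ (fun k _ => leibniz_iter r (cadj M j k) (dM k l) (delta_nat _))).
rewrite big_split /= => E; rewrite [RHS](_ : _ = iter r.+1 delta (if j == l then cdet M else 0)); last first.
  by case: eqP => _; rewrite ?mulr1n ?mulr0n // iter_delta0.
rewrite -[RHS]E; congr (_ + _); first by apply: eq_bigr => k _; rewrite !mxE.
rewrite (bigD1 l) //= eqxx mulr1 big1 ?addr0 // => k /negbTE->.
by rewrite mulr0 mul0rn.
Qed.

Lemma tr_adj_der r : \tr (adj_der r) = iter r.+1 delta (cdet M).
Proof.
rewrite iterSr delta_cdet iter_delta_sum; apply: eq_bigr => j _; by rewrite !mxE.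
Qed.

End Leibniz.

(** * Traces of the powers of a Manin matrix *)

Record subalg (F : fieldType) (B : algType F) (Z : B -> Prop) : Prop := Subalg {
  sub1 : Z 1;
  subD : forall x y, Z x -> Z y -> Z (x + y);
  subM : forall x y, Z x -> Z y -> Z (x * y);
  subZ : forall c x, Z x -> Z (c *: x) }.

Section SubalgTheory.
Variables (F : fieldType) (B : algType F) (Z : B -> Prop) (sZ : subalg Z).

Lemma sub0 : Z 0.
Proof. by rewrite -(scale0r (1 : B)); apply: subZ; last exact: sub1. Qed.
Lemma subN x : Z x -> Z (- x).
Proof. by rewrite -scaleN1r; exact: subZ. Qed.
Lemma subB x y : Z x -> Z y -> Z (x - y).
Proof. by move=> Zx Zy; apply: (subD sZ) => //; exact: subN. Qed.
Lemma sub_muln x m : Z x -> Z (x *+ m).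
Proof. by rewrite -scaler_nat; exact: subZ. Qed.
Lemma sub_sum (I : Type) (r : seq I) (P : pred I) (f : I -> B) :
  (forall i, P i -> Z (f i)) -> Z (\sum_(i <- r | P i) f i).
Proof. by move=> Zf; apply: big_ind; [exact: sub0|exact: subD|]. Qed.
End SubalgTheory.

Section PowerTraces.
Variables (F : fieldType) (B : algType F) (n : nat) (M : 'M[B]_n).
Variables (Z : B -> Prop) (sZ : subalg Z).

Definition mpow k := iter k (mulmx^~ M) 1%:M.

Lemma mpowS k : mpow k.+1 = mpow k *m M. Proof. by []. Qed.
Lemma mpowD k m : mpow (k + m) = mpow k *m mpow m.
Proof.
elim: m => [|m IH]; first by rewrite addn0 mulmx1.
by rewrite addnS !mpowS IH mulmxA.
Qed.
Lemma mpowSl k : mpow k.+1 = M *m mpow k.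
Proof. by rewrite -add1n mpowD mpowS mul1mx. Qed.

(** Combinations of the powers of [M] below the [j]-th, with left coefficients in
    [Z]. *)
Definition zspan j (X : 'M[B]_n) := exists2 z : nat -> B, (forall k, Z (z k)) &
  X = \sum_(k < j) z k *: mpow k.

Lemma zspan_mul j X : zspan j X -> zspan j.+1 (X *m M).
Proof.
move=> [z Zz ->]; exists (fun k => if k is k'.+1 then z k' else 0).
  by move=> [|k]; [exact: (sub0 sZ)|].
rewrite big_ord_recl scale0r add0r mulmx_suml; apply: eq_bigr => k _.
by rewrite -scalemxAl -mpowS.
Qed.

Lemma zspan_add j X Y : zspan j X -> zspan j Y -> zspan j (X + Y).
Proof.
move=> [z Zz ->] [y Zy ->]; exists (fun k => z k + y k); first by move=> k; apply: (subD sZ).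
by rewrite -big_split; apply: eq_bigr => k _; rewrite scalerDl.
Qed.

Lemma zspan_scale j X x : Z x -> zspan j X -> zspan j (x *: X).
Proof.
move=> Zx [z Zz ->]; exists (fun k => x * z k); first by move=> k; apply: (subM sZ).
by rewrite scaler_sumr; apply: eq_bigr => k _; rewrite scalerA.
Qed.

Lemma zspan_one j x : Z x -> zspan j.+1 x%:M.
Proof.
move=> Zx; exists (fun k => if k == 0%N then x else 0).
  by move=> k; case: ifP => // _; exact: (sub0 sZ).
by rewrite big_ord_recl big1 ?addr0 ?scale_scalar_mx ?mulr1 // => k _; rewrite scale0r.
Qed.

Definition ptr k := \tr (mpow k).

Lemma zspan_tr j X : (forall k, (k < j)%N -> Z (ptr k)) -> zspan j X -> Z (\tr X).
Proof.
move=> Zt [z Zz ->]; rewrite linear_sum /=; apply: (sub_sum sZ) => k _.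
have -> : \tr (z k *: mpow k) = z k * ptr k.
  by rewrite /ptr /mxtrace mulr_sumr; apply: eq_bigr => i _; rewrite mxE.
by apply: (subM sZ) => //; exact: Zt.
Qed.

End PowerTraces.

Section Newton.
Variables (F : fieldType) (B : algType F) (Z : B -> Prop) (sZ : subalg Z).
Hypothesis char0 : forall m : nat, m.+1%:R != 0 :> F.
Variables (delta : {additive B -> B}).
Hypothesis deltaM : forall x y, delta (x * y) = delta x * y + x * delta y.
Hypothesis Zdelta : forall x, Z x -> Z (delta x).
Variables (n : nat) (M : 'I_n.+1 -> 'I_n.+1 -> B).
Hypothesis mM : manin M.
Hypothesis dM : forall i j, delta (M i j) = (i == j)%:R.
Hypothesis ZD : Z (cdet M).
Hypothesis Dtop : iter n.+1 delta (cdet M) = n.+1`!%:R.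
Hypothesis adj_top : forall j k, iter n.+1 delta (cadj M j k) = 0.
Let MM : 'M[B]_n.+1 := \matrix_(i, j) M i j.
Let X := adj_der delta M.

Lemma half_alg : exists hf : B, hf + hf = 1.
Proof.
exists ((2%:R : F)^-1 *: 1); rewrite -scalerDl -[1 : B in RHS]scale1r; congr (_ *: _).
by rewrite -mulr2n -[_ *+ 2]mulr_natr mulVf.
Qed.

Lemma nat_inv r : ((r.+1%:R : F)^-1%:A : B) * r.+1%:R = 1.
Proof. by rewrite -(scaler_nat r.+1 (1 : B)) -scalerAl mul1r scalerA mulVf ?scale1r. Qed.

Lemma Z_iter r : Z (iter r delta (cdet M)).
Proof. by elim: r => //= r; exact: Zdelta. Qed.

(** By descent from the top derivative, which vanishes: [adj_derM] gives each
    derivative of the adjugate from the next one, multiplied by [M]. *)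
Lemma adj_span j : (j <= n)%N -> exists2 c : F, c != 0 &
  zspan MM Z j (X (n - j) - (c%:A : B) *: mpow MM j).
Proof.
have [hf hfE] := half_alg.
have XE r : X r = ((r.+1%:R : F)^-1%:A : B) *: ((iter r.+1 delta (cdet M))%:M - X r.+1 *m MM).
  rewrite -(adj_derM deltaM hfE mM dM) -/MM -/(X _) addrC addKr.
  by rewrite -(scaler_nat r.+1 (X r)) scalerA nat_inv scale1r.
have Za (c : F) : Z c%:A by apply: (subZ sZ); exact: (sub1 sZ).
elim: j => [|j IH] lejn.
  have X0 : X n.+1 = 0 by apply/matrixP => i k; rewrite !mxE adj_top.
  exists ((n.+1%:R)^-1 * n.+1`!%:R).
    rewrite mulf_neq0 ?invr_eq0 //.
    by have := fact_gt0 n.+1; case: (n.+1`!) => // m _; exact: char0.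
  exists (fun=> 0) => [_|]; first exact: (sub0 sZ).
  rewrite big_ord0 subn0 XE X0 mul0mx subr0 Dtop !scale_scalar_mx !mulr1.
  rewrite -(scaler_nat n.+1`! (1 : B)) -scalerAl mul1r scalerA subrr //.
have [c c0 W] := IH (ltnW lejn); exists (- ((n - j)%:R^-1 * c)).
  rewrite oppr_eq0 mulf_neq0 // invr_eq0.
  by have : (0 < n - j)%N; [rewrite subn_gt0|case: (n - j)%N => // m _; exact: char0].
have -> : X (n - j.+1) - (- ((n - j)%:R^-1 * c))%:A *: mpow MM j.+1 =
    ((n - j)%:R^-1)%:A *: ((iter (n - j) delta (cdet M))%:M - (X (n - j) - c%:A *: mpow MM j) *m MM).
  have En : (n - j.+1).+1 = (n - j)%N by rewrite subnSK.
  have K : (- ((n - j)%:R^-1 * c))%:A *: mpow MM j.+1 =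
      - (((n - j)%:R^-1)%:A *: (c%:A *: mpow MM j.+1)) :> 'M[B]_n.+1.
    by rewrite scaleNr scaleNr scalerA -scalerAl mul1r scalerA.
  by rewrite XE En K opprK mulmxBl -scalemxAl -mpowS !scalerBr opprB [in RHS]addrA [RHS]addrAC.
apply: (zspan_scale sZ) => //; apply: (zspan_add sZ); first by apply: (zspan_one _ sZ); exact: Z_iter.
rewrite -scaleN1r; apply: (zspan_scale sZ); last exact: (zspan_mul sZ).
by apply: (subN sZ); exact: (sub1 sZ).
Qed.

(** For small [k] the trace of [adj_span] is a derivative of the determinant
    ([tr_adj_der]) and has [ptr MM k] as its leading term.  The undifferentiated
    identity is a Cayley-Hamilton relation, which settles the larger [k]. *)
Lemma Z_ptr k : Z (ptr MM k).
Proof.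
have [hf hfE] := half_alg.
have div_c (c : F) x : c != 0 -> Z ((c%:A : B) * x) -> Z x.
  move=> c0 H; have -> : x = c^-1 *: ((c%:A : B) * x); last exact: (subZ sZ).
  by rewrite -scalerAl mul1r scalerA mulVf // scale1r.
have low j : (j <= n)%N -> (forall i, (i < j)%N -> Z (ptr MM i)) -> Z (ptr MM j).
  move=> lejn IH; have [c c0 W] := adj_span lejn; apply: (div_c c) => //.
  have := zspan_tr sZ IH W; rewrite linearB /= tr_adj_der //.
  have -> : \tr (c%:A *: mpow MM j) = c%:A * ptr MM j :> B.
    by rewrite /ptr /mxtrace mulr_sumr; apply: eq_bigr => i _; rewrite mxE.
  move=> /(subB sZ (Z_iter (n - j).+1)); by rewrite opprB addrC subrK.
have [c c0 W] := adj_span (leqnn n); rewrite subnn in W.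
have CH : zspan MM Z n.+1 ((c%:A : B) *: mpow MM n.+1).
  have -> : (c%:A : B) *: mpow MM n.+1 = (cdet M)%:M - (X 0 - (c%:A : B) *: mpow MM n) *m MM.
    by rewrite mulmxBl -scalemxAl -mpowS (adj_derM0 delta hfE mM) opprB addrC subrK.
  apply: (zspan_add sZ); first exact: (zspan_one _ sZ).
  rewrite -scaleN1r; apply: (zspan_scale sZ); last exact: (zspan_mul sZ).
  by apply: (subN sZ); exact: (sub1 sZ).
elim/ltn_ind: k => k IH; have [lekn|ltnk] := leqP k n; first exact: low.
case: CH => z Zz CH; apply: (div_c c) => //.
have -> : (c%:A : B) * ptr MM k = \sum_(i < n.+1) z i * ptr MM (i + (k - n.+1)).
  have trZ (x : B) (Y : 'M[B]_n.+1) : \tr (x *: Y) = x * \tr Y.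
    by rewrite /mxtrace mulr_sumr; apply: eq_bigr => i _; rewrite mxE.
  rewrite -trZ -{1}(subnKC ltnk) mpowD scalemxAl CH mulmx_suml linear_sum.
  by apply: eq_bigr => i _; rewrite /= -scalemxAl trZ -mpowD.
apply: (sub_sum sZ) => i _; apply: (subM sZ) => //; apply: IH.
by rewrite -[X in (_ < X)%N](subnKC ltnk) ltn_add2r.
Qed.

End Newton.

(** * Permanents of a Manin matrix *)

Lemma sum_lift_perm (V : nmodType) m (G : 'S_m.+1 -> V) :
  \sum_s G s = \sum_(k < m.+1) \sum_(s : 'S_m) G (lift_perm ord0 k s).
Proof.
rewrite pair_big /= (reindex (fun p : 'I_m.+1 * 'S_m => lift_perm ord0 p.1 p.2)) //=.
apply: onW_bij; apply: inj_card_bij; last by rewrite card_prod !card_Sn card_ord factS.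
move=> [k s] [k' s'] /= E.
have Ek : k = k' by rewrite -(lift_perm_id ord0 k s) E lift_perm_id.
congr pair => //; apply/permP => i; apply: (@lift_inj _ k).
by rewrite -(lift_perm_lift ord0 k s) E -Ek lift_perm_lift.
Qed.

Definition insert_at m (T : Type) (k : 'I_m.+1) (x : T) (l : 'I_m -> T) (i : 'I_m.+1) : T :=
  if unlift k i is Some j then l j else x.

Lemma insert_at_eq m T (k : 'I_m.+1) (x : T) l : insert_at k x l k = x.
Proof. by rewrite /insert_at unlift_none. Qed.
Lemma insert_at_lift m T (k : 'I_m.+1) (x : T) l j : insert_at k x l (lift k j) = l j.
Proof. by rewrite /insert_at liftK. Qed.

Lemma sum_ffun_insert (V : nmodType) (T : finType) m (k : 'I_m.+1) (G : {ffun 'I_m.+1 -> T} -> V) :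
  \sum_l G l = \sum_x \sum_(l : {ffun 'I_m -> T}) G [ffun i => insert_at k x l i].
Proof.
rewrite pair_big /= (reindex (fun p : T * {ffun 'I_m -> T} => [ffun i => insert_at k p.1 p.2 i])) //=.
exists (fun l : {ffun 'I_m.+1 -> T} => (l k, [ffun j => l (lift k j)])) => [[x l] _|l _] /=.
  rewrite ffunE insert_at_eq; congr pair; apply/ffunP => j.
  by rewrite !ffunE insert_at_lift.
apply/ffunP => i; rewrite ffunE.
by case: (unliftP k i) => [j ->|->]; rewrite ?insert_at_eq // insert_at_lift ffunE.
Qed.

Section Permanents.
Variables (B : nzRingType) (hf : B) (n : nat) (M : 'I_n -> 'I_n -> B).
Hypothesis (hfE : hf + hf = 1) (mM : manin M).

Definition perm_minor m (r c : 'I_m -> 'I_n) := perm_row (\matrix_(a, b) M (r a) (c b)).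

Lemma eq_perm_minor m (r r' c c' : 'I_m -> 'I_n) : r =1 r' -> c =1 c' -> perm_minor r c = perm_minor r' c'.
Proof.
by move=> Er Ec; congr perm_row; apply/matrixP => a b; rewrite !mxE Er Ec.
Qed.

Lemma perm_minor_row m (r c : 'I_m.+1 -> 'I_n) : perm_minor r c =
  \sum_k M (r ord0) (c k) * perm_minor (fun a => r (lift ord0 a)) (fun b => c (lift k b)).
Proof.
rewrite /perm_minor /perm_row sum_lift_perm; apply: eq_bigr => k _.
rewrite mulr_sumr; apply: eq_bigr => s _; rewrite big_ord_recl mxE lift_perm_id.
by congr (_ * _); apply: eq_bigr => a _; rewrite !mxE lift_perm_lift.
Qed.

(** Twice the difference is a sum over permutations of the Manin relation for the
    first two factors, multiplied by the remaining ones. *)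
Lemma perm_minor_swap m (r c : 'I_m.+2 -> 'I_n) :
  perm_minor (fun a => r (tperm ord0 (lift ord0 ord0) a)) c = perm_minor r c.
Proof.
pose t : 'S_m.+2 := tperm ord0 (lift ord0 ord0).
have t0 : t ord0 = lift ord0 ord0 by rewrite tpermL.
have t1 : t (lift ord0 ord0) = ord0 by rewrite tpermR.
have t2 a : t (lift ord0 (lift ord0 a)) = lift ord0 (lift ord0 a).
  by rewrite tpermD // -?(inj_eq val_inj) //= /bump /= .
have halve (x y : B) : x + x = y + y -> x = y.
  move=> E; rewrite -[x]mul1r -[y]mul1r -hfE !mulrDl -!mulrDr.
  by rewrite E.
apply: halve; rewrite /perm_minor /perm_row.
have dbl (G : 'S_m.+2 -> B) : \sum_s G s + \sum_s G s = \sum_s (G s + G (t * s)%g).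
  rewrite big_split /=; congr (_ + _); rewrite (reindex_inj (mulgI t)); exact: eq_bigr.
rewrite !dbl; apply: eq_bigr => s _; rewrite !big_ord_recl !mxE !permM.
rewrite -/t t0 t1.
set Q := \prod_(i < m) _; set Q1 := \prod_(i < m) _; set Q2 := \prod_(i < m) _.
set Q3 := \prod_(i < m) _.
have E1 : Q1 = Q by apply: eq_bigr => a _; rewrite !mxE permM t2.
have E2 : Q2 = Q by apply: eq_bigr => a _; rewrite !mxE -/t t2.
have E3 : Q3 = Q by apply: eq_bigr => a _; rewrite !mxE permM -/t !t2.
rewrite E1 E2 E3; have E := mM (r ord0) (r (lift ord0 ord0)) (c (s ord0)) (c (s (lift ord0 ord0))).
move: (M _ _) (M _ _) (M _ _) (M _ _) E => x1 x2 x3 x4 E.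
have {}E : x4 * x3 = x3 * x4 + (x2 * x1 - x1 * x2) by rewrite -E addrC subrK.
nc (tt, E).
Qed.

Lemma perm_minor_row_move m (k : 'I_m.+1) x (l : 'I_m -> 'I_n) (c : 'I_m.+1 -> 'I_n) :
  perm_minor (insert_at k x l) c = perm_minor (insert_at ord0 x l) c.
Proof.
elim: m k l c => [|m IH] k l c; first by rewrite (ord1 k).
case: (unliftP ord0 k) => [k' ->|-> //].
pose tl j := l (lift ord0 j).
have hd : insert_at (lift ord0 k') x l ord0 = l ord0.
  rewrite -[ord0 in LHS](_ : lift (lift ord0 k') ord0 = ord0) ?insert_at_lift //; exact: val_inj.
have tlE : (fun a => insert_at (lift ord0 k') x l (lift ord0 a)) =1 insert_at k' x tl.
  move=> a; case: (unliftP k' a) => [b ->|->]; rewrite ?insert_at_eq // insert_at_lift.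
  rewrite -[X in insert_at _ _ _ X](_ : lift (lift ord0 k') (lift ord0 b) = lift ord0 (lift k' b)) ?insert_at_lift //.
  by apply: val_inj; rewrite /= /bump /= !add1n ltnS addnS.
rewrite perm_minor_row hd; under eq_bigr do rewrite (eq_perm_minor tlE (fun=> erefl)) IH.
rewrite -[RHS]perm_minor_swap [RHS]perm_minor_row.
have hd2 : insert_at ord0 x l (tperm ord0 (lift ord0 ord0) ord0) = l ord0.
  by rewrite tpermL insert_at_lift.
have tl2 : (fun a => insert_at ord0 x l (tperm ord0 (lift ord0 ord0) (lift ord0 a))) =1 insert_at ord0 x tl.
  move=> a; case: (unliftP ord0 a) => [b ->|->].
    by rewrite tpermD ?insert_at_lift //.
  by rewrite tpermR !insert_at_eq.
by rewrite hd2; apply: eq_bigr => a _; rewrite (eq_perm_minor tl2 (fun=> erefl)).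
Qed.

(** [m`!] times the [m]-th symmetric trace; in [perm_open] one more row [i] and
    one more column [j] are left open. *)
Definition perm_trace m := \sum_(l : {ffun 'I_m -> 'I_n}) perm_minor l l.
Definition perm_open m i j := \sum_(l : {ffun 'I_m -> 'I_n}) perm_minor (insert_at ord0 i l) (insert_at ord0 j l).

Lemma perm_trace_open m : perm_trace m.+1 = \sum_i perm_open m i i.
Proof.
rewrite /perm_trace (sum_ffun_insert ord0); apply: eq_bigr => i _; apply: eq_bigr => l _.
by apply: eq_perm_minor => a; rewrite ffunE.
Qed.

Lemma perm_open0 i j : perm_open 0 i j = M i j * perm_trace 0.
Proof.
rewrite /perm_open /perm_trace mulr_sumr; apply: eq_bigr => l _.
rewrite perm_minor_row big_ord_recl big_ord0 addr0 !insert_at_eq; congr (_ * _).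
by apply: eq_perm_minor => -[].
Qed.

(** Expansion along the open row: its entry lies either in the open column or in
    a column [l k].  In the latter case row [l k] is moved to the front, which
    is allowed for a Manin matrix, and becomes the open row. *)
Lemma perm_open_rec m i j :
  perm_open m.+1 i j = M i j * perm_trace m.+1 + (\sum_x M i x * perm_open m x j) *+ m.+1.
Proof.
rewrite /perm_open; under eq_bigr do rewrite perm_minor_row big_ord_recl !insert_at_eq.
rewrite big_split /=; congr (_ + _).
  rewrite mulr_sumr; apply: eq_bigr => l _; congr (_ * _).
  by apply: eq_perm_minor => a; rewrite insert_at_lift.
rewrite exchange_big /=; set Y := (X in _ = X *+ _).
have -> : Y *+ m.+1 = \sum_(k < m.+1) Y by rewrite sumr_const card_ord.
apply: eq_bigr => k _; rewrite {}/Y.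
rewrite (sum_ffun_insert k); apply: eq_bigr => x _; rewrite mulr_sumr; apply: eq_bigr => l _.
rewrite insert_at_lift ffunE insert_at_eq; congr (_ * _); rewrite -(perm_minor_row_move k); apply: eq_perm_minor => a.
  by rewrite insert_at_lift ffunE.
case: (unliftP ord0 a) => [b ->|->].
  rewrite insert_at_lift (_ : lift (lift ord0 k) (lift ord0 b) = lift ord0 (lift k b)); last first.
    by apply: val_inj; rewrite /= /bump /= !add1n ltnS addnS.
  by rewrite insert_at_lift ffunE insert_at_lift.
rewrite insert_at_eq (_ : lift (lift ord0 k) ord0 = ord0) ?insert_at_eq //; exact: val_inj.
Qed.

End Permanents.

Section PermanentClosure.
Variables (F : fieldType) (B : algType F) (Z : B -> Prop) (sZ : subalg Z) (hf : B).
Hypothesis hfE : hf + hf = 1.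
Variables (n : nat) (M : 'I_n -> 'I_n -> B).
Hypothesis mM : manin M.
Let MM : 'M[B]_n := \matrix_(i, j) M i j.
Hypothesis Zt : forall k, Z (ptr MM k).

(** By [perm_open_rec] the matrix [perm_open m] is a combination of powers of [M]
    with smaller symmetric traces as right coefficients, and its trace is the
    next symmetric trace. *)
Lemma Z_perm_trace m : Z (perm_trace M m).
Proof.
suff H : Z (perm_trace M m) /\ exists2 z : nat -> B, (forall k, Z (z k)) &
    \matrix_(i, j) perm_open M m i j = \sum_(k < m.+1) mpow MM k.+1 *m (z k)%:M by case: H.
have trP (X : 'M[B]_n) z : \tr (X *m z%:M) = \tr X * z.
  rewrite /mxtrace mulr_suml; apply: eq_bigr => i _.
  rewrite mxE (bigD1 i) //= !mxE eqxx mulr1n big1 ?addr0 // => k /negbTE ki.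
  by rewrite mxE ki mulr0n mulr0.
elim: m => [|m [ZP [z Zz RE]]].
  have ZP0 : Z (perm_trace M 0).
    apply: (sub_sum sZ) => l _; apply: (sub_sum sZ) => s _; rewrite big_ord0; exact: (sub1 sZ).
  split=> //; exists (fun=> perm_trace M 0) => //.
  rewrite big_ord_recl big_ord0 addr0 mpowS mul1mx; apply/matrixP => i j.
  rewrite !mxE perm_open0 (bigD1 j) //= !mxE eqxx mulr1n big1 ?addr0 // => k /negbTE ki.
  by rewrite !mxE ki mulr0n mulr0.
have ZP1 : Z (perm_trace M m.+1).
  have -> : perm_trace M m.+1 = \tr (\matrix_(i, j) perm_open M m i j).
    by rewrite perm_trace_open; apply: eq_bigr => i _; rewrite mxE.
  rewrite RE linear_sum; apply: (sub_sum sZ) => k _ /=; rewrite trP.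
  by apply: (subM sZ) => //; exact: (Zt k.+1).
split=> //; exists (fun k => if k is k'.+1 then z k' *+ m.+1 else perm_trace M m.+1).
  by move=> [|k] //; exact: (sub_muln sZ).
have -> : \matrix_(i, j) perm_open M m.+1 i j = MM *m (perm_trace M m.+1)%:M +
    (MM *m \matrix_(i, j) perm_open M m i j) *+ m.+1.
  apply/matrixP => i j; rewrite !mxE mulmxnE !mxE (perm_open_rec hfE mM); congr (_ + _ *+ _).
    rewrite (bigD1 j) //= !mxE eqxx mulr1n big1 ?addr0 // => k /negbTE ki.
    by rewrite !mxE ki mulr0n mulr0.
  by apply: eq_bigr => x _; rewrite !mxE.
rewrite RE [RHS]big_ord_recl mpowS mul1mx; congr (_ + _).
rewrite mulmx_sumr -sumrMnl; apply: eq_bigr => k _.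
rewrite mulmxA -mpowSl; apply/matrixP => i j; rewrite mulmxnE !mxE -sumrMnl.
by apply: eq_bigr => a _; rewrite !mxE -mulrnAr mulrnAC.
Qed.

End PermanentClosure.

(** * Symmetric traces and determinant coefficients *)

Section DiffopDegree.
Variables (F : fieldType) (A : algType F) (d : derivation A).
Implicit Types (p q : diffop d).

Definition ddelta (p : diffop d) : diffop d := deriv (p : {poly A}).
Fact ddelta_additive : zmod_morphism ddelta.
Proof. exact: derivB. Qed.
HB.instance Definition _ :=
  GRing.isZmodMorphism.Build (diffop d) (diffop d) ddelta ddelta_additive.

Lemma deriv_lmulD (q : {poly A}) : deriv (lmulD d q) = lmulD d (deriv q) + q.
Proof.
rewrite /lmulD derivD derivM derivX mulr1 addrAC; congr (_ + _ + _).
by apply/polyP => i; rewrite coef_deriv !coef_map /= coef_deriv raddfMn.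
Qed.

Lemma deriv_iter_lmulD i (q : {poly A}) :
  deriv (iter i (lmulD d) q) = iter i (lmulD d) (deriv q) + iter i.-1 (lmulD d) q *+ i.
Proof.
elim: i => [|i IH]; first by rewrite mulr0n addr0.
rewrite iterS deriv_lmulD IH raddfD /= -addrA; congr (_ + _).
by case: i {IH} => [|i]; rewrite ?mulr0n ?raddf0 ?add0r //= raddfMn -mulrSr.
Qed.

Lemma dop_monomM a i q : dop_const d a * dop_D d ^+ i * q = a *: iter i (lmulD d) (q : {poly A}).
Proof.
have E : dop_D d ^+ i * q = iter i (lmulD d) (q : {poly A}).
  by rewrite {1}/GRing.mul /= dop_DXn diffop_mulXn.
by rewrite -mulrA E dop_constM.
Qed.

Lemma ddeltaM p q : ddelta (p * q) = ddelta p * q + p * ddelta q.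
Proof.
move: p; apply: diffop_ind => [a i|p p' E E']; last by rewrite !(mulrDl, raddfD) /= E E' addrACA.
have -> : ddelta (dop_const d a * dop_D d ^+ i) = (dop_const d a * dop_D d ^+ i.-1) *+ i.
  rewrite /ddelta !dop_constM !dop_DXn derivZ derivXn.
  by apply/polyP => k; rewrite coefZ coefMn; have := coefMn (a *: 'X^(i.-1) : {poly A}) i k => ->; rewrite coefZ mulrnAr.
rewrite mulrnAl !dop_monomM /ddelta derivZ deriv_iter_lmulD scalerDr addrC.
by congr (_ + _); apply/polyP => k; rewrite coefZ coefMn mulrnAr -coefZ -coefMn.
Qed.

Lemma size_iter_lmulD b i (q : {poly A}) : (size q <= b.+1)%N ->
  (size (iter i (lmulD d) q) <= (i + b).+1)%N /\ (iter i (lmulD d) q)`_(i + b) = q`_b.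
Proof.
move=> sq; elim: i => [//|i [IH1 IH2]] /=; split.
  rewrite /lmulD (leq_trans (size_polyD _ _)) // geq_max; apply/andP; split.
    by rewrite (leq_trans (size_polyMleq _ _)) // size_polyX addn2 ltnS.
  by rewrite (leq_trans (size_poly _ _)) // (leq_trans IH1).
rewrite /lmulD coefD coefMX /= IH2 coef_map /= [_`_(i.+1 + b)]nth_default ?raddf0 ?addr0 //.
Qed.

Lemma dop_mul_top a b p q : (size (p : {poly A}) <= a.+1)%N -> (size (q : {poly A}) <= b.+1)%N ->
  (size (((p * q)%R : diffop d) : {poly A}) <= (a + b).+1)%N /\
  dop_coef (a + b) (p * q) = dop_coef a p * dop_coef b q.
Proof.
move=> sp sq; have E := @diffop_mul_wide _ _ d a.+1 p q sp.
rewrite /dop_coef -[p * q]/(diffop_mul d p q) E; split.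
  apply: (leq_trans (size_sum _ _ _)); apply/bigmax_leqP => i _.
  apply: (leq_trans (size_scale_leq _ _)); have [s _] := size_iter_lmulD i sq.
  by rewrite (leq_trans s) // ltnS leq_add2r -ltnS.
rewrite coef_sum big_ord_recr /= coefZ (size_iter_lmulD a sq).2 big1 ?add0r // => i _.
have [s _] := size_iter_lmulD i sq.
rewrite coefZ [X in _ * X]nth_default ?mulr0 //.
by rewrite (leq_trans s) // ltn_add2r.
Qed.

(** The leading term of [D * a] is [a * D]. *)
Lemma dop_prod_top m (w : 'I_m -> nat) (f : 'I_m -> diffop d) :
  (forall i, (size (f i : {poly A}) <= (w i).+1)%N) ->
  (size (((\prod_i f i)%R : diffop d) : {poly A}) <= (\sum_i w i).+1)%N /\
  dop_coef (\sum_i w i) (\prod_i f i) = \prod_i dop_coef (w i) (f i).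
Proof.
elim: m w f => [|m IH] w f sf.
  by rewrite !big_ord0 /dop_coef; split; [rewrite size_poly1|rewrite coefC].
rewrite !big_ord_recl; have [s c] := IH (fun i => w (lift ord0 i)) (fun i => f (lift ord0 i)) (fun i => sf _).
have [s' c'] := dop_mul_top (sf ord0) s.
by rewrite c' c.
Qed.

End DiffopDegree.

Section GaudinClosure.
Variables (F : fieldType) (A : algType F) (d : derivation A).
Hypothesis char0 : forall m : nat, m.+1%:R != 0 :> F.
Variables (Z0 : A -> Prop) (sZ0 : subalg Z0).
Hypothesis Zd : forall x, Z0 x -> Z0 (d x).

Definition coef_in (p : diffop d) := forall k, Z0 (dop_coef k p).

Lemma coef_in_iter i (q : {poly A}) : (forall k, Z0 q`_k) -> forall k, Z0 (iter i (lmulD d) q)`_k.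
Proof.
move=> Zq; elim: i => [//|i IH] k; rewrite iterS /lmulD coefD coefMX coef_map.
apply: (subD sZ0); last exact: Zd.
by case: k => [|k] //=; exact: (sub0 sZ0).
Qed.

Lemma coef_in_subalg : subalg coef_in.
Proof.
split.
- move=> k; rewrite /dop_coef coefC; case: eqP => _; [exact: (sub1 sZ0)|exact: (sub0 sZ0)].
- by move=> p q Zp Zq k; rewrite /dop_coef coefD; apply: (subD sZ0); [exact: Zp|exact: Zq].
- move=> p q Zp Zq k; rewrite /dop_coef -[p * q]/(diffop_mul d p q) /diffop_mul coef_sum.
  apply: (sub_sum sZ0) => i _; rewrite coefZ; apply: (subM sZ0); first exact: Zp.
  exact: coef_in_iter.
- move=> c p Zp k; rewrite /dop_coef -[c *: p]/((c%:A : A) *: (p : {poly A})) coefZ -scalerAl mul1r.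
  by apply: (subZ sZ0); exact: Zp.
Qed.

Lemma coef_in_delta p : coef_in p -> coef_in (ddelta p).
Proof. by move=> Zp k; rewrite /dop_coef coef_deriv; apply: (sub_muln sZ0); exact: Zp. Qed.

Section Rank.
Variables (n : nat) (L : 'M[A]_n.+1).
Let M i j := gaudin_op d L i j.

Lemma iter_ddelta r (p : diffop d) : iter r (@ddelta _ _ d) p = derivn r (p : {poly A}).
Proof. by []. Qed.

Lemma gaudin_coef i j k : dop_coef k (M i j) =
  if k == 0%N then - L i j else if k == 1%N then (i == j)%:R else 0.
Proof.
rewrite /M gaudin_opE /dop_coef.
have -> : ((i == j)%:R * dop_D d - dop_const d (L i j) : diffop d) =
    'X *+ (i == j) - (L i j)%:P :> {poly A} by rewrite mulr_natl.
rewrite coefB coefMn coefX coefC; case: k => [|[|k]] /=; last by rewrite subr0 mul0rn.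
  by rewrite mul0rn sub0r.
by rewrite subr0.
Qed.

Lemma gaudin_size i j : (size (M i j : {poly A}) <= 2)%N.
Proof.
by apply/leq_sizeP => k k2; rewrite -[_`_k]/(dop_coef k (M i j)) gaudin_coef; case: k k2 => [|[|k]].
Qed.

Lemma sum_one m : (\sum_(i < m) 1 = m)%N.
Proof. by rewrite sum1_card card_ord. Qed.

Lemma size_sign (b : bool) (p : diffop d) : size ((-1) ^+ b * p : {poly A}) = size (p : {poly A}).
Proof. by case: b; rewrite ?mul1r // expr1 mulN1r size_polyN. Qed.

Lemma cdet_coefs : (size (cdet M : {poly A}) <= n.+2)%N /\ dop_coef n.+1 (cdet M) = 1.
Proof.
have top (s : 'S_n.+1) := @dop_prod_top _ _ d n.+1 (fun=> 1%N) (fun i => M (s i) i) (fun i => gaudin_size _ _).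
have E (s : 'S_n.+1) : \prod_i (\matrix_(i, j) M i j) (s i) i = \prod_i M (s i) i :> diffop d.
  by apply: eq_bigr => i _; rewrite mxE.
have sgn (b : bool) (p : diffop d) k : dop_coef k ((-1) ^+ b * p) = (-1) ^+ b * dop_coef k p.
  by case: b; rewrite ?mul1r // expr1 !mulN1r /dop_coef coefN.
rewrite /cdet /det_column; split.
  apply: (leq_trans (size_sum _ _ _)); apply/bigmax_leqP => s _; rewrite E.
  have [] := top s; rewrite sum_one => s1 _.
  by rewrite size_sign.
rewrite /dop_coef coef_sum (bigD1 1%g) //= -/(dop_coef _ _) E sgn.
have [_] := top 1%g; rewrite sum_one => ->; rewrite odd_perm1 mul1r.
rewrite big1 => [|i _]; last by rewrite gaudin_coef /= perm1 eqxx.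
rewrite big1 ?addr0 // => s s1; rewrite -/(dop_coef _ _) E sgn.
have [_] := top s; rewrite sum_one => ->.
have [i si] : exists i, s i != i.
  apply/existsP; apply: contraR s1; rewrite negb_exists => /forallP H.
  by apply/eqP/permP => i; rewrite perm1; apply/eqP; rewrite -[_ == _]negbK.
suff -> : \prod_i dop_coef 1 (M (s i) i) = 0 by rewrite mulr0.
have : i \in index_enum 'I_n.+1 by rewrite mem_index_enum.
elim: (index_enum _) => [//|j r IH]; rewrite inE big_cons.
case/orP => [/eqP <-|/IH ->]; last by rewrite mulr0.
by rewrite gaudin_coef /= (negbTE si) mul0r.
Qed.

Lemma cadj_size j k : (size (cadj M j k : {poly A}) <= n.+1)%N.
Proof.
rewrite /cadj /cdet /det_column.
apply: (leq_trans (size_sum _ _ _)); apply/bigmax_leqP => s _.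
have sf i : (size (replace_col M j (fun i => (i == k)%:R) (s i) i : {poly A}) <= (i != j : nat).+1)%N.
  rewrite /replace_col; case: eqP => _ /=; last exact: gaudin_size.
  by rewrite (_ : (s i == k)%:R = ((s i == k)%:R)%:P :> {poly A}) ?size_polyC ?leq_b1 // polyCMn.
have [+ _] := dop_prod_top sf.
have -> : (\sum_(i < n.+1) (i != j) = n)%N.
  rewrite (bigD1 j) //= eqxx add0n (eq_bigr (fun=> 1%N)); last by move=> i ->.
  by rewrite sum1_card cardC1 card_ord.
have -> : \prod_i (\matrix_(i, j0) replace_col M j (fun i => (i == k)%:R) i j0) (s i) i =
   \prod_i replace_col M j (fun i => (i == k)%:R) (s i) i :> diffop d.
  by apply: eq_bigr => i _; rewrite mxE.
by rewrite size_sign.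
Qed.

End Rank.

(** The operators with coefficients in [Z0] form an algebra stable under the
    derivative with respect to the symbol, and contain the determinant. *)
Theorem S_in_closure n (L : 'M[A]_n) :
  (forall i j k l, L i j * L k l - L k l * L i j =
     d (L k j) *+ (l == i) - d (L i l) *+ (j == k)) ->
  (forall i, Z0 (QH d L i)) -> forall m, Z0 (S_ d L m).
Proof.
move=> lax ZQ m; rewrite /S_.
have Zsign k x : Z0 x -> Z0 ((-1) ^+ k * x).
  by move=> Zx; rewrite -signr_odd; case: odd; rewrite ?mul1r // expr1 mulN1r; exact: (subN sZ0).
apply: Zsign; pose M i j := gaudin_op d L i j.
have mM : manin M := gaudin_manin lax.
have [hf hfE] := half_alg (diffop d) char0.
have sZ := coef_in_subalg.
suff H : coef_in (perm_trace M m) by apply: (subZ sZ); exact: H.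
apply: (Z_perm_trace sZ hfE mM) => k; case: n L lax ZQ @M mM => [|n] L lax ZQ M mM.
  by rewrite /ptr /mxtrace big_ord0; exact: (sub0 sZ).
have dM i j : ddelta (M i j) = (i == j)%:R.
  apply/polyP => a; rewrite coef_deriv -[_`_a.+1]/(dop_coef a.+1 (M i j)) gaudin_coef /=.
  have -> : ((i == j)%:R : diffop d) = ((i == j)%:R : A)%:P :> {poly A} by rewrite polyCMn.
  by rewrite coefC; case: a => [|a] /=; rewrite ?mulr1n ?mul0rn.
apply: (Z_ptr sZ char0 (delta := @ddelta _ _ d) (@ddeltaM _ _ d) coef_in_delta mM dM).
- move=> i; rewrite /cdet (_ : \matrix_(i, j) M i j = gaudin_op d L); first exact: ZQ.
  by apply/matrixP => a b; rewrite mxE.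
- have [s c] := cdet_coefs L; rewrite iter_ddelta.
  have -> : (n.+1`!%:R : diffop d) = (n.+1`!%:R : A)%:P :> {poly A} by rewrite polyCMn.
  apply/polyP => a; rewrite coef_derivn coefC; case: a => [|a] /=.
    by rewrite addn0 ffactnn -[X in X *+ _]/(dop_coef n.+1 (cdet M)) c.
  by rewrite nth_default ?mul0rn // (leq_trans s) // addnS ltnS leq_addr.
- by move=> j k'; rewrite iter_ddelta; exact: (derivn_poly0 (cadj_size L j k')).
Qed.

End GaudinClosure.

(** * Series Lax matrices *)

Section Centralizer.
Variables (F : fieldType) (R : algType F) (E : R -> Prop).

Definition commutes_with (f : laurent R) := forall m e, E e -> f m * e = e * f m.

Lemma commutes_with_subalg : subalg commutes_with.
Proof.
split.
- by move=> m e _; rewrite /= commr_nat.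
- by move=> f g Cf Cg m e Ee; rewrite [(f + g) m]/(f m + g m) mulrDl mulrDr Cf ?Cg.
- move=> f g Cf Cg m e Ee; have [N [K H]] := laurent_window f g m.
  rewrite (lmulE (iota_shift_uniq N K)); last by move=> i /H[] ->; rewrite ?mul0r ?mulr0.
  rewrite mulr_suml mulr_sumr; apply: eq_bigr => i _.
  by rewrite -mulrA Cg // mulrA Cf // mulrA.
- by move=> c f Cf m e Ee; rewrite [(c *: f) m]/(c *: f m) -scalerAl -scalerAr Cf.
Qed.

Lemma commutes_with_der inv f : commutes_with f -> commutes_with (laurent_dz R inv f).
Proof.
by move=> Cf m e Ee; rewrite /= /lderiv_fun mulrzAl mulrzAr Cf.
Qed.

End Centralizer.

Section SeriesCase.
Variables (F : fieldType) (R : algType F) (inv : bool) (n : nat) (L : 'M[laurent R]_n).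
Hypothesis char0 : forall m : nat, m.+1%:R != 0 :> F.
Hypothesis lax : series_gaudin_lax inv L.
Let d := laurent_dz R inv.

Lemma series_commuteP (f g : laurent R) : series_commute inv f g <-> forall a b : int, (f a : R) * g b = g b * f a.
Proof.
split=> [H a b|H a b]; last by rewrite /ser_bracket /bracket /zcoef H subrr.
have := H (if inv then - a else a) (if inv then - b else b).
rewrite /ser_bracket /bracket /zcoef => /eqP; rewrite subr_eq0 => /eqP.
by case: inv; rewrite ?opprK.
Qed.

Theorem series_QH_QH k l : series_commute inv (QH d L k) (QH d L l).
Proof.
have hf0 : ((2%:R : F)^-1) + 2%:R^-1 = 1 by rewrite -mulr2n -[_ *+ 2]mulr_natr mulVf.
exact: (QH_commute hf0 lax).
Qed.

(** [S_in_closure] for the centralizer of the coefficients of all [QH]. *)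
Theorem series_S_QH k l : series_commute inv (S_ d L k) (QH d L l).
Proof.
pose E (e : R) := exists j (b : int), e = QH d L j b.
suff H : commutes_with E (S_ d L k) by apply/series_commuteP => a b; apply: H; exists l, b.
apply: (S_in_closure char0 (commutes_with_subalg E)) => [f|i j a b|i].
- exact: commutes_with_der.
- exact: (lax_same_point lax).
by move=> a e [j [b ->]]; have /series_commuteP := series_QH_QH i j.
Qed.

(** [S_in_closure] for the centralizer of the coefficients of all [S_], which
    contains the [QH] by [series_S_QH]. *)
Theorem series_S_S k l : series_commute inv (S_ d L k) (S_ d L l).
Proof.
pose E (e : R) := exists j (b : int), e = S_ d L j b.
suff H : commutes_with E (S_ d L k) by apply/series_commuteP => a b; apply: H; exists l, b.
apply: (S_in_closure char0 (commutes_with_subalg E)) => [f|i j a b|i].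
- exact: commutes_with_der.
- exact: (lax_same_point lax).
by move=> a e [j [b ->]]; have /series_commuteP -> := series_S_QH j i.
Qed.

End SeriesCase.

(** * Expansion of rational functions at zero *)

Section PolynomialSeries.
Variables (F : fieldType) (R : algType F).
Local Notation inv := false.

Fact poly_ser_subproof (P : {poly R}) : exists N, lbounded (fun m : int => if m is Posz k then P`_k else 0) N.
Proof. by exists 0 => -[]. Qed.
Definition poly_ser (P : {poly R}) : laurent R := Laurent (poly_ser_subproof P).

Fact poly_ser_additive : zmod_morphism poly_ser.
Proof. by move=> P Q; apply: laurentP => -[m|m] /=; rewrite ?coefB ?subrr. Qed.
HB.instance Definition _ :=
  GRing.isZmodMorphism.Build {poly R} (laurent R) poly_ser poly_ser_additive.

Lemma poly_ser_bounded P : lbounded (poly_ser P) 0. Proof. by case. Qed.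

Fact poly_ser_multiplicative : monoid_morphism poly_ser.
Proof.
split=> [|P Q]; apply: laurentP => m.
  by case: m => [m|m] //=; rewrite coefC; case: m.
case: m => [m|m].
  have ltm : m%:Z < 0 + 0 + m.+1%:Z by lia.
  have E : (poly_ser P * poly_ser Q) m%:Z = _ := lmul_funE (@poly_ser_bounded P) (@poly_ser_bounded Q) ltm.
  rewrite E /= coefM; apply: eq_bigr => i _; rewrite add0r; congr (_ * _).
  by rewrite subzn // -ltnS.
have E : (poly_ser P * poly_ser Q) (Negz m) = 0 by apply: (lmul_bounded (@poly_ser_bounded P) (@poly_ser_bounded Q)); lia.
by rewrite E.
Qed.
HB.instance Definition _ :=
  GRing.isMonoidMorphism.Build {poly R} (laurent R) poly_ser poly_ser_multiplicative.

Lemma poly_ser_deriv P : poly_ser P^`() = laurent_dz R inv (poly_ser P).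
Proof.
apply: laurentP => -[m|m]; rewrite /= /lderiv_fun /= expr0 mul1r.
  have -> : m%:Z + 1 = m.+1 by lia.
  by rewrite coef_deriv addn1.
case: m => [|m].
  by have -> : Negz 0 + 1 = 0 :> int by []; rewrite mulr0z.
have E : Negz m.+1 + 1 = Negz m by lia.
by rewrite E mul0rz.
Qed.

Lemma poly_ser_central (q : {poly F}) f : poly_ser (polyA R q) * f = f * poly_ser (polyA R q).
Proof.
have -> : polyA R q = \sum_(k < size q) (q`_k)%:A *: 'X^k.
  by rewrite -[q in LHS]coefK poly_def /polyA rmorph_sum; apply: eq_bigr => k _; rewrite /= map_polyZ map_polyXn.
rewrite rmorph_sum mulr_suml mulr_sumr; apply: eq_bigr => k _ /=.
have -> : poly_ser ((q`_k)%:A *: 'X^k) = q`_k *: lmon k%:Z 1.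
  apply: laurentP => -[m|m] /=; last by rewrite scaler0.
  by rewrite coefZ coefXn eqz_nat; case: eqP; rewrite ?mulr1 ?mulr0 ?scaler0.
by rewrite -scalerAl -scalerAr lmon1C.
Qed.

(** After division by a power of [z] and a scalar, the geometric series. *)
Lemma poly_ser_inv (q : {poly F}) : q != 0 -> exists g, poly_ser (polyA R q) * g = 1.
Proof.
move=> q0.
have unit_inv (r : {poly F}) : r`_0 = 0 -> exists g, poly_ser (polyA R (1 - r)) * g = 1.
  move=> r0; pose G m := \sum_(j < m.+1) (polyA R r) ^+ j.
  have r0' : (polyA R r)`_0 = 0 by rewrite coef_map r0 /= scale0r.
  have low (j i : nat) (Q : {poly R}) : (i < j)%N -> (polyA R r ^+ j * Q)`_i = 0.
    elim: j i => // j IH i ij; rewrite exprS -mulrA coefM big1 // => k _.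
    case: (nat_of_ord k) (ltn_ord k) => [|k'] lk; first by rewrite r0' mul0r.
    by rewrite IH ?mulr0 //; lia.
  have stable m m' i : (i <= m)%N -> (m <= m')%N -> (G m')`_i = (G m)`_i.
    move=> im mm'; rewrite /G -(subnKC mm') -addSn big_split_ord /= coefD [X in _ + X](_ : _ = 0) ?addr0 //.
    rewrite coef_sum big1 // => j _; rewrite -[_ ^+ _]mulr1 low //; lia.
  have gP : exists N, lbounded (fun m : int => if m is Posz k then (G k)`_k else 0) N by exists 0; case.
  exists (Laurent gP); have bg : lbounded (Laurent gP) 0 by case.
  apply: laurentP => -[m|m]; last first.
    have E : (poly_ser (polyA R (1 - r)) * Laurent gP) (Negz m) = 0.
      by apply: (lmul_bounded (@poly_ser_bounded _) bg); lia.
    by rewrite E.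
  have ltm : m%:Z < 0 + 0 + m.+1%:Z by lia.
  have E : (poly_ser (polyA R (1 - r)) * Laurent gP) m%:Z = _ := lmul_funE (@poly_ser_bounded _) bg ltm.
  rewrite E /=; transitivity ((polyA R (1 - r) * G m)`_m).
    rewrite coefM; apply: eq_bigr => i _; rewrite add0r; congr (_ * _).
    have -> : m%:Z - (i : nat)%:Z = (m - i)%N by have := ltn_ord i; lia.
    by rewrite (stable (m - i)%N m) //; lia.
  have -> : polyA R (1 - r) * G m = 1 - polyA R r ^+ m.+1.
    rewrite /polyA rmorphB rmorph1 /= -/(polyA R r) /G.
    by rewrite -[RHS]opprB subrX1 -mulNr opprB.
  rewrite coefB -[_ ^+ _]mulr1 low // subr0 coefC; by case: m {ltm E}.
have [k [q1 [q1_0 Eq]]] : exists k (q1 : {poly F}), q1`_0 != 0 /\ q = q1 * 'X^k.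
  have [k [q1 /implyP/(_ q0) q1_0 Eq]] := multiplicity_XsubC q 0.
  exists k, q1; split; last by rewrite polyC0 subr0 in Eq.
  by rewrite -horner_coef0.
pose c := q1`_0; have [g gE] : exists g, poly_ser (polyA R (1 - (1 - c^-1 *: q1))) * g = 1.
  by apply: unit_inv; rewrite coefB coefZ mulVf // coefC subrr.
rewrite subKr in gE; exists (lmon (- k%:Z) 1 * (c^-1 *: g)).
have -> : polyA R q = polyA R q1 * 'X^k by rewrite Eq /polyA rmorphM /= map_polyXn.
have Xk : poly_ser 'X^k = lmon k%:Z 1.
  by apply: laurentP => -[m|m] /=; rewrite // coefXn eqz_nat; case: eqP.
have pM P Q : poly_ser (P * Q) = poly_ser P * poly_ser Q by exact: rmorphM.
rewrite pM Xk -!mulrA (mulrA (lmon k%:Z 1)) lmonM subrr mulr1 lmon_one mul1r.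
rewrite -scalerAr -[RHS]gE /polyA map_polyZ /=.
have -> : poly_ser (c^-1%:A *: map_poly (in_alg R) q1) = c^-1 *: poly_ser (map_poly (in_alg R) q1).
  apply: laurentP => -[m|m] /=; last by rewrite scaler0.
  by rewrite coefZ -scalerAl mul1r.
by rewrite -scalerAl.
Qed.

End PolynomialSeries.

Section RationalSeries.
Variables (F : fieldType) (R : algType F).
Local Notation dl := (laurent_dz R false).
Local Notation E := (@poly_ser F R).
Local Notation Eq q := (poly_ser (polyA R q)).
Implicit Types (f g : ratfun R).

Definition qinv (q : {poly F}) (q0 : q != 0) : laurent R := sval (cid (poly_ser_inv R q0)).
Lemma qinvP q (q0 : q != 0) : Eq q * qinv q0 = 1.
Proof. by rewrite /qinv; case: cid. Qed.

(** The expansion at zero; [rat_serE] characterizes it, whatever fraction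
    represents the function. *)
Definition rat_ser f : laurent R := poly_ser (rnum f) * qinv (rden_neq0 f).

Lemma Eq_reg (q : {poly F}) (X Y : laurent R) : q != 0 -> X * Eq q = Y * Eq q -> X = Y.
Proof.
move=> q0 XY; rewrite -[X]mulr1 -[Y]mulr1 -(qinvP q0) !mulrA.
by rewrite XY.
Qed.

Lemma poly_serM (P Q : {poly R}) : poly_ser (P * Q) = poly_ser P * poly_ser Q.
Proof. exact: rmorphM. Qed.

Lemma rat_serE P q : q != 0 -> rat_ser (rfrac P q) * Eq q = poly_ser P.
Proof.
move=> q0; set f := rfrac P q; apply: (Eq_reg (rden_neq0 f)).
have D : rat_ser f * Eq (rden f) = poly_ser (rnum f).
  by rewrite /rat_ser -mulrA -poly_ser_central qinvP mulr1.
by rewrite -mulrA poly_ser_central mulrA D -!poly_serM rfrac_num.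
Qed.

Fact rat_ser_additive : zmod_morphism rat_ser.
Proof.
move=> f g; have [P [S [q [q0 -> ->]]]] := rfracP2 f g; apply: (Eq_reg q0).
have -> : rfrac P q - rfrac S q = rfrac (P - S) q.
  by rewrite [- _]roppE // [_ + _]raddE.
by rewrite mulrBl !rat_serE // raddfB.
Qed.
HB.instance Definition _ :=
  GRing.isZmodMorphism.Build (ratfun R) (laurent R) rat_ser rat_ser_additive.

Fact rat_ser_multiplicative : monoid_morphism rat_ser.
Proof.
split=> [|f g].
  apply: (@Eq_reg 1) => //; first exact: oner_neq0.
  by rewrite [LHS]rat_serE ?oner_neq0 // mul1r polyA1.
have [P [S [q [q0 -> ->]]]] := rfracP2 f g.
apply: (@Eq_reg (q * q)); first by rewrite mulf_neq0.
have -> : rfrac P q * rfrac S q = rfrac (P * S) (q * q) by exact: rmulE.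
rewrite rat_serE ?mulf_neq0 // polyAM !poly_serM -(rat_serE P q0) -(rat_serE S q0).
have := poly_ser_central q (rat_ser (rfrac S q)).
move: (rat_ser _) (rat_ser _) (Eq q) => x y z zy; nc (tt, zy).
Qed.
HB.instance Definition _ :=
  GRing.isMonoidMorphism.Build (ratfun R) (laurent R) rat_ser rat_ser_multiplicative.

Lemma rat_ser_scale (c : F) f : rat_ser (c *: f) = c *: rat_ser f.
Proof.
have [P [q [q0 ->]]] := rfracP f; apply: (Eq_reg q0).
have -> : c *: rfrac P q = rfrac (polyA R c%:P * P) q by exact: rscaleE.
rewrite rat_serE // -scalerAl rat_serE // /polyA map_polyC /=.
apply: laurentP => -[m|m] /=; last by rewrite scaler0.
by rewrite coefCM -scalerAl mul1r.
Qed.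

Lemma rat_ser_deriv f : rat_ser (ratfun_dz R f) = dl (rat_ser f).
Proof.
have [P [q [q0 ->]]] := rfracP f.
apply: (@Eq_reg (q ^+ 2)); first by rewrite expf_neq0.
rewrite [ratfun_dz R _]rderivE // rat_serE ?expf_neq0 // raddfB /= !poly_serM.
have := congr1 dl (rat_serE P q0); rewrite derM -!poly_ser_deriv deriv_polyA => H.
rewrite expr2 polyAM poly_serM mulrA.
have -> : dl (rat_ser (rfrac P q)) * Eq q = poly_ser P^`() - rat_ser (rfrac P q) * Eq q^`().
  by rewrite -H addrK.
have ce := poly_ser_central q (poly_ser (polyA R q^`())).
rewrite mulrBl -(rat_serE P q0); move: ce.
move: (poly_ser _) (Eq q) (Eq q^`()) (rat_ser _) => x y z w ce; nc (tt, ce).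
Qed.

End RationalSeries.

(*@@perm_minor*)

Section Naturality.
Variables (F : fieldType) (A A' : algType F) (d : derivation A) (d' : derivation A').
Variables (f : {rmorphism A -> A'}) (fd : forall a, f (d a) = d' (f a)).
Hypothesis fZ : forall (c : F) a, f (c *: a) = c *: f a.
Variables (n : nat) (L : 'M[A]_n).

Lemma gaudin_op_map i j : dop_map fd (gaudin_op d L i j) = gaudin_op d' (map_mx f L) i j.
Proof.
rewrite !gaudin_opE mxE -(dop_map_const fd) -(dop_map_D fd).
by rewrite rmorphB rmorphM rmorph_nat.
Qed.

Lemma QH_map i : QH d' (map_mx f L) i = f (QH d L i).
Proof.
rewrite /QH -(dop_map_coef fd) det_column_map; congr (dop_coef _ (det_column _)).
by apply/matrixP => a b; rewrite [RHS]mxE; exact: (esym (gaudin_op_map a b)).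
Qed.

Lemma S_map p : S_ d' (map_mx f L) p = f (S_ d L p).
Proof.
rewrite /S_ rmorphM rmorph_sign; congr (_ * _).
have cZ (B : algType F) (e : derivation B) (c : F) (x : diffop e) k : dop_coef k (c *: x) = c *: dop_coef k x.
  by rewrite /dop_coef -[c *: x]/((c%:A : B) *: (x : {poly B})) coefZ -scalerAl mul1r.
rewrite /tr_sym !cZ fZ; congr (_ *: _); rewrite -(dop_map_coef fd) rmorph_sum; congr dop_coef.
apply: eq_bigr => l _; rewrite /perm_row rmorph_sum; apply: eq_bigr => s _.
rewrite rmorph_prod; apply: eq_bigr => i _; rewrite [LHS]mxE -gaudin_op_map.
by rewrite [in RHS]mxE.
Qed.

End Naturality.

Section ScalarRoots.
Variables (F : fieldType) (R : algType F).
Hypothesis char0 : forall m : nat, m.+1%:R != 0 :> F.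

Lemma poly_scalar_eq0 (P : {poly R}) (r : seq F) : uniq r -> (size P <= size r)%N ->
  {in r, forall a, P.[a%:A] = 0} -> P = 0.
Proof.
elim: r P => [|a r IH] P; first by rewrite leqn0 size_poly_eq0 => _ /eqP.
move=> /andP[ar ur] sP P0; have /factor_theorem[Q EQ] : root P a%:A by apply/rootP/P0/mem_head.
have central (c : F) (x : R) : x * c%:A = c%:A * x by rewrite -scalerAl -scalerAr mul1r mulr1.
rewrite EQ (IH Q) ?mul0r //.
  have [->|Q0] := eqVneq Q 0; first by rewrite size_poly0.
  by move: sP; rewrite EQ size_Mmonic ?monicXsubC // size_XsubC addn2 /= ltnS.
move=> b br; have := P0 b (mem_behead (s := a :: r) br).
rewrite EQ hornerM_comm; last by rewrite /comm_poly !hornerE central.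
rewrite !hornerE -scalerBl -scalerAr mulr1 => /eqP; rewrite scaler_eq0 subr_eq0.
case/orP => [/eqP Eb|/eqP //]; by rewrite -Eb br in ar.
Qed.

Lemma nat_inj : injective (fun k : nat => k%:R : F).
Proof.
move=> i j /eqP; wlog le_ij : i j / (i <= j)%N.
  by move=> H; case: (leqP i j) => [|/ltnW] /H // h; rewrite eq_sym => /h.
rewrite eq_sym -subr_eq0 -natrB //; case E: (j - i)%N => [|m]; last by rewrite (negbTE (char0 m)).
by move=> _; apply/eqP; rewrite eqn_leq le_ij -subn_eq0 E.
Qed.

(** Each scalar root splits off a central linear factor ([poly_scalar_eq0]), and
    there are infinitely many scalars outside the roots of [q]. *)
Lemma poly_scalar_generic_eq0 (P : {poly R}) (q : {poly F}) : q != 0 ->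
  (forall a, q.[a] != 0 -> P.[a%:A] = 0) -> P = 0.
Proof.
move=> q0 H; pose r := [seq k%:R : F | k <- iota 0 (size P + size q)].
have ur : uniq r by rewrite map_inj_uniq ?iota_uniq //; exact: nat_inj.
apply: (@poly_scalar_eq0 _ [seq a <- r | ~~ root q a]); first exact: filter_uniq.
  have := max_poly_roots q0 _ (filter_uniq (root q) ur).
  rewrite filter_all => /(_ isT) lt; rewrite size_filter.
  have E := count_predC (root q) r; rewrite size_map size_iota in E.
  rewrite size_filter in lt; rewrite -(leq_add2l (count (root q) r)).
  by rewrite [X in (_ <= X)%N]E addnC leq_add2l ltnW.
by move=> a; rewrite mem_filter => /andP[aq _]; exact: H.
Qed.

End ScalarRoots.

(** * From the rational to the series Lax relation *)

Section RationalLaxSeries.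
Variables (F : fieldType) (R : algType F).
Hypothesis char0 : forall m : nat, m.+1%:R != 0 :> F.
Variables (n : nat) (L : 'M[ratfun R]_n).
Hypothesis lax : rational_gaudin_lax L.

Lemma common_den : exists (q : {poly F}) (P : 'I_n -> 'I_n -> {poly R}),
  q != 0 /\ forall i j, L i j = rfrac (P i j) q.
Proof.
pose q := \prod_(x : 'I_n * 'I_n) rden (L x.1 x.2).
pose s i j := \prod_(x : 'I_n * 'I_n | x != (i, j)) rden (L x.1 x.2).
exists q, (fun i j => rnum (L i j) * polyA R (s i j)); split.
  by apply/prodf_neq0 => x _; exact: rden_neq0.
move=> i j; have -> : q = rden (L i j) * s i j by rewrite /q (bigD1 (i, j)).
rewrite -rfrac_ext ?rden_neq0 ?rfracK //.
by apply/prodf_neq0 => x _; exact: rden_neq0.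
Qed.

Variables (q : {poly F}) (P : 'I_n -> 'I_n -> {poly R}).
Hypothesis q0 : q != 0.
Hypothesis LE : forall i j, L i j = rfrac (P i j) q.
Local Notation ev Q a := (Q.[a%:A : R]).

(** The rational relation cleared of denominators. *)
Lemma lax_point i j k l u v : u != v -> q.[u] != 0 -> q.[v] != 0 ->
  (u - v) *: bracket (ev (P i j) u) (ev (P k l) v) =
  (q.[u] *: ev (P i l) v - q.[v] *: ev (P i l) u) *+ (j == k)
  - (q.[u] *: ev (P k j) v - q.[v] *: ev (P k j) u) *+ (l == i).
Proof.
move=> uv qu qv.
pose val a : 'M[R]_n := \matrix_(i, j) (q.[a]^-1 *: ev (P i j) a).
have valP a : q.[a] != 0 -> ratfun_mx_val L a (val a).
  by move=> qa i' j'; exists (P i' j'), q; rewrite LE mxE.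
have := lax uv (valP u qu) (valP v qv) i j k l; rewrite !mxE.
move=> /(congr1 (fun x => (u - v) *: (q.[u] *: (q.[v] *: x)))).
have uv0 : u - v != 0 by rewrite subr_eq0.
have E0 : q.[u] *: (q.[v] *: bracket (q.[u]^-1 *: ev (P i j) u) (q.[v]^-1 *: ev (P k l) v)) =
    bracket (ev (P i j) u) (ev (P k l) v).
  rewrite /bracket -!scalerAl -!scalerAr !scalerBr !scalerA.
  by congr (_ - _); rewrite -[RHS]scale1r; congr (_ *: _); field; rewrite qu qv.
have E1 (y : R) : (u - v) *: (q.[u] *: (q.[v] *: ((u - v)^-1 *: (q.[v]^-1 *: y)))) = q.[u] *: y.
  by rewrite !scalerA; congr (_ *: _); field; rewrite qv uv0.
have E2 (y : R) : (u - v) *: (q.[u] *: (q.[v] *: ((u - v)^-1 *: (q.[u]^-1 *: y)))) = q.[v] *: y.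
  by rewrite !scalerA; congr (_ *: _); field; rewrite qu uv0.
rewrite E0 => ->; rewrite !(scalerDr, scalerN, scalerMnr) ; rewrite -!scalerMnr !E1 !E2.
by rewrite !mulrnBl opprB addrA addrAC.
Qed.

Lemma ev_comm (Q : {poly R}) (u : F) (Q' : {poly R}) : ev (Q * Q') u = ev Q u * ev Q' u.
Proof.
rewrite hornerM_comm // /comm_poly -scalerAl mul1r.
by rewrite -scalerAr mulr1.
Qed.

Lemma ev_polyA (p : {poly F}) u : ev (polyA R p) u = p.[u]%:A.
Proof. exact: horner_map. Qed.

(** For fixed [u] both sides are polynomials in [v] that agree at almost all
    scalars; the coefficients of their difference are then polynomials in [u],
    treated in the same way in [lax_coefs]. *)
Lemma lax_coef_v i j k l u b : q.[u] != 0 ->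
  let c := ev (P i j) u in
  bracket c (u *: (P k l)`_b - (P k l * 'X)`_b) =
  (q.[u] *: (P i l)`_b - q`_b *: ev (P i l) u) *+ (j == k)
  - (q.[u] *: (P k j)`_b - q`_b *: ev (P k j) u) *+ (l == i).
Proof.
move=> qu c.
pose Q := polyA R (u%:P - 'X) * (c%:P * P k l - P k l * c%:P)
  - ((q.[u]%:A *: P i l - polyA R q * (ev (P i l) u)%:P) *+ (j == k)
  - (q.[u]%:A *: P k j - polyA R q * (ev (P k j) u)%:P) *+ (l == i)).
have : Q = 0.
  apply: (poly_scalar_generic_eq0 char0 (q := q * ('X - u%:P))).
    by rewrite mulf_neq0 // polyXsubC_eq0.
  move=> v; rewrite hornerM mulf_eq0 negb_or hornerXsubC subr_eq0 => /andP[qv].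
  rewrite eq_sym => uv.
  rewrite /Q !(hornerD, hornerN, hornerMn, hornerZ, ev_comm, ev_polyA, hornerC, hornerX).
  have := lax_point i j k l uv qu qv; rewrite /bracket -/c => E.
  apply/eqP; rewrite subr_eq0; apply/eqP.
  by rewrite -scalerAl mul1r E -!scalerAl !mul1r.
move=> /(congr1 (fun p : {poly R} => p`_b)); rewrite coef0 /Q => /eqP.
rewrite coefB subr_eq0 => /eqP E.
have aux (x y : R) : bracket c (u *: x - y) = u%:A * (c * x - x * c) - (c * y - y * c).
  rewrite /bracket mulrBr mulrBl -scalerAr -scalerAl -[u%:A * _]scalerAl mul1r scalerBr.
  move: (u *: (c * x)) (u *: (x * c)) => e1 e2; nc tt.
have -> : bracket c (u *: (P k l)`_b - (P k l * 'X)`_b) =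
    (polyA R (u%:P - 'X) * (c%:P * P k l - P k l * c%:P))`_b.
  rewrite /polyA rmorphB /= map_polyC map_polyX /= mulrBl coefB coefCM coefXM !coefB !coefCM !coefMC.
  by rewrite coefMX aux; case: eqP => // _; rewrite mulr0 mul0r subrr.
rewrite E; rewrite coefB !coefMn !coefB !coefZ !coefMC coef_map /=.
by rewrite -!scalerAl !mul1r.
Qed.

Lemma lax_coefs i j k l a b :
  bracket (P i j * 'X)`_a (P k l)`_b - bracket (P i j)`_a (P k l * 'X)`_b =
  (q`_a *: (P i l)`_b - q`_b *: (P i l)`_a) *+ (j == k)
  - (q`_a *: (P k j)`_b - q`_b *: (P k j)`_a) *+ (l == i).
Proof.
set x := (P k l)`_b; set y := (P k l * 'X)`_b.
pose Q := (P i j * 'X * x%:P - x%:P * (P i j * 'X)) - (P i j * y%:P - y%:P * P i j)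
  - ((polyA R q * ((P i l)`_b)%:P - (q`_b)%:A *: P i l) *+ (j == k)
  - (polyA R q * ((P k j)`_b)%:P - (q`_b)%:A *: P k j) *+ (l == i)).
have : Q = 0.
  apply: (poly_scalar_generic_eq0 char0 q0) => u qu.
  rewrite /Q !(hornerD, hornerN, hornerMn, hornerZ, ev_comm, ev_polyA, hornerC, hornerX).
  have := lax_coef_v i j k l b qu; rewrite /= /bracket -/x -/y => E.
  apply/eqP; rewrite subr_eq0; apply/eqP.
  rewrite -!scalerAl !mul1r -E mulrBr mulrBl -!scalerAr mulr1 -!scalerAl.
  move: (P i j).[u%:A] => c0.
  move: (u *: (c0 * x)) (u *: (x * c0)) => e1 e2; nc tt.
move=> /(congr1 (fun p : {poly R} => p`_a)); rewrite coef0 /Q => /eqP.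
rewrite coefB subr_eq0 => /eqP.
rewrite !coefB !coefMn !coefB !coefZ !coefMC !coefCM coef_map /= -!scalerAl !mul1r.
by move=> <-; rewrite /bracket.
Qed.

Let e := poly_ser (polyA R q).
Let p i j := poly_ser (P i j).
Local Notation U := (inU R).
Local Notation V := (inV R).
Local Notation t := (uv_diff R false).

Lemma poly_ser_shift (Q : {poly R}) (m : int) : poly_ser Q (m - 1) = poly_ser (Q * 'X) m.
Proof.
case: m => [[|m]|m].
- by have -> : Posz 0 - 1 = Negz 0 by []; rewrite /= coefMX.
- have -> : Posz m.+1 - 1 = Posz m by lia.
  by rewrite /= coefMX.
- by have -> : Negz m - 1 = Negz m.+1 by lia.
Qed.

Lemma lax_poly_ser i j k l :
  t * (U (p i j) * V (p k l) - V (p k l) * U (p i j)) =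
  (U e * V (p i l) - V e * U (p i l)) *+ (j == k) - (U e * V (p k j) - V e * U (p k j)) *+ (l == i).
Proof.
apply: (@coef_uv_inj _ _ false) => a b; rewrite coef_uv_diff.
have zzB G G' a' b' : coef_uv false (G - G') a' b' = coef_uv false G a' b' - coef_uv false G' a' b' :> R by [].
have zzM G (c : bool) a' b' : coef_uv false (G *+ c) a' b' = coef_uv false G a' b' *+ c :> R by case: c.
have XE a' b' : coef_uv false (U (p i j) * V (p k l) - V (p k l) * U (p i j)) a' b' =
    bracket (poly_ser (P i j) a') (poly_ser (P k l) b') by rewrite zzB coef_uv_UV coef_uv_VU.
have YE f : coef_uv false (U e * V (poly_ser f) - V e * U (poly_ser f)) a b = e a * poly_ser f b - e b * poly_ser f a.
  by rewrite zzB coef_uv_UV coef_uv_VU.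
rewrite !XE zzB 2!zzM !YE !poly_ser_shift.
case: a {YE} => [a|a]; case: b => [b|b] /=; rewrite ?(mulr0, mul0r, subrr, mul0rn, coef_map) /bracket /=.
- by rewrite -!scalerAl !mul1r; exact: lax_coefs.
- by rewrite ?(mulr0, mul0r, subrr, mul0rn).
- by rewrite ?(mulr0, mul0r, subrr, mul0rn).
- by rewrite ?(mulr0, mul0r, subrr, mul0rn).
Qed.

Let Phi i j := rat_ser (L i j).

Lemma PhiE i j : Phi i j * e = p i j.
Proof. by rewrite /Phi LE rat_serE. Qed.

(** Division by the denominators in [u] and in [v], which are central. *)
Lemma lax_series : series_gaudin_lax false (map_mx (@rat_ser F R) L).
Proof.
pose g := qinv R q0; have eg : e * g = 1 := qinvP R q0.
have eC (f : laurent R) : e * f = f * e by exact: poly_ser_central.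
have eU (f : laurent R) : U e * U f = U f * U e by rewrite -!rmorphM eC.
have eV (f : laurent R) : V e * V f = V f * V e by rewrite -!rmorphM eC.
have cc (m : int) (x : R) : e m * x = x * e m.
  case: m => m /=; last by rewrite mulr0 mul0r.
  by rewrite coef_map /= -scalerAl -scalerAr mul1r mulr1.
have eUV (f : laurent R) : U e * V f = V f * U e.
  by apply: (@coef_uv_inj _ _ false) => a b; rewrite coef_uv_UV coef_uv_VU cc.
have eVU (f : laurent R) : V e * U f = U f * V e.
  by apply: (@coef_uv_inj _ _ false) => a b; rewrite coef_uv_UV coef_uv_VU cc.
have Ueg : U e * U g = 1 by rewrite -rmorphM eg rmorph1.
have Veg : V e * V g = 1 by rewrite -rmorphM eg rmorph1.
have main i j k l : t * (U (Phi i j) * V (Phi k l) - V (Phi k l) * U (Phi i j)) =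
   (V (Phi i l) - U (Phi i l)) *+ (j == k) - (V (Phi k j) - U (Phi k j)) *+ (l == i).
  have UP i' j' : U (p i' j') = U (Phi i' j') * U e by rewrite -PhiE rmorphM.
  have VP i' j' : V (p i' j') = V (Phi i' j') * V e by rewrite -PhiE rmorphM.
  have := lax_poly_ser i j k l.
  rewrite (UP i j) (VP k l) (VP i l) (UP i l) (VP k j) (UP k j).
  have [a1 a2 a3 a4] := And4 (eUV (Phi k l)) (eVU (Phi i j)) (eUV (Phi i l)) (eUV (Phi k j)).
  have [a5 a6 a7] := And3 (eVU (Phi i l)) (eVU (Phi k j)) (eUV g).
  move: (U e) (V e) (U g) (V g) Ueg Veg a1 a2 a3 a4 a5 a6 a7 => ue ve ug vg Ueg Veg.
  move: (V (Phi i l)) (V (Phi k j)) (U (Phi i l)) (U (Phi k j)) => v2 v3 u2 u3.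
  move: (U (Phi i j)) (V (Phi k l)) => u1 v1 a1 a2 a3 a4 a5 a6 a7.
  move: (j == k) (l == i) => b1 b2 H.
  have := congr1 (fun x => x * (vg * ug)) H.
  rewrite [X in X = _](_ : _ = t * (u1 * v1 - v1 * u1)); last first.
    nc (tt, Ueg, Veg, a1, a2, a7).
  move=> ->; case: b1 {H}; case: b2; rewrite ?(mulr1n, mulr0n);
    nc (tt, Ueg, Veg, a3, a4, a5, a6, a7).
move=> i j k l a b; rewrite !mxE -!/(Phi _ _).
have := congr1 (fun G => coef_uv false G a b) (main i j k l); rewrite coef_uv_diff.
have zzB G G' a' b' : coef_uv false (G - G') a' b' = coef_uv false G a' b' - coef_uv false G' a' b' :> R by [].
have zzM G (c : bool) a' b' : coef_uv false (G *+ c) a' b' = coef_uv false G a' b' *+ c :> R by case: c.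
have XE a' b' : coef_uv false (U (Phi i j) * V (Phi k l) - V (Phi k l) * U (Phi i j)) a' b' =
    ser_bracket false (Phi i j) (Phi k l) a' b' by rewrite zzB coef_uv_UV coef_uv_VU.
have YE f : coef_uv false (V f - U f) a b = ser_v false f a b - ser_u false f a b.
  by rewrite zzB coef_uv_inU coef_uv_inV.
rewrite !XE zzB 2!zzM !YE /mul_u_sub_v => ->.
by rewrite !mulrnBl opprB addrA addrAC.
Qed.

End RationalLaxSeries.

(** * Rational Lax matrices *)

Section Descent.
Variables (F : fieldType) (R : algType F).

Lemma ev_commute (P : {poly R}) (z : F) (c : R) : (forall i, P`_i * c = c * P`_i) ->
  P.[z%:A] * c = c * P.[z%:A].
Proof.
move=> Pc; rewrite horner_coef mulr_suml mulr_sumr; apply: eq_bigr => i _.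
have zc (x : R) m : z%:A ^+ m * x = x * z%:A ^+ m :> R.
  elim: m => [|m IH]; first by rewrite mulr1 mul1r.
  by rewrite exprS -mulrA IH !mulrA -scalerAl -scalerAr mul1r mulr1.
by rewrite -mulrA zc mulrA Pc mulrA.
Qed.

Lemma commutes_with_poly_ser E (f : ratfun R) (P : {poly R}) q : q != 0 -> f = rfrac P q ->
  commutes_with E (rat_ser f) -> forall i e, E e -> P`_i * e = e * P`_i.
Proof.
move=> q0 -> Cf i e Ee; have sub := commutes_with_subalg E.
have Cq : commutes_with E (poly_ser (polyA R q)).
  move=> [m|m] e' _ /=; last by rewrite mulr0 mul0r.
  by rewrite coef_map /= -scalerAl -scalerAr mul1r mulr1.
have := subM sub Cf Cq; rewrite rat_serE // => H; exact: (H i%:Z).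
Qed.

(** The numerators are the products of the expansions with scalar series, so
    their coefficients lie in the same centralizers. *)
Lemma series_rat_commute (f g : ratfun R) :
  series_commute false (rat_ser f) (rat_ser g) -> rational_commute f g.
Proof.
move=> /series_commuteP C z u x y [P [q [qz fE ->]]] [S [s [su gE ->]]].
have nz (p : {poly F}) a : p.[a] != 0 -> p != 0.
  by apply: contra_neq => ->; rewrite horner0.
pose E1 (e : R) := exists b : int, e = rat_ser g b.
have C1 : commutes_with E1 (rat_ser f) by move=> m e [b ->].
pose E2 (e : R) := exists a : nat, e = P`_a.
have C2 : commutes_with E2 (rat_ser g).
  move=> m e [a ->]; rewrite (commutes_with_poly_ser (nz _ _ qz) fE C1) //; by exists m.
rewrite /bracket -!scalerAl -!scalerAr (@ev_commute P z S.[u%:A]); last first.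
  move=> i; symmetry; apply: ev_commute => j.
  by apply: (commutes_with_poly_ser (nz _ _ su) gE C2); exists i.
by rewrite !scalerA mulrC subrr.
Qed.

Theorem rational_S_commute (n : nat) (L : 'M[ratfun R]_n) :
  (forall m : nat, m.+1%:R != 0 :> F) -> rational_gaudin_lax L ->
  (forall k p, rational_commute (S_ (ratfun_dz R) L k) (S_ (ratfun_dz R) L p)) /\
  (forall k p, rational_commute (S_ (ratfun_dz R) L k) (QH (ratfun_dz R) L p)).
Proof.
move=> char0 lax; have [q [P [q0 LE]]] := common_den L.
have slax := lax_series char0 lax q0 LE.
have Smap := S_map (@rat_ser_deriv F R) (@rat_ser_scale F R) L.
have Qmap := QH_map (@rat_ser_deriv F R) L.
split=> k p; apply: series_rat_commute; rewrite -?Smap -?Qmap.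
  exact: series_S_S.
exact: series_S_QH.
Qed.

End Descent.

Theorem theorem7 (K : realType) (R : algType K[i]) (n : nat) :
  (* L(z) with entries in R((z)) (inv = false) or R((z^-1)) (inv = true) *)
  (forall (inv : bool) (L : 'M[laurent R]_n),
     series_gaudin_lax inv L ->
     (forall k p : nat, (1 <= k)%N -> (1 <= p)%N ->
        series_commute inv (S_ (laurent_dz R inv) L k) (S_ (laurent_dz R inv) L p))
     /\
     (forall k p : nat, (1 <= k)%N -> (p <= n)%N ->
        series_commute inv (S_ (laurent_dz R inv) L k) (QH (laurent_dz R inv) L p)))
  /\
  (* L(z) rational in z *)
  (forall L : 'M[ratfun R]_n,
     rational_gaudin_lax L ->
     (forall k p : nat, (1 <= k)%N -> (1 <= p)%N ->
        rational_commute (S_ (ratfun_dz R) L k) (S_ (ratfun_dz R) L p))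
     /\
     (forall k p : nat, (1 <= k)%N -> (p <= n)%N ->
        rational_commute (S_ (ratfun_dz R) L k) (QH (ratfun_dz R) L p))).
Proof.
have char0 (m : nat) : m.+1%:R != 0 :> K[i] by rewrite pnatr_eq0.
split=> [inv L lax|L lax].
  by split=> k p _ _; [exact: series_S_S|exact: series_S_QH].
by have [SS SQ] := rational_S_commute char0 lax; split=> k p _ _.
Qed.
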